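(* Let $\Omega=\mathbb{R}^d\times B_R$ and $\Gamma$ be as in the context (full ball $B_R$), let $A,g,b$ and the parameters satisfy the structure conditions $(H_1)$ and $(H_2)$ of the context, and let $a:\mathbb{R}\to\mathbb{R}$ be a measurable, locally bounded function with $a(u)\operatorname{sign}u\ge\mu_1|u|^{p-1}$ for all $u\in\mathbb{R}$. (a) Assume $N-d>\max\left\{\frac{pq}{q-p+1},\frac{p^2}{p-1}\right\}$ and $\mu_1>0$. If $u\in W^{1,p}_{\mathrm{loc}}(\bar\Omega\setminus\Gamma)\cap L^\infty_{\mathrm{loc}}(\bar\Omega\setminus\Gamma)$ satisfies assumption $(A_1)$ of the context and is a weak solution in $\bar\Omega\setminus\Gamma$ of $$-\operatorname{div}[A(\nabla u)]+a(u)+g(u)=0\quad\text{in }\Omega,$$ then the singularity of $u$ at $\Gamma$ is removable. (b) Assume $N-d>\frac{pq}{q-p+1}$ and $\mu_1\ge0$. If $u\in W^{1,p}_{\mathrm{loc}}(\bar\Omega\setminus\Gamma;\vartheta_\alpha)\cap L^\infty_{\mathrm{loc}}(\bar\Omega\setminus\Gamma)$ satisfies assumption $(A_2)$ of the context and is a weak solution in $\bar\Omega\setminus\Gamma$ of $$-\operatorname{div}[(1+|x|)^{-\alpha}A(\nabla u)]+(1+|x|)^{-\alpha}a(u)+(1+|x|)^{-\alpha}g(u)=0\quad\text{in }\Omega,$$ then the singularity of $u$ at $\Gamma$ is removable.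
   Context: Setting. $N\ge3$, $d\in\{1,\dots,N-2\}$, $R\in(0,\infty]$, $B_R=\{(x_{d+1},\dots,x_N)\in\mathbb{R}^{N-d}: |(x_{d+1},\dots,x_N)|<R\}$, $\Omega=\mathbb{R}^d\times B_R$, $\Gamma=\{x\in\mathbb{R}^N: x_{d+1}=\cdots=x_N=0\}$. If $d=0$, $\Omega=B_R$ and $\Gamma=\{0\}$ (the variable $x''$ is then absent). Write $x'=(x_{d+1},\dots,x_N)$, $x''=(x_1,\dots,x_d)$, $\vartheta_\alpha(x)=(1+|x|)^{-\alpha}$, $d\vartheta_\alpha=\vartheta_\alpha\,dx$. Structure conditions. $A:\mathbb{R}^N\to\mathbb{R}^N$, $g,b:\mathbb{R}\to\mathbb{R}$ are measurable, with $g,b$ locally bounded. $(H_1)$: $A(\eta)\cdot\eta\ge\mu|\eta|^p$ and $|A(\eta)|\le\mu^{-1}|\eta|^{p-1}$ for all $\eta\in\mathbb{R}^N$; $g(u)\operatorname{sign}u\ge|u|^q$ and $b(u)\operatorname{sign}u\ge\mu_1|u|^{p-1}$ for all $u\in\mathbb{R}$; where $p\in(1,N)$, $\alpha,\beta\in[0,N)$, $p-1\le\beta-\alpha$, $q-p+1>0$, $\mu>0$, $\mu_1\ge0$. $(H_2)$: $A(-\eta)=-A(\eta)$ for all $\eta\in\mathbb{R}^N$. (The function $b$ and the exponent $\beta$ do not occur in the equations considered here.) Spaces. For a weight $w$ and open set $U$, $L^p(U;w)$ is the set of measurable $u$ with $\int_U|u|^pw\,dx<\infty$, and $W^{1,p}(U;w)=\{u\in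 L^p(U;w): |\nabla u|\in L^p(U;w)\}$. $W^{1,p}_{\mathrm{loc}}(\bar\Omega\setminus\Gamma;\vartheta_\alpha)$ is the set of $u:\Omega\to\mathbb{R}$ with $u\in W^{1,p}(U;\vartheta_\alpha)$ for every open $U\subset\Omega$ with $\bar U\cap\Gamma=\emptyset$; $L^\infty_{\mathrm{loc}}(\bar\Omega\setminus\Gamma)$ is defined similarly, as are $W^{1,p}_{\mathrm{loc}}(\overline{B_R}\setminus\{0\};(1+|x'|)^{-\alpha})$ and $L^\infty_{\mathrm{loc}}(\overline{B_R}\setminus\{0\})$. When no weight is written, the weight is $1$ ($\alpha=0$). Weak solution. In (b), $u$ is a weak solution in $\bar\Omega\setminus\Gamma$ if $$\int_\Omega\left(\langle A(\nabla u),\nabla\varphi\rangle+a(u)\varphi+g(u)\varphi\right)d\vartheta_\alpha=0\qquad( * )$$ for all $\varphi\in W^{1,p}_{\mathrm{loc}}(\bar\Omega\setminus\Gamma;\vartheta_\alpha)\cap L^\infty_{\mathrm{loc}}(\bar\Omega\setminus\Gamma)$ with $\operatorname{supp}\varphi\subset\bar\Omega\setminus\Gamma$. In (a) the same definition is used with $d\vartheta_\alpha$ and $\vartheta_\alpha$ replaced by $dx$ and $1$. Removability. The singularity of $u$ at $\Gamma$ is removable if $u\in W^{1,p}(\Omega;\vartheta_\alpha)\cap L^\infty(\Omega)$ and $( * )$ holds for all $\varphi\in W^{1,p}(\Omega;\vartheta_\alpha)\cap L^\infty(\Omega)$ (in (a), with $\vartheta_\alpha$ replaced by $1$). Assumption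 $(A_1)$. There are $\delta>d$ and $C_0>0$ such that for all $r_1,r_2\in(0,1)$ with $r_1<r_2$, $u^\pm(x)\le C_0\,m^\pm_{r_1,r_2}(1+|x''|)^{-\delta}$ for a.e. $x\in\Omega$ with $r_1<|x'|<r_2$, where $m^\pm_{r_1,r_2}=\operatorname{ess\,sup}\{u^\pm(x): x\in\Omega,\ r_1<|x'|<r_2\}$, $u^+=\max\{u,0\}$, $u^-=-\min\{u,0\}$. Assumption $(A_2)$. There are a number $q_1$ with $0<q_1<\frac{(N-d)(q-p+1)-pq}{2p}$ and functions $u_1\in W^{1,p}_{\mathrm{loc}}(\overline{B_R}\setminus\{0\};(1+|x'|)^{-\alpha})\cap L^\infty_{\mathrm{loc}}(\overline{B_R}\setminus\{0\})$ and $u_2\in W^{1,p}(\mathbb{R}^d;(1+|x''|)^{-\alpha})\cap L^{q+1}(\mathbb{R}^d;(1+|x''|)^{-\alpha})\cap L^{q_1}(\mathbb{R}^d;(1+|x''|)^{-\alpha})\cap L^\infty(\mathbb{R}^d)$ such that $u(x)=u_1(x')u_2(x'')$ and $u_2(x'')>0$ for every $x\in\Omega$, and $(u_2+|\nabla u_2|)^{p-1}\in L^1(\mathbb{R}^d;(1+|x''|)^{-\alpha})$. *)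

(* Defs.v *)
From HB Require Import structures.
From mathcomp Require Import all_boot all_order all_algebra.
From mathcomp Require Import all_classical all_reals all_analysis.
From mathcomp Require Import ess_sup_inf.

Set Implicit Arguments.
Unset Strict Implicit.
Unset Printing Implicit Defensive.

Import Order.TTheory GRing.Theory Num.Theory.
Import numFieldNormedType.Exports.

Local Open Scope classical_set_scope.
Local Open Scope ring_scope.

Definition measure_rV_display : measure_display -> measure_display.
Proof. exact. Qed.

(* 'rV[T]_n carries the sigma-algebra generated by the coordinates; for
   'rV[R]_n this is the Borel sigma-algebra. *)
Section measurable_rV.
Context {d} {T : measurableType d}.
Variable n : nat.

Let coors : 'I_n -> 'rV[T]_n -> T := fun i x => x ord0 i.

Let rV_set0 : g_sigma_preimage coors set0.
Proof. exact: sigma_algebra0. Qed.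

Let rV_setC A : g_sigma_preimage coors A -> g_sigma_preimage coors (~` A).
Proof. exact: sigma_algebraC. Qed.

Let rV_bigcup (F : _^nat) : (forall i, g_sigma_preimage coors (F i)) ->
  g_sigma_preimage coors (\bigcup_i (F i)).
Proof. exact: sigma_algebra_bigcup. Qed.

HB.instance Definition _ := @isMeasurable.Build (measure_rV_display d)
  'rV[T]_n (g_sigma_preimage coors) rV_set0 rV_setC rV_bigcup.

End measurable_rV.

Lemma measurable_coord_rV d (T : measurableType d) n (i : 'I_n) :
  measurable_fun [set: 'rV[T]_n] (fun x : 'rV[T]_n => x ord0 i).
Proof.
move=> _ Y mY; rewrite setTI; apply: sub_sigma_algebra => /=.
rewrite -bigcup_seq/=; exists i => /=; first by rewrite mem_index_enum.
by exists Y => //; rewrite setTI.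
Qed.

Lemma measurable_fun_rVP d1 d2 (T1 : measurableType d1) (T2 : measurableType d2)
    n (f : T1 -> 'rV[T2]_n) :
  (forall i, measurable_fun [set: T1] (fun t => f t ord0 i)) ->
  measurable_fun [set: T1] f.
Proof.
move=> mf; apply: (@measurability _ _ _ _ _ _
  (\big[setU/set0]_(i < n) preimage_set_system setT
     (fun x : 'rV[T2]_n => x ord0 i) measurable)) => //.
move=> _ [B + <-]; rewrite -bigcup_seq => -[i _ [C mC <-]].
by rewrite setTI; exact: mf.
Qed.

Section lebesgue_rV.
Context {R : realType}.

Definition consr n (x : R * 'rV[R]_n) : 'rV[R]_n.+1 :=
  \row_i (if unlift ord0 i is Some j then x.2 ord0 j else x.1).

Definition unconsr n (x : 'rV[R]_n.+1) : R * 'rV[R]_n :=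
  (x ord0 ord0, \row_i x ord0 (lift ord0 i)).

Lemma consrK n : cancel (@consr n) (@unconsr n).
Proof.
move=> [t x]; rewrite /unconsr /consr mxE unlift_none; congr (_, _).
by apply/rowP => i; rewrite !mxE liftK.
Qed.

Lemma measurable_consr n : measurable_fun [set: R * 'rV[R]_n] (@consr n).
Proof.
apply: measurable_fun_rVP => i; under eq_fun do rewrite mxE.
case: unliftP => [j|] _; last exact: measurable_fst.
exact: measurableT_comp (@measurable_coord_rV _ R n j) measurable_snd.
Qed.

Lemma measurable_unconsr n : measurable_fun [set: 'rV[R]_n.+1] (@unconsr n).
Proof.
apply/measurable_fun_pairP; split; first exact: measurable_coord_rV.
apply: measurable_fun_rVP => i; rewrite /unconsr/=.
by under eq_fun do rewrite mxE; exact: measurable_coord_rV.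
Qed.

(* One Fubini step: from Lebesgue measure on R^n to Lebesgue measure on R^n+1. *)
Section lebesgue_step.
Local Open Scope ereal_scope.
Variables (n : nat) (mu : {sigma_finite_measure set 'rV[R]_n -> \bar R}).

Definition lebesgue_step : set 'rV[R]_n.+1 -> \bar R :=
  pushforward (@lebesgue_measure R \x mu) (@consr n).

Let step0 : lebesgue_step set0 = 0.
Proof. by rewrite /lebesgue_step /pushforward preimage_set0 measure0. Qed.

Let step_ge0 A : 0 <= lebesgue_step A.
Proof. by rewrite /lebesgue_step /pushforward; exact: measure_ge0. Qed.

Let step_sigma_additive : semi_sigma_additive lebesgue_step.
Proof.
move=> F mF tF mUF; rewrite /lebesgue_step /pushforward preimage_bigcup.
apply: measure_semi_sigma_additive.
- by move=> k; rewrite -[X in measurable X]setTI; exact: measurable_consr.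
- apply/trivIsetP => /= i j _ _ ij; rewrite -preimage_setI.
  by move/trivIsetP : tF => /(_ _ _ _ _ ij) ->//; rewrite preimage_set0.
- by rewrite -preimage_bigcup -[X in measurable X]setTI; exact: measurable_consr.
Qed.

HB.instance Definition _ := isMeasure.Build _ _ _
  lebesgue_step step0 step_ge0 step_sigma_additive.

Let step_sigma_finite : sigma_finite setT lebesgue_step.
Proof.
have /sigma_finiteP[F [TF ndF Foo]] := sigma_finiteT (@lebesgue_measure R).
have /sigma_finiteP[G [TG ndG Goo]] := sigma_finiteT mu.
exists (fun k => @unconsr n @^-1` (F k `*` G k)).
  rewrite -preimage_bigcup -[LHS](preimage_setT (@unconsr n)); congr (_ @^-1` _).
  rewrite -setXTT TF TG predeqE => -[x y]; split.
    move=> [/= [i _ Fix] [j _ Gjy]]; exists (maxn i j) => //; split.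
    - by move: x Fix; exact/subsetPset/ndF/leq_maxl.
    - by move: y Gjy; exact/subsetPset/ndG/leq_maxr.
  by move=> [k _ []/= ? ?]; split; exists k.
move=> k; have [mF Fk] := Foo k; have [mG Gk] := Goo k; split.
  rewrite -[X in measurable X]setTI; apply: measurable_unconsr => //.
  exact: measurableX.
rewrite /lebesgue_step /pushforward -comp_preimage.
rewrite (_ : @unconsr n \o @consr n = id); last first.
  by apply/funext => x; exact: consrK.
by rewrite preimage_id product_measure1E// lte_mul_pinfty// ge0_fin_numE.
Qed.

HB.instance Definition _ := Measure_isSigmaFinite.Build _ _ _
  lebesgue_step step_sigma_finite.

End lebesgue_step.

(* On R^0, a single point, the measure is the unit mass. *)
Fixpoint lebesgue_rV n : {sigma_finite_measure set 'rV[R]_n -> \bar R} :=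
  if n is n'.+1 then lebesgue_step (lebesgue_rV n') else \d_(0 : 'rV[R]_0).

Lemma measurable_box n (A : 'I_n -> set R) : (forall i, measurable (A i)) ->
  measurable [set x : 'rV[R]_n | forall i, A i (x ord0 i)].
Proof.
move=> mA; rewrite (_ : mkset _ =
    \bigcap_(i in [set: 'I_n]) (fun x : 'rV[R]_n => x ord0 i) @^-1` A i).
  apply: fin_bigcap_measurable => [|i _]; first exact: finite_finset.
  by rewrite -[X in measurable X]setTI; exact: measurable_coord_rV.
by apply/seteqP; split => [x Ax i _|x Ax i]; exact: Ax.
Qed.

Lemma lebesgue_rV_box n (A : 'I_n -> set R) : (forall i, measurable (A i)) ->
  lebesgue_rV n [set x : 'rV[R]_n | forall i, A i (x ord0 i)] =
  (\prod_(i < n) @lebesgue_measure R (A i))%E.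
Proof.
elim: n A => [|n IHn] A mA.
  by rewrite big_ord0 /= diracE mem_set// => i; case: i.
rewrite big_ord_recl -IHn//= /lebesgue_step /pushforward.
rewrite (_ : _ @^-1` _ =
    A ord0 `*` [set x : 'rV[R]_n | forall i, A (lift ord0 i) (x ord0 i)]).
  apply: product_measure1E; first exact: mA.
  exact: (@measurable_box n (fun i => A (lift ord0 i)) (fun i => mA _)).
apply/seteqP; split=> [[t x] Atx|[t x] [/= At Ax] i].
  split=> [|i /=]; first by have := Atx ord0; rewrite mxE unlift_none.
  by have := Atx (lift ord0 i); rewrite mxE liftK.
by rewrite mxE; case: unliftP => [j ->|->].
Qed.

End lebesgue_rV.

Section sobolev.
Context {R : realType}.

Definition dotr n (x y : 'rV[R]_n) : R := \sum_(i < n) x ord0 i * y ord0 i.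

(* The Euclidean norm; the library norm `|x| on 'rV[R]_n is the sup norm, which
   has the same topology. *)
Definition enorm n (x : 'rV[R]_n) : R := Num.sqrt (dotr x x).

Definition unit_rV n (i : 'I_n) : 'rV[R]_n := delta_mx ord0 i.

Definition partials n (s : seq 'I_n) (f : 'rV[R]_n -> R) : 'rV[R]_n -> R :=
  foldr (fun i h => 'D_(unit_rV i) h) f s.

Definition smooth n (f : 'rV[R]_n -> R) : Prop :=
  forall s : seq 'I_n, continuous (partials s f) /\
    forall i x, derivable (partials s f) x (unit_rV i).

Definition test_function n (U : set 'rV[R]_n) (f : 'rV[R]_n -> R) : Prop :=
  [/\ smooth f, compact (closure [set x | f x != 0]) &
      closure [set x | f x != 0] `<=` U].

(* Measurability for the completed measure: f agrees a.e. on U with a Borel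
   function. Nothing is required on null sets (such as Gamma below), to which the
   integral and the essential supremum are insensitive. *)
Definition lebesgue_measurable_fun n (U : set 'rV[R]_n) (f : 'rV[R]_n -> R) :
    Prop :=
  exists2 h : 'rV[R]_n -> R, measurable_fun U h &
    {ae lebesgue_rV n, forall x, U x -> f x = h x}.

Definition loc_integrable n (U : set 'rV[R]_n) (f : 'rV[R]_n -> R) : Prop :=
  lebesgue_measurable_fun U f /\
  forall K, K `<=` U -> compact K ->
    (\int[lebesgue_rV n]_(x in K) `|f x|%:E < +oo)%E.

Definition weak_gradient n (U : set 'rV[R]_n) (u : 'rV[R]_n -> R)
    (G : 'rV[R]_n -> 'rV[R]_n) : Prop :=
  loc_integrable U u /\
  forall i, loc_integrable U (fun x => G x ord0 i) /\
    forall f, test_function U f ->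
      (\int[lebesgue_rV n]_(x in U) (u x * 'D_(unit_rV i) f x)%:E =
       - \int[lebesgue_rV n]_(x in U) (G x ord0 i * f x)%:E)%E.

(* The weak gradient is unique up to a null subset of U; grad U u is a chosen
   representative (and 0 when there is none). *)
Definition grad n (U : set 'rV[R]_n) (u : 'rV[R]_n -> R) :
  'rV[R]_n -> 'rV[R]_n := xget (fun=> 0) [set G | weak_gradient U u G].

Definition Lp n (p : R) (U : set 'rV[R]_n) (w u : 'rV[R]_n -> R) : Prop :=
  lebesgue_measurable_fun U u /\
  (\int[lebesgue_rV n]_(x in U) (`|u x| `^ p * w x)%:E < +oo)%E.

(* Essential supremum over U of a function f >= 0 (for which extending by 0 outside
   U is harmless). *)
Definition ess_sup_on n (U : set 'rV[R]_n) (f : 'rV[R]_n -> R) : \bar R :=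
  ess_sup (lebesgue_rV n) ((fun x => (f x)%:E) \_ U)%E.

Definition Linfty n (U : set 'rV[R]_n) (u : 'rV[R]_n -> R) : Prop :=
  lebesgue_measurable_fun U u /\
  (ess_sup_on U (fun x => `|u x|%R) < +oo)%E.

Definition W1p n (p : R) (U : set 'rV[R]_n) (w u : 'rV[R]_n -> R) : Prop :=
  [/\ Lp p U w u, weak_gradient U u (grad U u) &
      Lp p U w (fun x => enorm (grad U u x))].

(* Open subsets of D whose closure (in the whole space) misses S: the sets on
   which the spaces "loc" on closure D minus S are tested. They need not be
   bounded. *)
Definition away n (D S U : set 'rV[R]_n) : Prop :=
  [/\ open U, U `<=` D & closure U `&` S = set0].

Definition W1p_loc n (p : R) (D S : set 'rV[R]_n) (w u : 'rV[R]_n -> R) : Prop :=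
  forall U, away D S U -> W1p p U w u.

Definition Linfty_loc n (D S : set 'rV[R]_n) (u : 'rV[R]_n -> R) : Prop :=
  forall U, away D S U -> Linfty U u.

Definition vartheta n (alpha : R) (x : 'rV[R]_n) : R :=
  (1 + enorm x) `^ (- alpha).

End sobolev.

(* A point of R^N, N = d + m, is x = (x'', x') with x'' = lsubmx x in R^d and
   x' = rsubmx x in R^m; thus m is the codimension N - d. When d = 0 the factor
   R^d is a point, so that Omega is the ball and Gamma is {0}. *)
Section problem.
Context {R : realType}.

Definition oball m (rad : \bar R) : set 'rV[R]_m :=
  [set y | ((enorm y)%:E < rad)%E].

Definition Omega d m (rad : \bar R) : set 'rV[R]_(d + m) :=
  [set x | oball rad (rsubmx x)].

Definition Gamma d m : set 'rV[R]_(d + m) := [set x | rsubmx x = 0].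

Arguments Omega d m rad : clear implicits.

Record structure_H1 n (A : 'rV[R]_n -> 'rV[R]_n) (g b : R -> R)
    (p q alpha beta mu mu1 : R) : Prop := StructureH1 {
  H1_coercive : forall eta, mu * enorm eta `^ p <= dotr (A eta) eta ;
  H1_growth : forall eta, enorm (A eta) <= mu^-1 * enorm eta `^ (p - 1) ;
  H1_g : forall t, `|t| `^ q <= g t * Num.sg t ;
  H1_b : forall t, mu1 * `|t| `^ (p - 1) <= b t * Num.sg t ;
  H1_p : 1 < p < n%:R ;
  H1_alpha : 0 <= alpha < n%:R ;
  H1_beta : 0 <= beta < n%:R ;
  H1_alpha_beta : p - 1 <= beta - alpha ;
  H1_q : 0 < q - p + 1 ;
  H1_mu : 0 < mu ;
  H1_mu1 : 0 <= mu1 }.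

Definition structure_H2 n (A : 'rV[R]_n -> 'rV[R]_n) : Prop :=
  forall eta, A (- eta) = - A eta.

Definition loc_bounded (f : R -> R) : Prop :=
  forall t : R, exists M : R, \forall s \near t, `|f s| <= M.

(* The integral identity for one test function phi, with weight w, the gradients
   being taken in D. Integrability is part of "the integral equals 0". *)
Definition integral_identity n (Om D : set 'rV[R]_n) (w : 'rV[R]_n -> R)
    (A : 'rV[R]_n -> 'rV[R]_n) (a g : R -> R) (u phi : 'rV[R]_n -> R) : Prop :=
  let F := fun x => (dotr (A (grad D u x)) (grad D phi x)
                     + a (u x) * phi x + g (u x) * phi x) * w x in
  [/\ lebesgue_measurable_fun Om F,
      (\int[lebesgue_rV n]_(x in Om) `|F x|%:E < +oo)%E &
      (\int[lebesgue_rV n]_(x in Om) (F x)%:E = 0)%E].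

(* A function of the class W1p_loc has a gradient on D minus S only. The support
   is a subset of closure D by construction. *)
Definition weak_solution n (p : R) (D S : set 'rV[R]_n) (w : 'rV[R]_n -> R)
    (A : 'rV[R]_n -> 'rV[R]_n) (a g : R -> R) (u : 'rV[R]_n -> R) : Prop :=
  forall phi, W1p_loc p D S w phi -> Linfty_loc D S phi ->
    closure (D `&` [set x | phi x != 0]) `&` S = set0 ->
    integral_identity D (D `\` S) w A a g u phi.

Definition removable n (p : R) (D : set 'rV[R]_n) (w : 'rV[R]_n -> R)
    (A : 'rV[R]_n -> 'rV[R]_n) (a g : R -> R) (u : 'rV[R]_n -> R) : Prop :=
  [/\ W1p p D w u, Linfty D u &
    forall phi, W1p p D w phi -> Linfty D phi ->
      integral_identity D D w A a g u phi].

Definition strip d m (rad : \bar R) (r1 r2 : R) : set 'rV[R]_(d + m) :=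
  Omega d m rad `&` [set x | r1 < enorm (rsubmx x) < r2].

Definition decay d m (rad : \bar R) (delta C0 r1 r2 : R)
    (v : 'rV[R]_(d + m) -> R) : Prop :=
  {ae lebesgue_rV (d + m), forall x, strip rad r1 r2 x ->
    ((v x)%:E <= C0%:E * ess_sup_on (strip rad r1 r2) v
                 * ((1 + enorm (lsubmx x)) `^ (- delta))%:E)%E}.

Definition assumption_A1 d m (rad : \bar R) (u : 'rV[R]_(d + m) -> R) : Prop :=
  exists delta C0 : R, [/\ d%:R < delta, 0 < C0 &
    forall r1 r2 : R, 0 < r1 < 1 -> 0 < r2 < 1 -> r1 < r2 ->
      decay rad delta C0 r1 r2 (u ^\+) /\ decay rad delta C0 r1 r2 (u ^\-)].

Definition assumption_A2 d m (rad : \bar R) (p q alpha : R)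
    (u : 'rV[R]_(d + m) -> R) : Prop :=
  exists (q1 : R) (u1 : 'rV[R]_m -> R) (u2 : 'rV[R]_d -> R),
  [/\ 0 < q1 < (m%:R * (q - p + 1) - p * q) / (2 * p),
      W1p_loc p (oball rad) [set 0] (vartheta alpha) u1
        /\ Linfty_loc (oball rad) [set 0] u1,
      [/\ W1p p setT (vartheta alpha) u2, Lp (q + 1) setT (vartheta alpha) u2,
          Lp q1 setT (vartheta alpha) u2 & Linfty setT u2],
      (forall x, Omega d m rad x ->
        u x = u1 (rsubmx x) * u2 (lsubmx x) /\ 0 < u2 (lsubmx x)) &
      Lp 1 setT (vartheta alpha)
        (fun y => (u2 y + enorm (grad setT u2 y)) `^ (p - 1))].

End problem.

Arguments Omega {R} d m rad.
Arguments Gamma {R} d m.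

(* Main.v *)
From HB Require Import structures.
Require Import Defs.
From mathcomp Require Import all_boot all_order all_algebra.
From mathcomp Require Import all_classical all_reals all_analysis.
From mathcomp Require Import measurable_realfun simple_functions ess_sup_inf.
From mathcomp Require Import ring lra.

Set Implicit Arguments.
Unset Strict Implicit.
Unset Printing Implicit Defensive.

Import Order.TTheory GRing.Theory Num.Theory.
Import numFieldNormedType.Exports.

Local Open Scope classical_set_scope.
Local Open Scope ring_scope.

(** Absorption by |u|^q beats diffusion of order p - 1 near a set of codimension
    m > pq / (q - p + 1), so strongly that a solution away from Gamma vanishes
    almost everywhere; removability of the singularity is then immediate. Both
    equations are treated at once, for any Borel weight w with 0 < w <= 1.

    The energy estimate. Fix a level M > 0 and test the equation with
    phi = H(u) zeta^s E, where
    - H ([Htest]) is an odd C^1 function that is zero on [-M, M], has slow growth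
      |H(t)| <= |t|^(2 kap), and satisfies 2 kap |H(t)| <= H'(t) |t|;
    - zeta ([cutoff]) removes the tube of radius 1/k around Gamma, and its gradient
      is of order k and lives in a tube of radius of order 1/k;
    - E ([envelope]) is the product of the functions 1 / (1 + lam^2 x_i^2): it is
      integrable and |d_i E| <= lam E, so that the unboundedness of Omega costs an
      error that is a small multiple of the test function itself.
    Let F be the integrand of the weak formulation, whose integral is zero. Put
    e = p (q + 2 kap) / (q - p + 1). Pointwise ([absorption], [tested_lower]),
    1/2 |u|^q |H(u)| zeta^s E w <= F + C (s |grad zeta|)^e E. Indeed either the
    ellipticity of A dominates the cross term of A(grad u) with grad (zeta^s E), or
    |grad u| <= C |u| Y, with Y the logarithmic gradient of zeta^s E. In the second
    case the cross term is at most a multiple of |H(u)| |u|^(p-1) Y^p; either it is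
    absorbed by |u|^q |H(u)|, or |u|^(q-p+1) <= C Y^p and everything is bounded by
    a power of Y. The part of Y that comes from E is too small to matter because
    |u| > M and lam is small. The error is thus supported in a tube where E has mass
    O(k^(-m)), and it integrates to O(k^(e-m)) ([envelope_tube], [energy_bound]).
    As m > pq / (q - p + 1), a small kap gives e < m, and k -> oo yields |u| <= M
    almost everywhere ([level_bound]). Since M is arbitrary, u = 0 ([solution_eq0]).

    The chain rule. That phi is admissible requires the chain and product rules for
    weak gradients ([weak_gradient_chain]). They are obtained without mollifiers.
    Testing the definition of the weak derivative G_i with tensor products of
    one-dimensional bumps and their primitives gives
    u(x + t e_i) - u(x) = t * (integral over s in [0, 1] of G_i(x + s t e_i)) for
    almost every x ([line_identity]). Hence translates of u converge in L^1, and
    almost everywhere along dyadic steps ([ae_cvg_translates]). Difference quotients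
    of H(u) are difference quotients of H times those of u, and dominated
    convergence gives the derivative H'(u) G_i ([chain_local]).

    The conclusion. Removability asks for the identity on all of Omega, for test
    functions that need not vanish near Gamma. With u = 0 it reduces to
    a(0) + g(0) = 0, which follows by testing with zeta^2 E alone ([reaction0]). *)

(** * Boxes and Lebesgue measure on row vectors *)

Section boxes.
Context {R : realType} {n : nat}.
Implicit Types (x y v : 'rV[R]_n) (a b : 'I_n -> R).

Definition obox a b : set 'rV[R]_n := [set x | forall i, a i < x ord0 i < b i].
Definition cbox a b : set 'rV[R]_n := [set x | forall i, a i <= x ord0 i <= b i].

Lemma obox_cbox a b : obox a b `<=` cbox a b.
Proof. by move=> x h i; have /andP[/ltW -> /ltW ->] := h i. Qed.

Lemma oboxI a b c d : obox a b `&` obox c d =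
  obox (fun i => Num.max (a i) (c i)) (fun i => Num.min (b i) (d i)).
Proof.
apply/seteqP; split => x.
  move=> [h1 h2] i; rewrite gt_max lt_min.
  by have /andP[-> ->] := h1 i; have /andP[-> ->] := h2 i.
move=> h; split=> i; have := h i; rewrite gt_max lt_min.
  by move=> /andP[/andP[-> _] /andP[-> _]].
by move=> /andP[/andP[_ ->] /andP[_ ->]].
Qed.

Lemma cboxI a b c d : cbox a b `&` cbox c d =
  cbox (fun i => Num.max (a i) (c i)) (fun i => Num.min (b i) (d i)).
Proof.
apply/seteqP; split => x.
  move=> [h1 h2] i; rewrite ge_max le_min.
  by have /andP[-> ->] := h1 i; have /andP[-> ->] := h2 i.
move=> h; split=> i; have := h i; rewrite ge_max le_min.
  by move=> /andP[/andP[-> _] /andP[-> _]].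
by move=> /andP[/andP[_ ->] /andP[_ ->]].
Qed.

Lemma measurable_obox a b : measurable (obox a b).
Proof.
rewrite (_ : obox a b = [set x | forall i, `]a i, b i[%classic (x ord0 i)]).
  exact: (@measurable_box _ _ (fun i => `]a i, b i[%classic)).
by apply/seteqP; split => x h i; have := h i; rewrite /= in_itv.
Qed.

Lemma compact_cbox a b : compact (cbox a b).
Proof.
rewrite (_ : cbox a b = [set x | forall i, `[a i, b i]%classic (x ord0 i)]).
  apply: (@rV_compact _ _ (fun i => `[a i, b i]%classic)) => i.
  exact: segment_compact.
by apply/seteqP; split => x h i; have := h i; rewrite /= in_itv.
Qed.

Lemma rV_ballP x e y :
  ball x e y <-> 0 < e /\ forall i, `|x ord0 i - y ord0 i| < e.
Proof.
split=> [[e0 h]|[e0 h]]; split=> // i; first by have := h ord0 i.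
by move=> j; rewrite (ord1 i); exact: h.
Qed.

Lemma open_obox a b : open (obox a b).
Proof.
rewrite (_ : obox a b = \big[setI/setT]_(i < n)
   ((fun x : 'rV[R]_n => x ord0 i) @^-1` `]a i, b i[%classic)); last first.
  rewrite -bigcap_seq; apply/seteqP; split => x h i.
    by move=> _ /=; rewrite in_itv /=; exact: h.
  by have := h i; rewrite /= mem_index_enum in_itv => /(_ isT).
elim/big_ind : _ => [|A B|i _]; [exact: openT|exact: openI|].
apply: open_comp => [x _|]; first exact: coord_continuous.
exact: itv_open.
Qed.

Lemma closed_cbox a b : closed (cbox a b).
Proof. by apply: compact_closed; [exact: norm_hausdorff|exact: compact_cbox]. Qed.

Lemma open_obox_sub (U : set 'rV[R]_n) x : open U -> U x ->
  exists2 r, 0 < r & cbox (fun i => x ord0 i - r) (fun i => x ord0 i + r) `<=` U.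
Proof.
rewrite openE => /[apply]; rewrite /interior -nbhs_ballE => -[e /= e0 eU].
exists (e / 2); first by rewrite divr_gt0.
move=> y h; apply: eU; apply/rV_ballP; split => // i.
rewrite distrC (@le_lt_trans _ _ (e / 2))//; last lra.
by rewrite ler_distl; exact: h.
Qed.

Lemma compact_sub_cbox (K : set 'rV[R]_n) : compact K ->
  exists r, K `<=` cbox (fun=> - r) (fun=> r).
Proof.
move=> /compact_bounded; rewrite /bounded_set => -[M [Mr hM]].
exists (M + 1) => x Kx i; rewrite -ler_norml.
apply: le_trans (hM (M + 1) _ _ Kx); last by rewrite ltrDl.
have -> : `|x| = \big[Num.max/0]_ij `|x ij.1 ij.2| by exact: mx_normrE.
exact: (le_bigmax _ (fun ij : 'I_1 * 'I_n => `|x ij.1 ij.2|) (ord0, i)).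
Qed.

(** Every point of an open set lies in one of these countably many cubes, with the
    closed cube inside the open set; indexing them by [nat] through [unpickle] turns
    open sets into countable unions of boxes. *)
Definition rat_box (N : nat) : ('I_n -> R) * ('I_n -> R) :=
  if unpickle N is Some (c, k) then
    (fun i => ratr ((c : 'rV[rat]_n) ord0 i) - (k.+1%:R)^-1,
     fun i => ratr ((c : 'rV[rat]_n) ord0 i) + (k.+1%:R)^-1)
  else (fun=> 0, fun=> 0).

Lemma rat_box_cover (U : set 'rV[R]_n) x : open U -> U x ->
  exists2 N, obox (rat_box N).1 (rat_box N).2 x &
     cbox (rat_box N).1 (rat_box N).2 `<=` U.
Proof.
move=> oU Ux; have [r r0 rU] := open_obox_sub oU Ux.
have [k kr] : exists k : nat, k.+1%:R^-1 < r / 2 :> R.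
  have [k _ hk] := near_infty_natSinv_lt (PosNum (divr_gt0 r0 (ltr0n R 2))).
  by exists k; exact: (hk k (leqnn k)).
have kp : 0 < k.+1%:R^-1 :> R by rewrite invr_gt0 ltr0n.
have hq i : exists q : rat, x ord0 i - k.+1%:R^-1 < ratr q < x ord0 i + k.+1%:R^-1.
  have [|q] := @rat_in_itvoo R (x ord0 i - k.+1%:R^-1) (x ord0 i + k.+1%:R^-1).
    by rewrite ltrD2l gtrN.
  by rewrite in_itv /= => h; exists q.
have [q qP] := choice hq.
exists (pickle ((\row_i q i) : 'rV[rat]_n, k)); rewrite /rat_box pickleK /=.
  move=> i /=; rewrite !mxE; have := qP i.
  by move: (ratr (q i)) (_^-1) => ? ?; lra.
move=> y h; apply: rU => i; have := h i; rewrite /= !mxE; have := qP i.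
by move: (ratr (q i)) (_^-1) kr => ? ?; lra.
Qed.

Lemma open_bigcup_rat_box (U : set 'rV[R]_n) : open U ->
  U = \bigcup_(N in [set N | cbox (rat_box N).1 (rat_box N).2 `<=` U])
        obox (rat_box N).1 (rat_box N).2.
Proof.
move=> oU; apply/seteqP; split=> [x Ux|x [N NU]].
  by have [N] := rat_box_cover oU Ux; exists N.
by move/obox_cbox; exact: NU.
Qed.

Lemma open_measurable_rV (U : set 'rV[R]_n) : open U -> measurable U.
Proof.
move=> oU; rewrite (open_bigcup_rat_box oU).
by apply: bigcup_measurable => N _; exact: measurable_obox.
Qed.

Lemma closed_measurable_rV (U : set 'rV[R]_n) : closed U -> measurable U.
Proof.
by move=> cU; rewrite -(setCK U); apply: measurableC; by apply: open_measurable_rV; exact: closed_openC.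
Qed.

Lemma compact_measurable_rV (U : set 'rV[R]_n) : compact U -> measurable U.
Proof.
move=> cU; apply: closed_measurable_rV; apply: compact_closed => //.
Qed.

Lemma continuous_measurable_rV (f : 'rV[R]_n -> R) :
  continuous f -> measurable_fun setT f.
Proof.
move=> cf; apply: (measurability _ (RGenOpens.measurableE R)).
move=> _ [B [a [b ->]] <-]; rewrite setTI; apply: open_measurable_rV.
by apply: open_comp => [x _|]; [exact: cf|exact: itv_open].
Qed.

Definition oboxes : set (set 'rV[R]_n) := [set obox ab.1 ab.2 | ab in setT].

Lemma oboxes_setI : setI_closed oboxes.
Proof.
move=> _ _ [[a b] _ <-] [[c d] _ <-] /=; rewrite oboxI.
by exists ((fun i => Num.max (a i) (c i)), (fun i => Num.min (b i) (d i))).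
Qed.

Lemma oboxes_cover : \bigcup_k obox (fun=> - (k%:R : R)) (fun=> k%:R) = setT.
Proof.
apply/seteqP; split => // x _.
have [r xr] := compact_sub_cbox (@compact_set1 _ x).
exists (Num.trunc r).+1 => // i; have := xr x erefl i.
by have := truncnS_gt r; lra.
Qed.

(** A coordinate strip is a countable union of boxes, so boxes generate the product
    sigma-algebra. *)
Lemma rV_measurable_oboxes : @measurable _ 'rV[R]_n = <<s oboxes >>.
Proof.
apply/seteqP; split; last first.
  apply: smallest_sub; first exact: sigma_algebra_measurable.
  by move=> _ [[a b] _ <-]; exact: measurable_obox.
apply: smallest_sub; first exact: smallest_sigma_algebra.
rewrite -bigcup_seq => A [i _ [B mB <-]].
pose T := g_sigma_algebraType oboxes.
suff : measurable_fun (setT : set T) (fun x : T => (x : 'rV[R]_n) ord0 i) by exact.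
apply: (measurability _ (RGenOpens.measurableE R)).
move=> _ [C [a [b ->]] <-]; rewrite setTI.
rewrite [X in measurable X](_ : _ = \bigcup_k
    obox (fun j => if j == i then a else - k%:R)
         (fun j => if j == i then b else k%:R)).
  apply: bigcupT_measurable => k; apply: sub_sigma_algebra.
  by exists ((fun j => if j == i then a else - k%:R),
             (fun j => if j == i then b else k%:R)).
apply/seteqP; split => [x /=|x [k _ /(_ i)] /=]; last by rewrite eqxx in_itv.
rewrite in_itv/= => xab; have : setT x by [].
rewrite -oboxes_cover => -[k _ hk]; exists k => // j.
by case: eqP => [->//|_]; exact: hk.
Qed.

Local Notation mu := (@lebesgue_rV R n).

Lemma lebesgue_rV_obox a b : (forall i, a i <= b i) ->
  mu (obox a b) = (\prod_(i < n) (b i - a i))%:E.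
Proof.
move=> ab; rewrite (_ : obox a b = [set x | forall i, `]a i, b i[%classic (x ord0 i)]).
  rewrite (@lebesgue_rV_box _ _ (fun i => `]a i, b i[%classic)) //.
  rewrite -prodEFin; apply: eq_bigr => i _.
  rewrite lebesgue_measure_itv /= lte_fin; have := ab i.
  by rewrite le_eqVlt => /predU1P[->|->]; rewrite ?ltxx ?subrr ?EFinB.
by apply/seteqP; split => x h i; have := h i; rewrite /= in_itv.
Qed.

Lemma lebesgue_rV_obox_lty a b : (mu (obox a b) < +oo)%E.
Proof.
pose M i := `|a i| + `|b i|.
apply: (@le_lt_trans _ _ (mu (obox (fun i => - M i) M))).
  apply: le_measure; rewrite ?inE; [exact: measurable_obox|exact: measurable_obox|].
  move=> x h i; have := h i; rewrite /M.
  by have := ler_norm (b i); have := ler_norm (- a i); rewrite normrN;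
    have := normr_ge0 (a i); have := normr_ge0 (b i); lra.
rewrite lebesgue_rV_obox ?ltry// => i; rewrite /M.
by have := normr_ge0 (a i); have := normr_ge0 (b i); lra.
Qed.

(** Boxes are stable under intersection and exhaust the space, so that the
    uniqueness theorem for measures applies. *)
Lemma eq_measure_rV (m1 m2 : {measure set 'rV[R]_n -> \bar R}) :
  (forall a b, m1 (obox a b) = m2 (obox a b)) ->
  (forall a b, (m1 (obox a b) < +oo)%E) ->
  forall A, measurable A -> m1 A = m2 A.
Proof.
move=> m12 m1y; apply: (measure_unique oboxes (fun k => obox (fun=> - (k%:R : R)) (fun=> k%:R))).
- exact: rV_measurable_oboxes.
- exact: oboxes_setI.
- by move=> k; exists ((fun=> - (k%:R : R)), (fun=> k%:R)).
- exact: oboxes_cover.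
- by move=> _ [[a b] _ <-]; exact: m12.
- by move=> k; exact: m1y.
Qed.

Lemma measurable_shift v : measurable_fun setT (fun x : 'rV[R]_n => x + v).
Proof.
apply: measurable_fun_rVP => i; under eq_fun do rewrite mxE.
by apply: measurable_funD => //; exact: measurable_coord_rV.
Qed.

(** It suffices to compare both sides on boxes, where a translation moves the
    endpoints. *)
Lemma lebesgue_rV_shift v A : measurable A ->
  mu ((fun x => x + v) @^-1` A) = mu A.
Proof.
pose m0 : {measure set _ -> \bar R} := pushforward mu (fun x : 'rV[R]_n => x + v).
pose m1 := m0 (measurable_shift v).
have m1E B : m1 B = mu ((fun x => x + v) @^-1` B) by [].
have shE a b : (fun x : 'rV[R]_n => x + v) @^-1` obox a b =
    obox (fun i => a i - v ord0 i) (fun i => b i - v ord0 i).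
  by apply/seteqP; split => x h i; have := h i; rewrite ?mxE; lra.
move: A; apply: (@eq_measure_rV m1) => a b; rewrite m1E shE.
  have [ab|] := pselect (forall i, a i < b i).
    rewrite lebesgue_rV_obox; last by move=> i; rewrite lerD2r ltW.
    rewrite [RHS]lebesgue_rV_obox; last by move=> i; exact: ltW.
    by congr EFin; apply: eq_bigr => i _; ring.
  move=> /existsNP[i /negP]; rewrite -leNgt => ba.
  rewrite (_ : obox _ _ = set0); last first.
    by apply/seteqP; split => // x /(_ i); lra.
  rewrite (_ : obox a b = set0)//.
  by apply/seteqP; split => // x /(_ i); lra.
exact: lebesgue_rV_obox_lty.
Qed.

(** Almost everywhere statements are local: an open set is covered by countably many
    rational cubes, so only countably many null sets accumulate. *)
Lemma ae_open_local (U : set 'rV[R]_n) (P : 'rV[R]_n -> Prop) : open U ->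
  (forall a b, cbox a b `<=` U -> {ae mu, forall x, obox a b x -> P x}) ->
  {ae mu, forall x, U x -> P x}.
Proof.
move=> oU h.
have H N : {ae mu, forall x, cbox (rat_box N).1 (rat_box N).2 `<=` U ->
    obox (rat_box N).1 (rat_box N).2 x -> P x}.
  have [s|ns] := pselect (cbox (rat_box N).1 (rat_box N).2 `<=` U).
    by apply: filterS (h _ _ s) => x + _; exact.
  by apply: aeW => x /ns.
have : {ae mu, forall x, forall N, cbox (rat_box N).1 (rat_box N).2 `<=` U ->
    obox (rat_box N).1 (rat_box N).2 x -> P x} by exact: ae_foralln.
apply: filterS => x hx Ux; have [N h1 h2] := rat_box_cover oU Ux.
exact: hx h2 h1.
Qed.

End boxes.

(** * Integrals of functions that agree almost everywhere *)

Section integral_ae.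
Context d (T : measurableType d) (R : realType).
Variable mu : {measure set T -> \bar R}.
Local Open Scope ereal_scope.
Import HBNNSimple.

(** The integral of a nonnegative function is a supremum over the simple functions
    below it. A simple function below f, cut off on the null set where f and g
    differ, lies below g and has the same integral. *)
Let nnint_le (f g : T -> \bar R) : (forall x, 0 <= f x) -> (forall x, 0 <= g x) ->
  {ae mu, forall x, f x = g x} -> \int[mu]_x f x <= \int[mu]_x g x.
Proof.
move=> f0 g0 [N [mN N0 sN]].
rewrite !ge0_integralTE//; apply: ge_ereal_sup => _ [h /= hf <-].
have mNC := measurableC mN.
apply: ereal_sup_ubound; exists (proj_nnsfun h mNC).
  move=> x /=; rewrite mindicE; have [xN|xN] := boolP (x \in ~` N); last first.
    by rewrite mulr0.
  rewrite mulr1; suff <- : f x = g x by exact: hf.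
  by apply: contrapT => fg; move: xN; rewrite inE; apply; exact: sN.
rewrite -!integralT_nnsfun; apply: ge0_ae_eq_integral => //.
- exact/measurable_EFinP.
- exact/measurable_EFinP.
- by move=> x _; rewrite lee_fin.
- by move=> x _; rewrite lee_fin.
exists N; split => // x /= hx; apply: contrapT => nx; apply: hx => _.
by rewrite mindicE mem_set ?mulr1.
Qed.

(** Functions in the definitions of weak gradient and of weak solution are only equal
    almost everywhere to Borel functions; this lemma replaces them by Borel
    representatives under the integral sign. *)
Lemma ae_integral_eq (D : set T) (f g : T -> \bar R) :
  {ae mu, forall x, D x -> f x = g x} ->
  \int[mu]_(x in D) f x = \int[mu]_(x in D) g x.
Proof.
move=> fg; rewrite integral_mkcond [RHS]integral_mkcond.
have {}fg : {ae mu, forall x, (f \_ D) x = (g \_ D) x}.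
  apply: filterS fg => x h; rewrite !patchE; case: ifPn => // /set_mem; exact: h.
rewrite integralE [RHS]integralE; congr (_ - _); apply/eqP; rewrite eq_le;
  apply/andP; split; apply: nnint_le => //.
- by apply: filterS fg => x h; rewrite !funeposE h.
- by apply: filterS fg => x h; rewrite !funeposE h.
- by apply: filterS fg => x h; rewrite !funenegE h.
- by apply: filterS fg => x h; rewrite !funenegE h.
Qed.

End integral_ae.

(** * Bump functions on the line and their primitives *)

Section smooth1.
Context {R : realType}.
Implicit Types (f g : R -> R) (P Q : {poly R}).

Fixpoint diffn k f : Prop :=
  if k is k'.+1 then exists2 f', (forall t : R, is_derive t (1 : R) f (f' t)) & diffn k' f'
  else True.

Definition cinf f := forall k, diffn k f.

Lemma diffn_pred k f : diffn k.+1 f -> diffn k f.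
Proof.
elim: k f => // k IH f [f' df f'k]; exists f' => //; exact: IH.
Qed.

Lemma diffnD k f g : diffn k f -> diffn k g -> diffn k (fun t => f t + g t).
Proof.
elim: k f g => // k IH f g [f' df f'k] [g' dg g'k].
exists (fun t => f' t + g' t); last exact: IH.
by move=> t; have := df t; have := dg t => ? ?; exact: is_deriveD.
Qed.

Lemma diffnM k f g : diffn k f -> diffn k g -> diffn k (fun t => f t * g t).
Proof.
elim: k f g => // k IH f g [f' df f'k] [g' dg g'k].
exists (fun t => f t * g' t + g t * f' t).
  by move=> t; have := df t; have := dg t => ? ?; exact: is_deriveM.
apply: diffnD; apply: IH => //; apply: diffn_pred.
  by exists f'.
by exists g'.
Qed.

Lemma diffn_cst k (c : R) : diffn k (fun=> c).
Proof.
elim: k c => // k IH c; exists (fun=> 0) => // t; exact: is_derive_cst.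
Qed.

Lemma is_derive_affine (c d t : R) : is_derive t (1 : R) (fun t => c * t + d) c.
Proof.
apply: (is_derive_eq (f' := _)); last by rewrite addr0 -[RHS]mulr1.
Qed.

Lemma is_derive_comp_affine (f : R -> R) (f' c d : R) t : is_derive (c * t + d) (1 : R) f f' ->
  is_derive t (1 : R) (fun t => f (c * t + d)) (f' * c).
Proof. by move=> h; apply: (@is_derive1_comp _ f (fun t => c * t + d)); exact: is_derive_affine. Qed.

Lemma diffn_affine k f (c d : R) : diffn k f -> diffn k (fun t => f (c * t + d)).
Proof.
elim: k f => // k IH f [f' df f'k]; exists (fun t => f' (c * t + d) * c).
  by move=> t; exact: is_derive_comp_affine.
by apply: diffnM; [exact: IH|exact: diffn_cst].
Qed.

Lemma cinfM f g : cinf f -> cinf g -> cinf (fun t => f t * g t).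
Proof. by move=> cf cg k; exact: diffnM. Qed.

Lemma cinf_affine f c d : cinf f -> cinf (fun t => f (c * t + d)).
Proof. by move=> cf k; exact: diffn_affine. Qed.

Lemma cinf_is_derive f t : cinf f -> is_derive t (1 : R) f (derive1 f t).
Proof.
move=> /(_ 1%N)[f' df _]; have := df t => h.
by rewrite derive1E derive_val.
Qed.

Lemma cinf_derive f : cinf f -> cinf (derive1 f).
Proof.
move=> cf k; have [f' df f'k] := cf k.+1.
rewrite (_ : derive1 f = f') //; apply/funext => t.
by rewrite derive1E; have := df t => ?; rewrite derive_val.
Qed.

Lemma cinf_derive1n f k : cinf f -> cinf (derive1n k f).
Proof. by move=> cf; elim: k => // k; rewrite derive1nS; exact: cinf_derive. Qed.

Lemma is_derive_continuous f (f' t : R) : is_derive t (1 : R) f f' -> {for t, continuous f}.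
Proof.
by move=> [df _]; apply/differentiable_continuous/derivable1_diffP.
Qed.

Lemma cinf_continuous f : cinf f -> continuous f.
Proof. by move=> cf t; exact: is_derive_continuous (cinf_is_derive t cf). Qed.

(** The functions P(1/t) exp(-1/t), extended by zero to t <= 0, form a class that is
    stable under differentiation; this makes their smoothness an induction. *)
Definition flat P (t : R) : R := if 0 < t then P.[t^-1] * expR (- t^-1) else 0.

(** Monomial by monomial: x^j / j! is a term of the exponential series. *)
Lemma poly_le_expR P : exists C : R, forall x, 0 <= x -> `|P.[x]| <= C * expR x.
Proof.
exists (\sum_(i < size P) `|P`_i| * i`!%:R) => x x0.
rewrite horner_coef (le_trans (ler_norm_sum _ _ _))// mulr_suml.
apply: ler_sum => i _; rewrite normrM -mulrA ler_wpM2l//.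
rewrite ger0_norm ?exprn_ge0//.
have fp : 0 < (i`!%:R : R) by rewrite ltr0n fact_gt0.
case: (nat_of_ord i) fp => [|j] fp.
  by rewrite expr0 fact0 mul1r -expR0 ler_expR.
have := expR_ge1Dxn j x0; rewrite -ler_pdivrMl// mulrC.
by apply: le_trans; rewrite lerDr.
Qed.

(** With [flat_bounded], this factor t gives both the continuity of [flat P] and its
    differentiability at 0. *)
Lemma flatMX P t : flat P t = flat ('X * P) t * t.
Proof.
rewrite /flat; case: ifPn; rewrite ?mul0r// => t0.
rewrite hornerM hornerX; move: (expR _) (P.[_]) => E Q; field.
by rewrite gt_eqF.
Qed.

Lemma flat_bounded P : exists C : R, forall t, `|flat P t| <= C.
Proof.
have [C hC] := poly_le_expR P; exists C => t; rewrite /flat.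
have C0 : 0 <= C.
  have := hC 0 (lexx _); rewrite expR0 mulr1; exact: le_trans.
case: ifPn => t0; last by rewrite normr0.
have := hC t^-1; rewrite invr_ge0 ltW// => /(_ isT) h.
rewrite normrM (ger0_norm (expR_ge0 _)) expRN ler_pdivrMr ?expR_gt0//.
Qed.

Lemma flat_continuous0 P : {for 0, continuous (flat P)}.
Proof.
have [C hC] := flat_bounded ('X * P).
have f0 : flat P 0 = 0 by rewrite /flat ltxx.
apply/cvgrPdist_le => /= e e0; rewrite f0.
have C1 : 0 < `|C| + 1 by rewrite ltr_wpDl.
near=> t; rewrite sub0r normrN flatMX normrM.
apply: (@le_trans _ _ ((`|C| + 1) * `|t|)).
  rewrite ler_wpM2r// (le_trans (hC t))//.
  by rewrite (le_trans (ler_norm C))// lerDl.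
rewrite mulrC -ler_pdivlMr//.
near: t; exists (e / (`|C| + 1)); first exact: divr_gt0.
by move=> t /=; rewrite sub0r normrN; exact: ltW.
Unshelve. all: by end_near. Qed.

Lemma is_derive_flat P (t : R) :
  is_derive t (1 : R) (flat P) (flat ('X ^+ 2 * (P - P^`())) t).
Proof.
have [t0|t0|->] := ltrgtP t 0; last 1 first.
- apply/is_derive1_caratheodory; exists (flat ('X * P)); split.
  + by move=> z; rewrite subr0 -flatMX {2}/flat ltxx subr0.
  + exact: flat_continuous0.
  + by rewrite /flat ltxx.
- have -> : flat ('X ^+ 2 * (P - P^`())) t = 0 by rewrite /flat ltNge ltW.
  have h : is_derive t (1 : R) (cst (0 : R)) 0 by exact: is_derive_cst.
  apply: near_eq_is_derive h.
  near=> s; rewrite /flat ifF//; apply/negbTE; rewrite -leNgt ltW//.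
  by near: s; exact: lt_nbhsl.
have d1 : is_derive t (1 : R) (fun s : R => s^-1) (- t ^- 2).
  have e1 : (- t ^- 2 *: (1 : R)) = - t ^- 2 :> R by exact: mulr1.
  by rewrite -e1; apply: is_deriveV; rewrite gt_eqF.
have d2 := @is_derive1_comp _ (horner P) (fun s : R => s^-1) t _ _ (is_derive_poly P t^-1) d1.
have d3 := is_deriveN d1.
have d4 := @is_derive1_comp _ expR (- (fun s : R => s^-1)) t _ _ (is_derive_expR _) d3.
have d5 := is_deriveM d2 d4.
have -> : flat ('X ^+ 2 * (P - P^`())) t =
   (horner P \o (fun s : R => s^-1)) t *: (expR ((- (fun s : R => s^-1)) t) * - - t ^- 2) +
    (expR \o - (fun s : R => s^-1)) t *: (P^`().[t^-1] * - t ^- 2).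
  rewrite /flat t0 !hornerE /= exprVn -![_ *: _]/(_ * _).
  rewrite -![(- (fun s : R => s^-1)) t]/(- t^-1).
  by move: (expR _) (P.[_]) (P^`().[_]) (t^-2) => a b c d; ring.
apply: near_eq_is_derive d5.
near=> s; rewrite /= /flat ifT//.
by near: s; exact: lt_nbhsr.
Unshelve. all: by end_near. Qed.

Lemma cinf_flat P : cinf (flat P).
Proof.
move=> k; elim: k P => // k IH P.
by exists (flat ('X ^+ 2 * (P - P^`()))) => // t; exact: is_derive_flat.
Qed.

(** The factor k.+1 makes the bumps converge pointwise to the indicator of the open
    interval from a to b. *)
Definition bump (a b : R) (k : nat) (t : R) : R :=
  flat 1 (k.+1%:R * (t - a)) * flat 1 (k.+1%:R * (b - t)).

Lemma flat1_ge0 t : 0 <= flat 1 t.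
Proof. by rewrite /flat; case: ifP; rewrite // hornerE mul1r expR_ge0. Qed.

Lemma flat1_le1 t : flat 1 t <= 1.
Proof.
rewrite /flat; case: ifP => // t0; rewrite hornerE mul1r expR_le1.
by rewrite oppr_le0 invr_ge0 ltW.
Qed.

Lemma bump_ge0 a b k t : 0 <= bump a b k t.
Proof. by rewrite mulr_ge0 ?flat1_ge0. Qed.

Lemma bump_le1 a b k t : bump a b k t <= 1.
Proof.
by rewrite -[1]mulr1 ler_pM ?flat1_ge0 ?flat1_le1.
Qed.

Lemma bump_out a b k t : ~~ (a < t < b) -> bump a b k t = 0.
Proof.
rewrite negb_and -!leNgt /bump /flat => /orP[h|h].
  by rewrite ifF ?mul0r// pmulr_rgt0 ?ltr0n// subr_gt0 ltNge h.
by rewrite [X in _ * X]ifF ?mulr0// pmulr_rgt0 ?ltr0n// subr_gt0 ltNge h.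
Qed.

Lemma cinf_bump a b k : cinf (bump a b k).
Proof.
apply: cinfM.
  rewrite (_ : (fun t => _) = (fun t => flat 1 (k.+1%:R * t + - k.+1%:R * a))).
    exact/cinf_affine/cinf_flat.
  by apply/funext => t; rewrite mulrBr mulNr.
rewrite (_ : (fun t => _) = (fun t => flat 1 (- k.+1%:R * t + k.+1%:R * b))).
  exact/cinf_affine/cinf_flat.
by apply/funext => t; rewrite mulrBr mulNr addrC.
Qed.

Lemma flat1_cvg (c : R) : 0 < c -> flat 1 (k.+1%:R * c) @[k --> \oo] --> (1 : R).
Proof.
move=> c0; rewrite -[X in _ --> X](@expR0 R).
have -> : (fun k => flat 1 (k.+1%:R * c)) = (fun k : nat => expR (- (k.+1%:R^-1 * c^-1))).
  apply/funext => k; rewrite /flat ifT ?mulr_gt0 ?ltr0n//.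
  by rewrite hornerE mul1r invfM.
apply: continuous_cvg; first exact: continuous_expR.
rewrite -oppr0; apply: cvgN; rewrite -(mul0r c^-1); apply: cvgMl.
exact: cvg_harmonic.
Qed.

Lemma bump_cvg a b t : bump a b k t @[k --> \oo] --> ((a < t < b)%R%:R : R).
Proof.
have [/andP[h1 h2]|h] := boolP (a < t < b).
  rewrite -subr_gt0 in h1; rewrite -subr_gt0 in h2.
  rewrite mulr1n -[X in _ --> X](mulr1 1).
  exact: (cvgM (flat1_cvg h1) (flat1_cvg h2)).
rewrite /= (_ : (fun k => _) = (fun=> 0)); first exact: cvg_cst.
by apply/funext => k; rewrite bump_out.
Qed.

Local Notation leb := (@lebesgue_measure R).

Lemma bump_integrable a b k : leb.-integrable setT (EFin \o bump a b k).
Proof.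
have mb : measurable_fun setT (bump a b k).
  apply: continuous_measurable_fun; exact/cinf_continuous/cinf_bump.
have h : leb.-integrable setT (EFin \o \1_`[a, b]).
  apply/integrableP; split; first exact/measurable_EFinP.
  under eq_integral do rewrite /= ger0_norm//.
  by rewrite integral_indic// setIT [X in (X < _)%E]lebesgue_measure_itv/=; case: ifP; rewrite // ltry.
apply: le_integrable h => //.
- exact/measurable_EFinP.
- move=> t _ /=; rewrite lee_fin ger0_norm ?bump_ge0// ger0_norm ?ler0n//.
  rewrite indicE; case: (boolP (t \in _)) => [_|]; first exact: bump_le1.
  rewrite notin_setE /= in_itv /= => h; rewrite bump_out//.
  by apply/negP => /andP[h1 h2]; apply: h; rewrite !ltW.
Qed.

Definition bump_prim a b k (y : R) : R :=
  (\int[leb]_(s in [set` Interval -oo%O (BRight y)]) bump a b k s)%R.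

Lemma is_derive_bump_prim a b k (y : R) :
  is_derive y (1 : R) (bump_prim a b k) (bump a b k y).
Proof.
have [||||d1 d2] := @continuous_FTC1 R (bump a b k) -oo%O y (y + 1).
- by rewrite ltrDl.
- exact: integrableS (bump_integrable a b k).
- by rewrite /= ltNyr.
- exact/cinf_continuous/cinf_bump.
- by split; [exact: d1|rewrite -derive1E; exact: d2].
Qed.

(** A primitive of a bump does not vanish at +oo, but its difference with a translate
    of itself has compact support: it is an admissible profile, whose derivative is
    a difference of bumps. *)
Definition bump_diff (t : R) a b k (y : R) : R :=
  bump_prim a b k y - bump_prim a b k (y - t).

Lemma is_derive_bump_diff t a b k (y : R) :
  is_derive y (1 : R) (bump_diff t a b k) (bump a b k y - bump a b k (y - t)).
Proof.
apply: is_deriveB; first exact: is_derive_bump_prim.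
have h := is_derive_bump_prim a b k (y - t).
have := @is_derive1_comp _ (bump_prim a b k) (fun s => s - t) y _ 1 h.
by rewrite mulr1; apply; exact: is_derive_shift.
Qed.

Lemma cinf_bump_diff t a b k : cinf (bump_diff t a b k).
Proof.
case=> // n; exists (fun y => bump a b k y - bump a b k (y - t)).
  by move=> y; exact: is_derive_bump_diff.
rewrite (_ : (fun y => _) = fun y => bump a b k y + (-1) * bump a b k (1 * y + - t)).
  apply: diffnD; first exact: cinf_bump.
  apply: diffnM; first exact: diffn_cst.
  exact/diffn_affine/cinf_bump.
by apply/funext => y; rewrite mulN1r mul1r.
Qed.

(** The fundamental theorem of calculus, in the form that appears when a bump is
    sheared; it also shows where [bump_diff] is supported. *)
Lemma bump_diffE t a b k y :
  (\int[leb]_(s in `[0%R, 1%R]) (t * bump a b k (y - t * s)%R)%:E)%E =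
  (bump_diff t a b k y)%:E.
Proof.
pose F s := - bump_prim a b k (y - t * s).
have dF (s : R) : is_derive s (1 : R) F (t * bump a b k (y - t * s)).
  have h := is_derive_bump_prim a b k (y - t * s).
  have h2 : is_derive s (1 : R) (fun s => y - t * s) (- t).
    have := is_derive_affine (- t) y s.
    by under eq_fun do rewrite mulNr addrC.
  have h3 := is_deriveN (@is_derive1_comp _ (bump_prim a b k) (fun s => y - t * s) s _ _ h h2).
  by rewrite mulrN opprK mulrC in h3.
have cF : continuous F by move=> s; exact: is_derive_continuous (dF s).
rewrite (@continuous_FTC2 _ _ F)//.
- by rewrite /F mulr0 subr0 mulr1 -EFinB /bump_diff; congr EFin; lra.
- apply: continuous_subspaceT => s.
  apply: (@continuousM _ _ (fun=> t) (fun s => bump a b k (y - t * s))).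
    exact: cvg_cst.
  apply: (@continuous_comp _ _ _ (fun s => y - t * s) (bump a b k)).
    apply: cvgB; first exact: cvg_cst.
    by apply: cvgM; [exact: cvg_cst|exact: cvg_id].
  exact/cinf_continuous/cinf_bump.
- split; first by move=> s _; have [] := dF s.
    exact: cvg_at_right_filter (cF 0).
  exact: cvg_at_left_filter (cF 1).
- by move=> s _; rewrite derive1E; have [_ ->] := dF s.
Qed.

Lemma bump_diff_out t a b k y :
  ~~ (Num.min a (a + t) < y < Num.max b (b + t)) -> bump_diff t a b k y = 0.
Proof.
move=> h; apply: EFin_inj; rewrite -bump_diffE integral0_eq// => s.
rewrite /= in_itv/= => /andP[s0 s1]; rewrite bump_out ?mulr0//.
apply: contra h; rewrite gt_min lt_max => /andP[h1 h2].
have [t0|t0] := leP 0 t.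
  have st : 0 <= t * s <= t by rewrite mulr_ge0//= ler_piMr.
  by apply/andP; split; apply/orP; [left|right]; lra.
have st : t <= t * s <= 0 by rewrite ler_niMr ?nmulr_rle0// ltW.
by apply/andP; split; apply/orP; [right|left]; lra.
Qed.

End smooth1.

(** * Tensor products as test functions *)

Section tensors.
Context {R : realType} {n : nat}.
Implicit Types (x v : 'rV[R]_n) (th : 'I_n -> R -> R).

(** Partial derivatives are ordinary derivatives along lines; derivatives in several
    variables are all computed through this equivalence. *)
Lemma is_derive_lineP (f : 'rV[R]_n -> R) x v df :
  is_derive (0 : R) (1 : R) (fun h => f (x + h *: v)) df <-> is_derive x v f df.
Proof.
have e : (fun h : R => h^-1 *: (((fun h => f (x + h *: v)) \o shift 0) (h *: (1 : R)) -
      (fun h => f (x + h *: v)) 0)) =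
    (fun h => h^-1 *: ((f \o shift x) (h *: v) - f x)).
  apply/funext => h /=; congr (_ *: (_ - _)).
    by rewrite addr0 [x + _]addrC; congr (f (_ *: _ + _)); exact: mulr1.
  by rewrite scale0r addr0.
by split=> -[]; rewrite /derivable /derive ?e => d1 d2; apply: DeriveDef;
  rewrite /derivable /derive ?e.
Qed.

Definition tens th x := \prod_(j < n) th j (x ord0 j).

Lemma coord_line x (i j : 'I_n) (h : R) :
  (x + h *: unit_rV i) ord0 j = x ord0 j + h * (j == i)%:R.
Proof. by rewrite /unit_rV !mxE eqxx. Qed.

Lemma is_derive_tens th i (dth : R -> R) x :
  (forall t : R, is_derive t (1 : R) (th i) (dth t)) ->
  is_derive x (unit_rV i) (tens th)
    (tens (fun j => if j == i then dth else th j) x).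
Proof.
move=> dthi; apply/is_derive_lineP; rewrite /tens (bigD1 i)//= eqxx.
pose C := \prod_(j < n | j != i) th j (x ord0 j).
rewrite (_ : (fun h => _) = (fun h => th i (1 * h + x ord0 i) * C)); last first.
  apply/funext => h; rewrite (bigD1 i)//= coord_line eqxx mulr1 mul1r addrC.
  congr (_ * _); apply: eq_bigr => j ji.
  by rewrite coord_line (negbTE ji) mulr0 addr0.
rewrite (_ : \prod_(j < n | _) _ = C); last first.
  by apply: eq_bigr => j /negbTE ->.
have h1 := is_derive_affine 1 (x ord0 i) (0 : R).
have h2 := dthi (1 * 0 + x ord0 i).
have h3 := @is_derive1_comp _ (th i) (fun t => 1 * t + x ord0 i) 0 _ _ h2 h1.
have h4 : is_derive (0 : R) (1 : R) (cst C) 0 by exact: is_derive_cst.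
have h5 := is_deriveM h3 h4.
apply: is_derive_eq h5 _.
by rewrite scaler0 add0r mulr1 mulr0 add0r /= mulrC.
Qed.

Lemma cinf_partials_tens th (s : seq 'I_n) : (forall j, cinf (th j)) ->
  partials s (tens th) = tens (fun j => derive1n (count_mem j s) (th j)).
Proof.
move=> cth; elim: s => [|i s IH] //=.
rewrite IH; apply/funext => x.
have /(@derive_val _ _ _ _ _ _ _) -> := @is_derive_tens
  (fun j => derive1n (count_mem j s) (th j)) i _ x
  (fun t => cinf_is_derive t (cinf_derive1n (count_mem i s) (cth i))).
apply: eq_bigr => j _; rewrite eq_sym; case: eqVneq => [->|] //=.
Qed.

Lemma continuous_tens th : (forall j, continuous (th j)) -> continuous (tens th).
Proof.
move=> cth; rewrite /tens; elim: (index_enum _) => [|j s IH].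
  have -> : (fun x0 : 'rV[R]_n => \prod_(j <- [::]) th j (x0 ord0 j)) = cst 1.
    by apply/funext => x; rewrite big_nil.
  exact: cst_continuous.
rewrite (_ : (fun x => _) = fun x => th j (x ord0 j) * \prod_(i <- s) th i (x ord0 i)).
  move=> x; apply: (@continuousM _ _ (fun x => th j (x ord0 j))
    (fun x => \prod_(i <- s) th i (x ord0 i))); last exact: IH.
  apply: (@continuous_comp _ _ _ (fun x : 'rV[R]_n => x ord0 j) (th j)).
    exact: coord_continuous.
  exact: cth.
by apply/funext => x; rewrite big_cons.
Qed.

Lemma smooth_tens th : (forall j, cinf (th j)) -> smooth (tens th).
Proof.
move=> cth s; rewrite cinf_partials_tens//; split.
  by apply: continuous_tens => j; exact/cinf_continuous/cinf_derive1n.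
move=> i x; have [] // := @is_derive_tens
  (fun j => derive1n (count_mem j s) (th j)) i _ x
  (fun t => cinf_is_derive t (cinf_derive1n (count_mem i s) (cth i))).
Qed.

Lemma test_function_tens th a b (U : set 'rV[R]_n) : (forall j, cinf (th j)) ->
  (forall j t, ~~ (a j < t < b j) -> th j t = 0) ->
  cbox a b `<=` U -> test_function U (tens th).
Proof.
move=> cth tho abU.
have sub : closure [set x | tens th x != 0] `<=` cbox a b.
  have -> : cbox a b = closure (cbox a b) by apply/closure_id; exact: closed_cbox.
  apply: closure_subset => x /= nz i.
  apply/andP; apply: contrapT => h; move/negP: nz; apply; apply/eqP.
  rewrite /tens (bigD1 i)//= tho ?mul0r//.
  by apply/negP => /andP[h1 h2]; apply: h; rewrite !ltW.
split; [exact: smooth_tens| |exact: subset_trans abU].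
by apply: subclosed_compact sub; [exact: closed_closure|exact: compact_cbox].
Qed.

End tensors.

(** * Real-valued integrable functions *)

Section real_integrals.
Context d (T : measurableType d) (R : realType).
Variable mu : {measure set T -> \bar R}.
Implicit Types f g : T -> R.

Definition L1 f := mu.-integrable setT (EFin \o f).

Lemma L1_measurable f : L1 f -> measurable_fun setT f.
Proof. by move=> /integrableP[/measurable_EFinP]. Qed.

Lemma L1_le f g : measurable_fun setT f -> (forall x, `|f x| <= g x) -> L1 g -> L1 f.
Proof.
move=> mf fg ig; apply: le_integrable ig => //; first exact/measurable_EFinP.
by move=> x _ /=; rewrite lee_fin (le_trans (fg x))// ler_norm.
Qed.

Lemma L1_scale C f : L1 f -> L1 (fun x => C * f x).
Proof. exact: (@integrableZl _ _ _ mu setT measurableT C (EFin \o f)). Qed.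

Lemma L1M f (h : T -> R) (C : R) : L1 f -> measurable_fun setT h -> (forall x, `|h x| <= C) ->
  L1 (fun x => f x * h x).
Proof.
move=> if_ mh hC.
have iC : L1 (fun x => C * `|f x|) by apply/L1_scale/integrable_norm.
apply: L1_le iC; first by apply: measurable_funM => //; exact: L1_measurable.
by move=> x; rewrite normrM mulrC ler_wpM2r.
Qed.

Lemma L1D f g : L1 f -> L1 g -> L1 (fun x => f x + g x).
Proof. by move=> h1 h2; exact: (integrableD measurableT h1 h2). Qed.

Lemma L1B f g : L1 f -> L1 g -> L1 (fun x => f x - g x).
Proof. by move=> h1 h2; exact: (integrableB measurableT h1 h2). Qed.

Lemma L1_norm f : L1 f -> L1 (fun x => `|f x|).
Proof. exact: integrable_norm. Qed.

Lemma L1_EFin f : L1 f -> (\int[mu]_x (f x)%:E)%E = (\int[mu]_x f x)%:E.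
Proof. by move=> h; rewrite /Rintegral fineK// integrable_fin_num. Qed.

Lemma L1_indic f (A : set T) : measurable A -> L1 f -> L1 (fun x => f x * \1_A x).
Proof.
move=> mA if_; apply: (@L1M _ _ 1) => // x.
by rewrite indicE ger0_norm ?ler0n// lern1 leq_b1.
Qed.

Lemma integral_indicM f (A : set T) :
  (\int[mu]_(x in A) (f x)%:E = \int[mu]_x (f x * \1_A x)%:E)%E.
Proof.
rewrite integral_mkcond; apply: eq_integral => x _.
rewrite patchE indicE; case: ifP => /= _; first by rewrite mulr1.
by rewrite mulr0.
Qed.

Lemma Rdominated_convergence (f_ : nat -> T -> R) f g :
  (forall k, measurable_fun setT (f_ k)) -> measurable_fun setT f ->
  {ae mu, forall x, f_ k x @[k --> \oo] --> f x} -> L1 g ->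
  (forall k x, `|f_ k x| <= g x) ->
  L1 f /\ (\int[mu]_x f_ k x) @[k --> \oo] --> \int[mu]_x f x.
Proof.
move=> mf_ mf ff ig fg.
have L1f_ k : L1 (f_ k) by exact: L1_le ig.
have ff' : {ae mu, forall x, setT x -> (f_ k x)%:E @[k --> \oo] --> (f x)%:E}.
  by apply: filterS ff => x h _; apply/cvg_EFin; [exact: nearW|exact: h].
have [h1 _ h3] := @dominated_convergence _ _ _ mu setT measurableT
  (fun k x => (f_ k x)%:E) (EFin \o f) (EFin \o g)
  (fun k => (measurable_EFinP _ _).2 (mf_ k)) ((measurable_EFinP _ _).2 mf)
  ff' ig (aeW _ (fun x k _ => fg k x)).
split => //; move: h3; rewrite /= L1_EFin// => /fine_cvg.
by [].
Qed.

End real_integrals.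

(** * The fundamental lemma of the calculus of variations *)

Section density.
Context d (T : measurableType d) (R : realType).
Variables (mu : {measure set T -> \bar R}) (f : T -> \bar R).
Hypotheses (mf : measurable_fun setT f) (f0 : forall x, (0 <= f x)%E).

Definition density (A : set T) : \bar R := (\int[mu]_(x in A) f x)%E.

Let density0 : density set0 = 0%E. Proof. exact: integral_set0. Qed.

Let density_ge0 A : (0 <= density A)%E. Proof. exact: integral_ge0. Qed.

HB.instance Definition _ := isMeasure.Build _ _ _ density density0 density_ge0
  (semi_sigma_additive_nng_induced mf f0).

Definition density_measure : {measure set T -> \bar R} := density.

End density.

Section fundamental.
Context {R : realType} {n : nat}.
Implicit Types (x v : 'rV[R]_n) (a b : 'I_n -> R) (U V : set 'rV[R]_n).
Local Notation mu := (@lebesgue_rV R n).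

Definition tbump a b k : 'rV[R]_n -> R := tens (fun j => bump (a j) (b j) k).

Lemma tbump_ge0 a b k x : 0 <= tbump a b k x.
Proof. by apply: prodr_ge0 => j _; exact: bump_ge0. Qed.

Lemma tbump_le1 a b k x : tbump a b k x <= 1.
Proof. by apply: prodr_ile1 => j _; rewrite bump_ge0 bump_le1. Qed.

Lemma tbump_norm a b k x : `|tbump a b k x| <= 1.
Proof. by rewrite ger0_norm ?tbump_ge0 ?tbump_le1. Qed.

Lemma tbump_test a b k U : cbox a b `<=` U -> test_function U (tbump a b k).
Proof.
apply: test_function_tens => j; first exact: cinf_bump.
by move=> t; exact: bump_out.
Qed.

Lemma tbump_out a b k x : ~ obox a b x -> tbump a b k x = 0.
Proof.
move=> /existsNP[i /negP h]; rewrite /tbump /tens (bigD1 i)//= bump_out ?mul0r//.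
Qed.

Lemma tbump_continuous a b k : continuous (tbump a b k).
Proof. by apply: continuous_tens => j; exact/cinf_continuous/cinf_bump. Qed.

Lemma tbump_measurable a b k : measurable_fun setT (tbump a b k).
Proof. by apply: continuous_measurable_rV; exact: tbump_continuous. Qed.

Lemma tbump_cvg a b x : tbump a b k x @[k --> \oo] --> (\1_(obox a b) x : R).
Proof.
have [h|h] := pselect (obox a b x); last first.
  rewrite indicE memNset// (_ : (fun k => _) = (fun=> 0)); first exact: cvg_cst.
  by apply/funext => k; rewrite tbump_out.
rewrite indicE mem_set//= mulr1n.
have -> : 1 = \prod_(j < n) (a j < x ord0 j < b j)%R%:R :> R.
  by rewrite big1// => j _; rewrite h.
rewrite /tbump /tens.
elim: (index_enum _) => [|j s IH].
  by under eq_fun do rewrite big_nil; rewrite big_nil; exact: cvg_cst.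
under eq_fun do rewrite big_cons; rewrite big_cons.
by apply: cvgM => //; exact: bump_cvg.
Qed.

(** Bumps converge to indicators, so the integral of g over every box inside V is
    zero. On a fixed box the measures with densities the positive and negative parts
    of g therefore agree on boxes, hence on all Borel sets, and g = 0 there. *)
Lemma fundamental_lemma (g : 'rV[R]_n -> R) V : open V -> L1 mu g ->
  (forall a b k, (forall i, a i < b i) -> cbox a b `<=` V ->
     \int[mu]_x (g x * tbump a b k x) = 0) ->
  {ae mu, forall x, V x -> g x = 0}.
Proof.
move=> oV ig h.
have hbox a b : cbox a b `<=` V -> (\int[mu]_(x in obox a b) (g x)%:E = 0)%E.
  move=> abV; have [ab|] := pselect (forall i, a i < b i); last first.
    move=> /existsNP[i /negP]; rewrite -leNgt => ba.
    rewrite (_ : obox a b = set0) ?integral_set0//.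
    by apply/seteqP; split => // x /(_ i); lra.
  rewrite integral_indicM.
  have m1 : measurable (obox a b) by exact: measurable_obox.
  have [h1 h2] : L1 mu (fun x => g x * \1_(obox a b) x) /\
      (\int[mu]_x (g x * tbump a b k x)) @[k --> \oo] --> \int[mu]_x (g x * \1_(obox a b) x).
    apply: (@Rdominated_convergence _ _ _ mu _ _ (fun x => `|g x|)).
    - move=> k; apply: measurable_funM; first exact: (L1_measurable ig).
      exact: tbump_measurable.
    - by apply: measurable_funM; first exact: (L1_measurable ig).
    - by apply: aeW => x; apply: cvgM; [exact: cvg_cst|exact: tbump_cvg].
    - exact: L1_norm.
    - move=> k x; rewrite normrM -[leRHS]mulr1 ler_wpM2l//.
      exact: tbump_norm.
  rewrite L1_EFin//; congr EFin; apply: cvg_unique h2 _ => //.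
  rewrite (_ : (fun k => _) = (fun=> 0)); first exact: cvg_cst.
  by apply/funext => k; exact: h.
apply: ae_open_local => // a b abV.
pose Q := obox a b.
have mQ : measurable Q by exact: measurable_obox.
pose G := EFin \o (fun x => g x * \1_Q x).
have iG : mu.-integrable setT G by exact: L1_indic.
have mG := measurable_int _ iG.
have iGp B : measurable B -> mu.-integrable B (G^\+)%E.
  by move=> mB; apply: integrableS (integrable_funepos measurableT iG).
have iGn B : measurable B -> mu.-integrable B (G^\-)%E.
  by move=> mB; apply: integrableS (integrable_funeneg measurableT iG).
pose m1 := density_measure mu (measurable_funepos mG) (funepos_ge0 G).
pose m2 := density_measure mu (measurable_funeneg mG) (funeneg_ge0 G).
have m12 A : measurable A -> m1 A = m2 A.
  apply: eq_measure_rV => [c e|c e]; last first.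
    apply: integrable_lty; first exact: measurable_obox.
    by apply: iGp; exact: measurable_obox.
  have mce : measurable (obox c e) by exact: measurable_obox.
  have : (\int[mu]_(x in obox c e) G x = 0)%E.
    have := hbox (fun i => Num.max (c i) (a i)) (fun i => Num.min (e i) (b i)).
    rewrite -oboxI -cboxI => <-; last by move=> x [_]; exact: abV.
    rewrite /G integral_indicM [RHS]integral_indicM; apply: eq_integral => x _.
    by rewrite indicI /= mulrA mulrAC.
  rewrite integralE => /eqP; rewrite sube_eq ?add0e; first by move/eqP.
  - by apply: integrable_fin_num => //; exact: iGp.
  - by rewrite fin_num_adde_defl// integrable_fin_num//; exact: iGn.
have : ae_eq mu setT G (cst 0%E).
  apply: integral_ae_eq => // E _ mE; rewrite integral0 integralE.
  rewrite -[X in (X - _)%E]/(m1 E) m12// subee//.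
  by apply: integrable_fin_num => //; exact: iGn.
apply: filterS => x /(_ I) [] /eqP; rewrite mulf_eq0 => /orP[/eqP//|].
by rewrite indicE pnatr_eq0 eqb0 => /negP h1 Qx; exfalso; apply: h1; rewrite inE.
Qed.

End fundamental.

(** * Weak gradients: restriction, uniqueness, gluing *)

Section weak.
Context {R : realType} {n : nat}.
Implicit Types (x v : 'rV[R]_n) (a b : 'I_n -> R) (U V K : set 'rV[R]_n).
Implicit Types (u f : 'rV[R]_n -> R) (G : 'rV[R]_n -> 'rV[R]_n).
Local Notation mu := (@lebesgue_rV R n).

Lemma integral_vanish U V (F : 'rV[R]_n -> \bar R) : V `<=` U ->
  (forall x, U x -> ~ V x -> F x = 0%E) ->
  (\int[mu]_(x in U) F x = \int[mu]_(x in V) F x)%E.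
Proof.
move=> VU h; rewrite integral_mkcond [RHS]integral_mkcond; apply: eq_integral => x _.
rewrite !patchE; case: ifPn => [/set_mem Ux|/negP nU].
  by case: ifPn => // /negP nV; apply: h => // Vx; apply: nV; rewrite inE.
by rewrite ifF//; apply/negP => /set_mem /VU Ux; apply: nU; rewrite inE.
Qed.

Lemma derive_out f x v : ~ closure [set x | f x != 0] x -> 'D_v f x = 0.
Proof.
move=> nx; have -> : 'D_v f x = 'D_v (cst (0 : R)) x.
  apply: near_eq_derive.
  have /open_nbhs_nbhs : open_nbhs x (~` closure [set x | f x != 0]).
    by split => //; apply: closed_openC; exact: closed_closure.
  apply: filterS => y ny; apply/eqP; apply: contrapT => /negP h; apply: ny.
  exact: subset_closure.
exact: derive_cst.
Qed.

Lemma fun_out f x : ~ closure [set x | f x != 0] x -> f x = 0.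
Proof.
by move=> nx; apply/eqP; apply: contrapT => /negP h; apply: nx; exact: subset_closure.
Qed.

Lemma test_functionS U V f : V `<=` U -> test_function V f -> test_function U f.
Proof. by move=> VU [h1 h2 h3]; split => //; exact: subset_trans VU. Qed.

Lemma loc_integrableS U V f : open U -> open V -> V `<=` U ->
  loc_integrable U f -> loc_integrable V f.
Proof.
move=> oU oV VU [[h mh fh] iK]; split.
  exists h; first by apply: measurable_funS mh => //; exact: open_measurable_rV.
  by apply: filterS fh => x + /VU; exact.
by move=> K KV cK; apply: iK => //; exact: subset_trans VU.
Qed.

Lemma weak_gradientS U V u G : open U -> open V -> V `<=` U ->
  weak_gradient U u G -> weak_gradient V u G.
Proof.
move=> oU oV VU [lu wG]; split; first exact: loc_integrableS lu.
move=> i; have [lG tG] := wG i; split; first exact: loc_integrableS lG.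
move=> f tf; have := tG f (test_functionS VU tf); have [_ _ fV] := tf.
rewrite (@integral_vanish U V); last 2 first.
- by [].
- by move=> x _ nV; rewrite derive_out ?mulr0// => /fV.
rewrite (@integral_vanish U V) // => x _ nV.
by rewrite fun_out ?mulr0// => /fV.
Qed.

(** Translations and Fubini need a Borel function that is integrable over the whole
    space; a function on V is replaced by such a representative, extended by 0. *)
Lemma L1_repr V f : measurable V -> lebesgue_measurable_fun V f ->
  (\int[mu]_(x in V) `|f x|%:E < +oo)%E ->
  exists F : 'rV[R]_n -> R, [/\ L1 mu F, {ae mu, forall x, V x -> F x = f x} &
    forall x, ~ V x -> F x = 0].
Proof.
move=> mV [h mh fh] If; exists (h \_ V); split.
- apply/integrableP; split.
    by apply/measurable_EFinP; apply/(measurable_restrictT _ mV).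
  rewrite (_ : (fun x => _) = ((fun x => `|h x|%:E) \_ V)); last first.
    by apply/funext => x; rewrite /= !patchE; case: ifP => //; rewrite normr0.
  rewrite -integral_mkcond (@ae_integral_eq _ _ _ _ _ _ (fun x => `|f x|%:E)) //.
  by apply: filterS fh => x /[apply] ->.
- by apply: filterS fh => x fx Vx; rewrite patchE mem_set// fx.
- by move=> x nV; rewrite patchE memNset.
Qed.

Lemma loc_integrable_repr U K f : open U -> K `<=` U -> compact K ->
  loc_integrable U f ->
  exists h : 'rV[R]_n -> R, [/\ L1 mu h, {ae mu, forall x, K x -> h x = f x} &
     forall x, ~ K x -> h x = 0].
Proof.
move=> oU KU cK [[h mh fh] iK]; apply: L1_repr; last exact: iK.
  exact: compact_measurable_rV.
exists h; last by apply: filterS fh => x + /KU; exact.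
by apply: measurable_funS mh => //; exact: open_measurable_rV.
Qed.

Lemma integral_repr U K f (h phi : 'rV[R]_n -> R) : K `<=` U ->
  {ae mu, forall x, K x -> h x = f x} -> (forall x, ~ K x -> h x = 0) ->
  (forall x, ~ K x -> phi x = 0) ->
  (\int[mu]_(x in U) (f x * phi x)%:E = \int[mu]_x (h x * phi x)%:E)%E.
Proof.
move=> KU hf h0 p0; rewrite (@integral_vanish U K)//; last first.
  by move=> x _ /p0 ->; rewrite mulr0.
rewrite [RHS](@integral_vanish setT K)//; last by move=> x _ /p0 ->; rewrite mulr0.
by apply: ae_integral_eq; apply: filterS hf => x /[apply] ->.
Qed.

(** The difference of two weak gradients integrates to zero against all bumps. *)
Lemma weak_gradient_unique U u G G' : open U ->
  weak_gradient U u G -> weak_gradient U u G' -> {ae mu, forall x, U x -> G x = G' x}.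
Proof.
move=> oU [_ wG] [_ wG'].
suff H i : {ae mu, forall x, U x -> G x ord0 i = G' x ord0 i}.
  have : {ae mu, forall x i, U x -> G x ord0 i = G' x ord0 i} by exact: filter_forall.
  by apply: filterS => x h Ux; apply/rowP => i; exact: h.
apply: ae_open_local => // a b abU.
have cK : compact (cbox a b) by exact: compact_cbox.
have [lG tG] := wG i; have [lG' tG'] := wG' i.
have [h [ih hG h0]] := loc_integrable_repr oU abU cK lG.
have [h' [ih' hG' h0']] := loc_integrable_repr oU abU cK lG'.
have : {ae mu, forall x, obox a b x -> h x - h' x = 0}.
  apply: fundamental_lemma; [exact: open_obox|exact: L1B|].
  move=> c e k _ ceV.
  have tU : cbox c e `<=` U by apply: subset_trans ceV _ => x /obox_cbox; exact: abU.
  have tb := tbump_test k tU.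
  have t0 x : ~ cbox a b x -> tbump c e k x = 0.
    by move=> nx; apply: tbump_out => /obox_cbox /ceV /obox_cbox.
  have L1t (f : 'rV[R]_n -> R) : L1 mu f -> L1 mu (fun x => f x * tbump c e k x).
    by move=> if_; apply: (L1M if_); [exact: tbump_measurable|exact: tbump_norm].
  under eq_Rintegral do rewrite mulrBl.
  rewrite RintegralB//; [|exact: L1t|exact: L1t].
  apply/eqP; rewrite subr_eq0; apply/eqP; rewrite /Rintegral; congr fine.
  rewrite -(integral_repr abU hG h0 t0) -(integral_repr abU hG' h0' t0).
  have := tG _ tb; rewrite (tG' _ tb) => /(congr1 (@oppe R)).
  by rewrite !oppeK => ->.
apply: filterS3 hG hG' => x e1 e2 e3 xab; have xc := obox_cbox xab.
by rewrite -e1// -e2//; apply/eqP; rewrite -subr_eq0; apply/eqP; exact: e3.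
Qed.

Lemma compact_sub_increasing (V_ : nat -> set 'rV[R]_n) K :
  (forall k, open (V_ k)) -> nondecreasing_seq V_ -> compact K ->
  K `<=` \bigcup_k V_ k -> exists k, K `<=` V_ k.
Proof.
move=> oV ndV cK KV.
have := cK; rewrite compact_cover => /(_ nat setT V_) [//|//|D _ KD].
exists (\max_(i <- finmap.enum_fset D) i)%N => x /KD [i /= iD Vi].
have : (i <= \max_(i <- finmap.enum_fset D) i)%N by exact: leq_bigmax_seq.
by move=> /ndV/subsetPset; apply.
Qed.

(** Representatives on the sets V_k are glued along the disjoint differences of these
    sets; only countably many null sets are involved. *)
Lemma lebesgue_measurable_fun_bigcup (V_ : nat -> set 'rV[R]_n) f :
  (forall k, open (V_ k)) ->
  (forall k, lebesgue_measurable_fun (V_ k) f) ->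
  lebesgue_measurable_fun (\bigcup_k V_ k) f.
Proof.
move=> oV h; have mV k := open_measurable_rV (oV k).
have {}h k : exists hk : 'rV[R]_n -> R,
    measurable_fun (V_ k) hk /\ {ae mu, forall x, V_ k x -> f x = hk x}.
  by have [hk] := h k; exists hk.
have [h_ h_P] := choice h.
pose g x := if pselect (exists k, seqDU V_ k x) is left e then h_ (xchoose
   (let: ex_intro k e := e in ex_intro (fun k => x \in seqDU V_ k) k (mem_set e))) x else 0.
have gE k x : seqDU V_ k x -> g x = h_ k x.
  move=> xk; rewrite /g; case: pselect => [[k' e]|]; last by case; exists k.
  congr (h_ _ x).
  have /set_mem xc := xchooseP (ex_intro (fun k => x \in seqDU V_ k) k' (mem_set e)).
  apply: contrapT => ne; have := trivIset_seqDU V_.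
  by move=> /(_ _ _ I I) => /(_ _ k) H; apply: ne; apply: H; exists x.
have mS k : measurable (seqDU V_ k).
  by apply: measurableD => //; apply: bigsetU_measurable.
have sV k : seqDU V_ k `<=` V_ k by move=> x [].
rewrite seqDU_bigcup_eq; exists g.
  apply/measurable_fun_bigcup => // k.
  apply: (eq_measurable_fun (h_ k)); first by move=> x /set_mem /gE.
  by apply: measurable_funS (h_P k).1.
have : {ae mu, forall x k, V_ k x -> f x = h_ k x}.
  by apply: ae_foralln => k; exact: (h_P k).2.
by apply: filterS => x hx [k _ xk]; rewrite (gE k)//; apply: hx; exact: sV.
Qed.

Lemma eq_ae_lebesgue_measurable U f f' : {ae mu, forall x, U x -> f x = f' x} ->
  lebesgue_measurable_fun U f -> lebesgue_measurable_fun U f'.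
Proof.
move=> ff' [h mh fh]; exists h => //.
by apply: filterS2 ff' fh => x e1 e2 Ux; rewrite -e1// e2.
Qed.

Lemma eq_ae_loc_integrable U f f' : {ae mu, forall x, U x -> f x = f' x} ->
  loc_integrable U f -> loc_integrable U f'.
Proof.
move=> ff' [mf iK]; split; first exact: eq_ae_lebesgue_measurable mf.
move=> K KU cK; rewrite (@ae_integral_eq _ _ _ _ _ _ (fun x => `|f x|%:E)); first exact: iK.
by apply: filterS ff' => x e /KU /e ->.
Qed.

Lemma loc_integrable_bigcup (V_ : nat -> set 'rV[R]_n) f :
  (forall k, open (V_ k)) -> nondecreasing_seq V_ ->
  (forall k, loc_integrable (V_ k) f) -> loc_integrable (\bigcup_k V_ k) f.
Proof.
move=> oV ndV h; split.
  by apply: lebesgue_measurable_fun_bigcup => // k; have [] := h k.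
move=> K KV cK; have [k Kk] := compact_sub_increasing oV ndV cK KV.
by have [_] := h k; apply.
Qed.

(** A test function has compact support, so it is already a test function for some
    V_k; uniqueness of weak gradients makes the G_k compatible. *)
Lemma weak_gradient_glue (V_ : nat -> set 'rV[R]_n) u (G_ : nat -> 'rV[R]_n -> 'rV[R]_n) :
  (forall k, open (V_ k)) -> nondecreasing_seq V_ ->
  (forall k, weak_gradient (V_ k) u (G_ k)) ->
  exists G, weak_gradient (\bigcup_k V_ k) u G.
Proof.
move=> oV ndV wG.
have mono k j : (k <= j)%N -> V_ k `<=` V_ j by move=> /ndV/subsetPset.
pose G x := if pselect (exists k, x \in V_ k) is left e then G_ (ex_minn e) x else 0.
have GE : {ae mu, forall x k, V_ k x -> G x = G_ k x}.
  have H : {ae mu, forall x k j, (k <= j)%N -> V_ k x -> G_ k x = G_ j x}.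
    apply: ae_foralln => k; apply: ae_foralln => j.
    have [kj|kj] := boolP (k <= j)%N; last exact: aeW.
    have := weak_gradient_unique (oV k) (wG k)
      (weak_gradientS (oV j) (oV k) (mono _ _ kj) (wG j)).
    by apply: filterS => x h _; exact: h.
  apply: filterS H => x H k Vk; rewrite /G; case: pselect => [e|]; last first.
    by case; exists k; rewrite inE.
  case: ex_minnP => j /set_mem Vj jm; apply: H => //; apply: jm; exact: mem_set.
have GEk k : {ae mu, forall x, V_ k x -> G x = G_ k x}.
  by apply: filterS GE => x; apply.
exists G; split.
  by apply: loc_integrable_bigcup => // k; have [] := wG k.
move=> i; split.
  apply: loc_integrable_bigcup => // k; have [_ /(_ i) [lG _]] := wG k.
  by apply: eq_ae_loc_integrable lG; apply: filterS (GEk k) => x /[apply] ->.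
move=> f [sf cf fU]; have [k fk] := compact_sub_increasing oV ndV cf fU.
have [_ /(_ i) [_ tG]] := wG k.
have sub : V_ k `<=` \bigcup_k V_ k by move=> x Vx; exists k.
rewrite (integral_vanish sub); last first.
  by move=> x _ nV; rewrite derive_out ?mulr0// => /fk.
rewrite (integral_vanish sub); last first.
  by move=> x _ nV; rewrite fun_out ?mulr0// => /fk.
rewrite tG//; congr (- _)%E; apply: ae_integral_eq.
by apply: filterS (GEk k) => x /[apply] ->.
Qed.

Lemma grad_weak_gradient U u G : weak_gradient U u G -> weak_gradient U u (grad U u).
Proof. by move=> h; rewrite /grad; apply: xgetPex; exists G. Qed.

End weak.

(** * Translations and shears *)

Section shift.
Context {R : realType} {n : nat}.
Implicit Types (x v : 'rV[R]_n) (f : 'rV[R]_n -> R).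
Local Notation mu := (@lebesgue_rV R n).
Local Notation leb := (@lebesgue_measure R).

Lemma ge0_integral_shift v (f : 'rV[R]_n -> \bar R) : measurable_fun setT f ->
  (forall x, (0 <= f x)%E) ->
  (\int[mu]_x f (x + v)%R = \int[mu]_x f x)%E.
Proof.
move=> mf f0.
rewrite -[LHS](@ge0_integral_pushforward _ _ _ _ _ _ (measurable_shift v) mu setT f)//.
apply: eq_measure_integral => [|? A mA _]; first exact: measurable_shift.
by rewrite -[RHS](lebesgue_rV_shift v mA).
Qed.

Lemma L1_shift v f : L1 mu f -> L1 mu (fun x => f (x + v)).
Proof.
move=> if_; have mf := L1_measurable if_; apply/integrableP; split.
  by apply/measurable_EFinP; apply: (measurableT_comp mf); exact: measurable_shift.
rewrite (ge0_integral_shift v (f := fun x => `|(f x)%:E|%E))//; last first.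
  by apply: measurableT_comp => //; exact/measurable_EFinP.
by case/integrableP : if_.
Qed.

Lemma integral_shift v f : L1 mu f ->
  (\int[mu]_x (f (x + v)%R)%:E = \int[mu]_x (f x)%:E)%E.
Proof.
move=> if_; have mf := L1_measurable if_.
rewrite -[LHS](@integral_pushforward _ _ _ _ _ _ (measurable_shift v) mu setT (EFin \o f))//.
- apply: eq_measure_integral => [|? A mA _]; first exact: measurable_shift.
  by rewrite -[RHS](lebesgue_rV_shift v mA).
- exact/measurable_EFinP.
- by rewrite preimage_setT; exact: L1_shift.
Qed.

Lemma measurable_line (c : R) v :
  measurable_fun setT (fun z : 'rV[R]_n * R => z.1 + (c * z.2) *: v).
Proof.
apply: measurable_fun_rVP => i; under eq_fun do rewrite !mxE.
apply: measurable_funD; first exact: measurableT_comp (measurable_coord_rV i) measurable_fst.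
by apply: measurable_funM => //; apply: measurable_funM => //; exact: measurable_snd.
Qed.

Local Notation pi := (mu \x leb)%E.

(** The translates of f by c s v for s in [0, 1], as one function of (x, s). The
    indicator of [0, 1] makes it integrable on the whole product space, where Fubini
    is applied. *)
Definition shear (c : R) v f : 'rV[R]_n * R -> R :=
  fun z => f (z.1 + (c * z.2) *: v) * \1_`[0, 1] z.2.

Lemma measurable_shear c v f : measurable_fun setT f ->
  measurable_fun setT (shear c v f).
Proof.
move=> mf; apply: measurable_funM.
  exact: measurableT_comp mf (measurable_line c v).
have m1 : measurable_fun setT (\1_`[0, 1] : R -> R) by [].
exact: (measurableT_comp m1 measurable_snd).
Qed.

Lemma ge0_integral_indic01 (C : \bar R) : (0 <= C)%E ->
  (\int[leb]_s (C * (\1_`[0%R, 1%R] s)%:E) = C)%E.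
Proof.
move=> C0; rewrite ge0_integralZl//; last exact/measurable_EFinP.
rewrite integral_indic// setIT.
by rewrite [X in (_ * X)%E](@lebesgue_measure_itv R `[0, 1])/= lte_fin ltr01 oppr0 adde0 mule1.
Qed.

Lemma integral_norm_shear c v f : measurable_fun setT f ->
  (\int[pi]_z `|shear c v f z|%:E = \int[mu]_x `|f x|%:E)%E.
Proof.
move=> mf; rewrite fubini_tonelli2//; last first.
  by apply/measurable_EFinP; apply: measurableT_comp => //; exact: measurable_shear.
rewrite -[RHS]ge0_integral_indic01; last exact: integral_ge0.
apply: eq_integral => s _; rewrite /fubini_G /shear /=.
under eq_integral do rewrite normrM [X in _ * X]ger0_norm// EFinM.
rewrite ge0_integralZr//; first last.
- by apply/measurable_EFinP; apply: measurableT_comp => //;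
    apply: (measurableT_comp mf); exact: measurable_shift.
congr (_ * _)%E; apply: (ge0_integral_shift ((c * s) *: v) (f := fun x => `|f x|%:E)) => //.
by apply/measurable_EFinP; exact: measurableT_comp.
Qed.

Lemma integrable_shear c v f : L1 mu f -> L1 pi (shear c v f).
Proof.
move=> if_; have mf := L1_measurable if_; apply/integrableP; split.
  by apply/measurable_EFinP; exact: measurable_shear.
rewrite (integral_norm_shear c v mf).
by case/integrableP : if_.
Qed.

(** Fubini, then for each s the change of variable x -> x - c s v, moves the
    translation from f to phi. *)
Lemma integral_shear_swap c v f (phi : 'rV[R]_n -> R) (C : R) : L1 mu f ->
  measurable_fun setT phi -> (forall x, `|phi x| <= C) ->
  (\int[mu]_x \int[leb]_s (shear c v f (x, s) * phi x)%:E =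
   \int[mu]_x \int[leb]_s (f x * shear (- c) v phi (x, s))%:E)%E.
Proof.
move=> if_ mphi phiC; have mf := L1_measurable if_.
have i1 : L1 pi (fun z => shear c v f z * phi z.1).
  apply: (@L1M _ _ _ _ _ _ C); first exact: integrable_shear.
    exact: measurableT_comp mphi measurable_fst.
  by move=> z; exact: phiC.
have i2 : L1 pi (fun z => f z.1 * shear (- c) v phi z).
  have i3 : L1 pi (shear 0 v f) by exact: integrable_shear.
  have i4 : L1 pi (fun z => shear 0 v f z * shear (- c) v phi z).
    apply: (@L1M _ _ _ _ _ _ C) => //; first exact: measurable_shear.
    move=> z; rewrite /shear normrM [X in _ * X]ger0_norm//.
    by rewrite -[leRHS]mulr1 ler_pM.
  apply: eq_integrable i4 => // z _; congr EFin; rewrite /shear mul0r scale0r addr0.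
  by rewrite indicE; case: (_ \in _); rewrite ?mulr1 ?mulr0.
have F1 := @Fubini _ _ _ _ _ mu leb _ i1.
have F2 := @Fubini _ _ _ _ _ mu leb _ i2.
rewrite F1 F2; apply: eq_integral => s _ /=.
rewrite /shear /=; set w := (c * s) *: v.
transitivity (\int[mu]_x (f (x + w) * \1_`[0, 1] s * phi (x + w - w))%R%:E)%E.
  by apply: eq_integral => x _; rewrite addrK.
rewrite (@integral_shift w (fun x => f x * \1_`[0, 1] s * phi (x - w))).
  by apply: eq_integral => x _; rewrite mulNr scaleNr -mulrA [X in _ * X]mulrC.
apply: (@L1M _ _ _ _ _ _ C).
- apply: (@L1M _ _ _ _ _ _ 1) => // x.
  by rewrite indicE ger0_norm ?ler0n// lern1 leq_b1.
- by apply: (measurableT_comp mphi); exact: measurable_shift.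
- by move=> x; exact: phiC.
Qed.

End shift.

Section partial_integral.
Context {R : realType} {n : nat}.
Local Notation mu := (@lebesgue_rV R n).
Local Notation leb := (@lebesgue_measure R).
Local Notation pi := (mu \x leb)%E.

(** Fubini with a real-valued inner integral, which has an arbitrary value on the null
    set of x where the section is not integrable. *)
Lemma L1_partial (h : 'rV[R]_n * R -> R) : L1 pi h ->
  [/\ L1 mu (fun x => \int[leb]_s h (x, s)),
      {ae mu, forall x, L1 leb (fun s => h (x, s))} &
      (\int[mu]_x (\int[leb]_s h (x, s))%R%:E = \int[mu]_x \int[leb]_s (h (x, s))%:E)%E].
Proof.
move=> ih.
have iF := @integrable_fubini_F _ _ _ _ _ mu leb _ ih.
have a1 := @ae_integrable1 _ _ _ _ _ mu leb _ ih.
split => //.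
- apply: le_integrable iF => //.
    apply/measurable_EFinP; apply: (measurableT_comp (f := fine)) => //.
    exact: (@measurable_fubini_F _ _ _ _ _ mu leb _ ih).
  move=> x _ /=; rewrite /Rintegral /fubini_F /=.
  by case: (\int[leb]_y (h (x, y))%:E)%E => [r| |] //=; rewrite normr0 leey.
- apply: ae_integral_eq; apply: filterS a1 => x ix _.
  by rewrite (L1_EFin ix).
Qed.

End partial_integral.

(** * Weak gradients and increments along lines *)

Section line.
Context {R : realType} {n : nat}.
Implicit Types (x v : 'rV[R]_n) (a b : 'I_n -> R).
Local Notation mu := (@lebesgue_rV R n).
Local Notation leb := (@lebesgue_measure R).
Local Notation pi := (mu \x leb)%E.

(* W contains all translates of V by at most T along the i-th axis; uW and gW are
   integrable Borel representatives on W of u and of its i-th weak derivative. *)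
Variables (U V W : set 'rV[R]_n) (u : 'rV[R]_n -> R) (G : 'rV[R]_n -> 'rV[R]_n).
Variables (i : 'I_n) (T : R) (uW gW : 'rV[R]_n -> R).
Hypotheses (wG : weak_gradient U u G) (oV : open V) (WU : W `<=` U).
Hypothesis VW : forall x s, V x -> `|s| <= T -> W (x + s *: unit_rV i).
Hypotheses (iu : L1 mu uW) (ig : L1 mu gW).
Hypotheses (uWu : {ae mu, forall x, W x -> uW x = u x}) (uW0 : forall x, ~ W x -> uW x = 0).
Hypotheses (gWG : {ae mu, forall x, W x -> gW x = G x ord0 i}) (gW0 : forall x, ~ W x -> gW x = 0).

Local Notation e := (unit_rV i).

(** The test function whose i-th partial derivative is the difference between a tensor
    bump and its translate by t. *)
Definition tprim t a b k : 'rV[R]_n -> R :=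
  tens (fun j => if j == i then bump_diff t (a j) (b j) k else bump (a j) (b j) k).

Lemma tbump_line a b k x s :
  tbump a b k (x + s *: e) =
  bump (a i) (b i) k (x ord0 i + s) * \prod_(j < n | j != i) bump (a j) (b j) k (x ord0 j).
Proof.
rewrite /tbump /tens (bigD1 i)//= coord_line eqxx mulr1; congr (_ * _).
by apply: eq_bigr => j ji; rewrite coord_line (negbTE ji) mulr0 addr0.
Qed.

Lemma tprimE t a b k x :
  tprim t a b k x =
  bump_diff t (a i) (b i) k (x ord0 i) * \prod_(j < n | j != i) bump (a j) (b j) k (x ord0 j).
Proof.
rewrite /tprim /tens (bigD1 i)//= eqxx; congr (_ * _).
by apply: eq_bigr => j /negbTE ->.
Qed.

Lemma derive_tprim t a b k x :
  'D_e (tprim t a b k) x = tbump a b k x - tbump a b k (x - t *: e).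
Proof.
pose th j := if j == i then bump_diff t (a j) (b j) k else bump (a j) (b j) k.
have dth (y : R) : is_derive y (1 : R) (th i) (bump (a i) (b i) k y - bump (a i) (b i) k (y - t)).
  by rewrite /th eqxx; exact: is_derive_bump_diff.
have /(@derive_val _ _ _ _ _ _ _) -> := is_derive_tens x dth.
have e1 : x - t *: e = x + (- t) *: e by rewrite scaleNr.
have e2 : x = x + 0 *: e by rewrite scale0r addr0.
rewrite e1 [X in tbump a b k X - _]e2 !tbump_line addr0 -mulrBl.
rewrite /tens (bigD1 i)//= eqxx; congr (_ * _).
by apply: eq_bigr => j ji; rewrite /th (negbTE ji).
Qed.

Lemma integral_tbump_shear (c t : R) a b k x :
  (\int[leb]_s (c * (t * shear (- t) e (tbump a b k) (x, s)))%:E = (c * tprim t a b k x)%:E)%E.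
Proof.
rewrite tprimE; set P := \prod_(j < n | _) _.
pose j (s : R) := t * bump (a i) (b i) k (x ord0 i - t * s) * \1_`[0, 1] s.
have ij : L1 leb j.
  have i1 : L1 leb \1_`[0, 1] by exact: integrable_indic_itv.
  have : L1 leb (fun s => \1_`[0, 1] s * (t * bump (a i) (b i) k (x ord0 i - t * s))).
    apply: (L1M (C := `|t|) i1).
      apply: continuous_measurable_fun => s.
      apply: (@continuousM _ _ (fun=> t) (fun s => bump (a i) (b i) k (x ord0 i - t * s))).
        exact: cvg_cst.
      apply: (@continuous_comp _ _ _ (fun s => x ord0 i - t * s) (bump (a i) (b i) k)).
        apply: cvgB; first exact: cvg_cst.
        by apply: cvgM; [exact: cvg_cst|exact: cvg_id].
      exact/cinf_continuous/cinf_bump.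
    by move=> s; rewrite normrM ler_piMr// ger0_norm ?bump_ge0 ?bump_le1.
  by under eq_fun do rewrite mulrC.
transitivity (\int[leb]_s ((c * P)%:E * (j s)%:E))%E.
  apply: eq_integral => s _; rewrite -EFinM; congr EFin.
  by rewrite /shear /= tbump_line -/P /j mulNr; ring.
rewrite integralZl// -integral_indicM bump_diffE -EFinM; congr EFin; ring.
Qed.

Lemma tprim_testW t a b k : `|t| <= T -> (forall j, a j < b j) -> cbox a b `<=` V ->
  test_function W (tprim t a b k).
Proof.
move=> tT ab abV.
pose a' j := if j == i then Num.min (a j) (a j + t) else a j.
pose b' j := if j == i then Num.max (b j) (b j + t) else b j.
apply: (@test_function_tens _ _ _ a' b').
- by move=> j; case: ifP => _; [exact: cinf_bump_diff|exact: cinf_bump].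
- move=> j y; rewrite /a' /b'; case: eqP => [->|_]; first exact: bump_diff_out.
  exact: bump_out.
- move=> x xab.
  (* the shift along the i-th axis from x to the nearest point of the box *)
  pose s := x ord0 i - Num.max (a i) (Num.min (x ord0 i) (b i)).
  have -> : x = (x - s *: e) + s *: e by rewrite subrK.
  have := xab i; rewrite /a' /b' eqxx ge_min le_max => /andP[h1 h2].
  have abi := ab i.
  apply: VW; last first.
    apply: le_trans tT; have t1 := ler_norm t; have t2 := ler_norm (- t).
    have t3 := normr_ge0 t; rewrite normrN in t2.
    rewrite ler_norml /s; move: h1 h2 => /orP[] h1 /orP[] h2.
    - have [c1|c1] := leP (x ord0 i) (b i); have [c2|c2] := leP (a i) _; lra.
    - have [c1|c1] := leP (x ord0 i) (b i); have [c2|c2] := leP (a i) _; lra.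
    - have [c1|c1] := leP (x ord0 i) (b i); have [c2|c2] := leP (a i) _; lra.
    - have [c1|c1] := leP (x ord0 i) (b i); have [c2|c2] := leP (a i) _; lra.
  apply: abV => j; rewrite -scaleNr coord_line.
  have [->|ji] := eqVneq j i; last first.
    by rewrite mulr0 addr0; have := xab j; rewrite /a' /b' (negbTE ji).
  rewrite mulr1 /s opprB addrC subrK.
  by rewrite le_max lexx/= ge_max (ltW abi) ge_min lexx orbT.
Qed.

(** By [fundamental_lemma] it suffices to test with tensor bumps. On the left, the
    translation moves to the bump and produces the derivative of [tprim]; on the
    right, the shear moves to the bump and integrates it to [tprim]. The two sides
    agree by the definition of the weak derivative. *)
Lemma line_identity t : `|t| <= T ->
  {ae mu, forall x, V x -> uW (x + t *: e) - uW x =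
     \int[leb]_s shear t e (fun x => t * gW x) (x, s)}.
Proof.
move=> tT.
have itg : L1 mu (fun x => t * gW x) by exact: L1_scale.
have ih := integrable_shear t e itg.
have [iI aeI eI] := L1_partial ih.
have isu := L1_shift (t *: e) iu.
set I := fun x => \int[leb]_s shear t e (fun x => t * gW x) (x, s) in iI eI *.
suff : {ae mu, forall x, V x -> uW (x + t *: e) - uW x - I x = 0}.
  by apply: filterS => x h Vx; apply/eqP; rewrite -subr_eq0; apply/eqP; exact: h.
apply: fundamental_lemma => //.
  by apply: L1B => //; exact: L1B.
move=> a b k ab abV.
pose th := tbump a b k.
have L1t (f : 'rV[R]_n -> R) v : L1 mu f -> L1 mu (fun x => f x * th (x + v)).
  move=> if_; apply: (L1M (C := 1) if_) => [|x]; last exact: tbump_norm.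
  by apply: (measurableT_comp (tbump_measurable a b k)); exact: measurable_shift.
have L1t0 (f : 'rV[R]_n -> R) : L1 mu f -> L1 mu (fun x => f x * th x).
  by move=> /(L1t _ 0); under eq_fun do rewrite addr0.
have E1 : (\int[mu]_x (uW (x + t *: e) * th x)%:E = \int[mu]_x (uW x * th (x - t *: e))%:E)%E.
  rewrite -(integral_shift (t *: e) (L1t _ _ iu)).
  by apply: eq_integral => x _; rewrite addrK.
have E2 : (\int[mu]_x (I x * th x)%:E = \int[mu]_x (gW x * tprim t a b k x)%:E)%E.
  transitivity (\int[mu]_x \int[leb]_s (shear t e (fun x => t * gW x) (x, s) * th x)%:E)%E.
    apply: ae_integral_eq; apply: filterS aeI => x ix _.
    under eq_integral do rewrite EFinM.
    by rewrite integralZr// L1_EFin// -EFinM.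
  rewrite (integral_shear_swap _ _ itg (tbump_measurable a b k) (tbump_norm a b k)).
  apply: eq_integral => x _; rewrite -integral_tbump_shear.
  by apply: eq_integral => s _; congr EFin; ring.
have tW := tprim_testW k tT ab abV.
have [_ _ sW] := tW.
have [_ /(_ i)[_ /(_ _ (test_functionS WU tW))]] := wG.
rewrite (integral_repr WU uWu uW0); last by move=> x nW; rewrite derive_out// => /sW.
rewrite (integral_repr WU gWG gW0); last by move=> x nW; rewrite fun_out// => /sW.
move=> E3.
apply: EFin_inj; rewrite -L1_EFin; last first.
  by apply: L1t0; apply: L1B => //; exact: L1B.
under eq_integral do rewrite !mulrBl !EFinB.
rewrite (integralB measurableT (L1B (L1t0 _ isu) (L1t0 _ iu)) (L1t0 _ iI)).
rewrite (integralB measurableT (L1t0 _ isu) (L1t0 _ iu)).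
rewrite E1 E2.
have -> : (\int[mu]_x (gW x * tprim t a b k x)%:E =
   - \int[mu]_x (uW x * 'D_e (tprim t a b k) x)%:E)%E by rewrite E3 oppeK.
under [X in (_ - - X)%E]eq_integral do rewrite derive_tprim mulrBr EFinB.
rewrite (integralB measurableT (L1t0 _ iu) (L1t _ _ iu)).
rewrite (L1_EFin (L1t _ _ iu)) (L1_EFin (L1t0 _ iu)).
set y1 := (\int[mu]_x (uW x * th (x - t *: e)))%R.
set y2 := (\int[mu]_x (uW x * th x))%R.
by change ((y1 - y2 - - (y2 - y1))%:E = 0%:E); congr EFin; lra.
Qed.

End line.

(** * Almost everywhere convergence and difference quotients *)

Section ae_cvg.
Context d (T : measurableType d) (R : realType) (mu : {measure set T -> \bar R}).

(** The integrals are summable, so the series of the f k is integrable, hence finite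
    almost everywhere, and its terms tend to 0. *)
Lemma ae_cvg0 (f : nat -> T -> R) (C : R) :
  (forall k, measurable_fun setT (f k)) -> (forall k x, 0 <= f k x) ->
  (forall k, (\int[mu]_x (f k x)%:E <= (C / (2 ^ (k + 1))%:R)%:E)%E) ->
  {ae mu, forall x, f k x @[k --> \oo] --> (0 : R)}.
Proof.
move=> mf f0 fC; pose F x := (\sum_(k <oo) (f k x)%:E)%E.
have F0 x : (0 <= F x)%E by apply: nneseries_ge0 => k _ _; rewrite lee_fin.
have iF : mu.-integrable setT F.
  apply/integrableP; split.
    apply: ge0_emeasurable_sum => [k x _ _|k _]; first by rewrite lee_fin.
    exact/measurable_EFinP.
  under eq_integral do rewrite gee0_abs//.
  rewrite integral_nneseries//; last first.
  - by move=> k x _; rewrite lee_fin.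
  - by move=> k; exact/measurable_EFinP.
  apply: (@le_lt_trans _ _ (\sum_(k <oo) (C / (2 ^ (k + 1))%:R)%:E)%E).
    apply: lee_nneseries => [k _ _|k _ //].
    by apply: integral_ge0 => x _; rewrite lee_fin.
  have /cvg_lim := @cvg_geometric_eseries_half R C 0.
  by rewrite /eseries => -> //; rewrite ltry.
have := integrable_ae measurableT iF; apply: filterS => x /(_ I) Fx.
apply: cvg_series_cvg_0; apply: nondecreasing_is_cvgn.
  apply/nondecreasing_seqP => k.
  by rewrite /series /= big_nat_recr//= lerDl.
exists (fine (F x)) => _ [k _ <-].
rewrite -lee_fin fineK// /series /= -sumEFin.
by apply: (@nneseries_lim_ge _ (fun k => (f k x)%:E)) => j _ _; rewrite lee_fin.
Qed.

End ae_cvg.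

(** The identity 1/x = x exp (- ln (x^2)) holds away from 0, and at 0 both sides are
    0 by convention. *)
Lemma measurable_invr (R : realType) : measurable_fun setT (@GRing.inv R).
Proof.
have -> : @GRing.inv R = fun x => x * expR (- ln (x * x)).
  apply/funext => x; have [->|x0] := eqVneq x 0; first by rewrite invr0 mul0r.
  have xx0 : 0 < x * x by rewrite lt_def mulf_neq0// -expr2 sqr_ge0.
  by rewrite expRN lnK ?posrE//; field.
apply: measurable_funM => //; apply: (measurableT_comp (@measurable_expR R)).
apply: measurableT_comp => //; apply: (measurableT_comp (@measurable_ln R)).
by apply: measurable_funM.
Qed.

Section quotient.
Context {R : realType}.
Variables (H H' : R -> R) (L : R).
Hypotheses (dH : forall t : R, is_derive t (1 : R) H (H' t)) (cH' : continuous H')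
  (H'L : forall t, `|H' t| <= L).

Definition dquot (a b : R) : R := if a == b then H' a else (H b - H a) / (b - a).

Lemma dquotE a b : H b - H a = dquot a b * (b - a).
Proof.
rewrite /dquot; case: eqP => [->|/eqP ab]; first by rewrite !subrr mulr0.
by rewrite divfK// subr_eq0 eq_sym.
Qed.

Lemma C1_continuous : continuous H.
Proof. by move=> t; exact: is_derive_continuous (dH t). Qed.

Lemma dquot_mvt a b : exists2 c, Num.min a b <= c <= Num.max a b & dquot a b = H' c.
Proof.
rewrite /dquot; case: eqP => [->|/eqP ab]; first by exists b => //; rewrite minxx maxxx lexx.
have [ltab|ltba|e] := ltrgtP a b; last by rewrite e eqxx in ab.
- have [|c] := @MVT _ H H' _ _ ltab (fun x _ => dH x).
    by apply: continuous_subspaceT; exact: C1_continuous.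
  rewrite in_itv/= => /andP[h1 h2] ->; exists c; first by rewrite !ltW.
  by rewrite mulfK// subr_eq0 gt_eqF.
- have [|c] := @MVT _ H H' _ _ ltba (fun x _ => dH x).
    by apply: continuous_subspaceT; exact: C1_continuous.
  rewrite in_itv/= => /andP[h1 h2] h; exists c; first by rewrite !ltW.
  rewrite -opprB h -mulrN opprB mulfK// subr_eq0 lt_eqF//.
Qed.

Lemma dquot_norm a b : `|dquot a b| <= L.
Proof. by have [c _ ->] := dquot_mvt a b. Qed.

Lemma C1_lipschitz a b : `|H b - H a| <= L * `|b - a|.
Proof. by rewrite dquotE normrM ler_wpM2r// dquot_norm. Qed.

(** By the mean value theorem the quotient is a value of H' between a k and b k. *)
Lemma dquot_cvg (a b : nat -> R) (c : R) :
  a k @[k --> \oo] --> c -> b k @[k --> \oo] --> c ->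
  dquot (a k) (b k) @[k --> \oo] --> H' c.
Proof.
move=> ac bc; apply/cvgrPdist_lt => e e0.
have : H' x @[x --> c] --> H' c by exact: cH'.
move=> /cvgrPdist_lt/(_ e e0) [/= dl dl0 hd].
move/cvgrPdist_lt/(_ dl dl0): ac => ac; move/cvgrPdist_lt/(_ dl dl0): bc => bc.
near=> k; have [x xab ->] := dquot_mvt (a k) (b k); apply: hd => /=.
have h1 : `|c - a k| < dl by near: k.
have h2 : `|c - b k| < dl by near: k.
move: h1 h2 xab; rewrite !ltr_norml ge_min le_max => h1 h2 /andP[/orP[] h3 /orP[] h4]; lra.
Unshelve. all: by end_near. Qed.

Lemma measurable_dquot d (T : measurableType d) (f g : T -> R) :
  measurable_fun setT f -> measurable_fun setT g ->
  measurable_fun setT (fun x => dquot (f x) (g x)).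
Proof.
move=> mf mg; have mH : measurable_fun setT H by apply: continuous_measurable_fun; exact: C1_continuous.
have mH' : measurable_fun setT H' by apply: continuous_measurable_fun.
apply: measurable_fun_ifT; first exact: measurable_fun_eqr.
  exact: measurableT_comp mH' mf.
apply: measurable_funM.
  by apply: measurable_funB; [exact: measurableT_comp mH mg|exact: measurableT_comp mH mf].
have mV : measurable_fun setT (@GRing.inv R) by exact: measurable_invr.
by apply: (measurableT_comp mV); exact: measurable_funB.
Qed.

End quotient.

Lemma ae_imp2 d (X : measurableType d) (R : realType) (nu : {measure set X -> \bar R})
    (P Q S : X -> Prop) : {ae nu, forall x, P x} -> {ae nu, forall x, Q x} ->
  (forall x, P x -> Q x -> S x) -> {ae nu, forall x, S x}.
Proof. by move=> h1 h2 h; apply: filterS2 h1 h2. Qed.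

(** * The chain rule near a compact set *)

Section chain.
Context {R : realType} {n : nat}.
Implicit Types (x v : 'rV[R]_n) (a b : 'I_n -> R).
Local Notation mu := (@lebesgue_rV R n).
Local Notation leb := (@lebesgue_measure R).
Local Notation pi := (mu \x leb)%E.

Lemma L1_indic_compact (K : set 'rV[R]_n) : compact K -> L1 mu (\1_K : 'rV[R]_n -> R).
Proof.
move=> cK; have mK := compact_measurable_rV cK; have [r Kr] := compact_sub_cbox cK.
apply/integrableP; split; first exact/measurable_EFinP.
under eq_integral do rewrite /= ger0_norm//.
rewrite integral_indic// setIT.
apply: (@le_lt_trans _ _ (mu (obox (fun=> - (r + 1)) (fun=> r + 1)))).
  apply: le_measure; rewrite ?inE//; first exact: measurable_obox.
  by move=> x /Kr hx j; have := hx j; lra.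
exact: lebesgue_rV_obox_lty.
Qed.

Variables (U V W : set 'rV[R]_n) (u : 'rV[R]_n -> R) (G : 'rV[R]_n -> 'rV[R]_n).
Variables (i : 'I_n) (T : R) (uW gW : 'rV[R]_n -> R).
Hypotheses (wG : weak_gradient U u G) (oV : open V) (WU : W `<=` U) (cW : compact W).
Hypothesis VW : forall x s, V x -> `|s| <= T -> W (x + s *: unit_rV i).
Hypotheses (T0 : 0 < T) (iu : L1 mu uW) (ig : L1 mu gW).
Hypotheses (uWu : {ae mu, forall x, W x -> uW x = u x}) (uW0 : forall x, ~ W x -> uW x = 0).
Hypotheses (gWG : {ae mu, forall x, W x -> gW x = G x ord0 i}) (gW0 : forall x, ~ W x -> gW x = 0).

Local Notation e := (unit_rV i).

Let VsubW : V `<=` W.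
Proof. by move=> x Vx; have := VW Vx (s := 0); rewrite normr0 scale0r addr0; apply; exact: ltW. Qed.

Let mV : measurable V := open_measurable_rV oV.
Let mW : measurable W := compact_measurable_rV cW.

(** The integral in [line_identity] is at most an average of translates of gW, all of
    which have the same L^1 norm. *)
Lemma increment_bound t : `|t| <= T ->
  (\int[mu]_x (`|uW (x + t *: e) - uW x| * \1_V x)%:E <= `|t|%:E * \int[mu]_x `|gW x|%:E)%E.
Proof.
move=> tT.
have itg : L1 mu (fun x => t * gW x) by exact: L1_scale.
have mh := measurable_shear t e (L1_measurable itg).
have mabs : measurable_fun setT (fun z => `|shear t e (fun x => t * gW x) z|%:E).
  by apply/measurable_EFinP; exact: measurableT_comp mh.
rewrite -ge0_integralZl//; last first.
  by apply/measurable_EFinP; apply: measurableT_comp => //; exact: L1_measurable ig.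
under [leRHS]eq_integral do rewrite -EFinM -normrM.
rewrite -(integral_norm_shear t e (L1_measurable itg)).
rewrite fubini_tonelli1//.
apply: ae_ge0_le_integral => //.
- apply/measurable_EFinP; apply: measurable_funM => //; apply: measurableT_comp => //.
  by apply: measurable_funB; [exact: L1_measurable (L1_shift _ iu)|exact: L1_measurable iu].
- by move=> x _; apply: integral_ge0.
- exact: measurable_fun_fubini_tonelli_F.
have [_ aeI _] := L1_partial (integrable_shear t e itg).
have := line_identity wG oV WU VW iu ig uWu uW0 gWG gW0 tT.
apply: filterS2 aeI => x ix hx _; rewrite indicE.
have [/set_mem Vx|_] := boolP (x \in V); last by rewrite mulr0 integral_ge0.
rewrite mulr1 hx// /fubini_F (L1_EFin (L1_norm ix)) lee_fin.
exact: le_normr_Rintegral.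
Qed.

(** Convergence in L^1 at a summable rate implies convergence almost everywhere. The
    displacement r k s depends on a parameter s, because [chain_local] compares
    values of u at two points that slide along the segment between x and its
    translate; the null set is therefore taken in the product space. *)
Lemma ae_cvg_translates (r : nat -> R -> R) :
  (forall k, measurable_fun setT (r k)) ->
  (forall k s, 0 <= s <= 1 -> `|r k s| <= T / (2 ^ (k + 1))%:R) ->
  {ae pi, forall z, V z.1 -> 0 <= z.2 <= 1 ->
     uW (z.1 + r k z.2 *: e) @[k --> \oo] --> uW z.1}.
Proof.
move=> mr rT.
pose f k (z : 'rV[R]_n * R) :=
  `|uW (z.1 + r k z.2 *: e) - uW z.1| * \1_V z.1 * \1_`[0, 1] z.2.
have muW := L1_measurable iu.
have mline k : measurable_fun setT (fun z : 'rV[R]_n * R => z.1 + r k z.2 *: e).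
  apply: measurable_fun_rVP => j; under eq_fun do rewrite !mxE.
  apply: measurable_funD; first exact: measurableT_comp (measurable_coord_rV j) measurable_fst.
  by apply: measurable_funM => //; exact: measurableT_comp (mr k) measurable_snd.
have m01 : measurable_fun setT (\1_`[0, 1] : R -> R) by [].
have mV1 : measurable_fun setT (\1_V : 'rV[R]_n -> R) by [].
have mf k : measurable_fun setT (f k).
  apply: measurable_funM; last exact: measurableT_comp m01 measurable_snd.
  apply: measurable_funM; last exact: measurableT_comp mV1 measurable_fst.
  apply: measurableT_comp => //; apply: measurable_funB.
    exact: measurableT_comp muW (mline k).
  exact: measurableT_comp muW measurable_fst.
have f0 k z : 0 <= f k z by rewrite !mulr_ge0.
have [C Ceq] : exists C : R, (\int[mu]_x `|gW x|%:E = C%:E)%E.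
  by exists (\int[mu]_x `|gW x|)%R; rewrite (L1_EFin (L1_norm ig)).
have C0 : 0 <= C by rewrite -lee_fin -Ceq; exact: integral_ge0.
have fC k : (\int[pi]_z (f k z)%:E <= (T * C / (2 ^ (k + 1))%:R)%:E)%E.
  have mfk : measurable_fun setT (fun z => (f k z)%:E) by exact/measurable_EFinP.
  rewrite fubini_tonelli2//; last by move=> z; rewrite lee_fin.
  rewrite -[leRHS]ge0_integral_indic01; last by rewrite lee_fin !mulr_ge0 ?invr_ge0// ltW.
  apply: ge0_le_integral => //.
  - by move=> s _; apply: integral_ge0 => x _; rewrite lee_fin.
  - by apply: measurable_fun_fubini_tonelli_G => //; move=> z; rewrite lee_fin.
  - by apply: emeasurable_funM => //; exact/measurable_EFinP.
  move=> s _; rewrite /fubini_G /f /=.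
  rewrite indicE; have [|_] := boolP (s \in _); last first.
    by rewrite mule0; under eq_integral do rewrite mulr0; rewrite integral0.
  rewrite inE /= in_itv/= => s01; rewrite mule1; under eq_integral do rewrite mulr1.
  have rk := rT k s s01.
  have kT : T / (2 ^ (k + 1))%:R <= T.
    by rewrite ler_pdivrMr ?ltr0n ?expn_gt0// ler_peMr ?ler1n ?expn_gt0// ltW.
  apply: (le_trans (increment_bound (le_trans rk kT))).
  by rewrite Ceq -EFinM lee_fin mulrAC ler_wpM2r.
have := @ae_cvg0 _ _ _ pi f (T * C) mf f0 fC; apply: filterS => z hz Vz z01.
move/cvgrPdist_lt: hz => hz; apply/cvgrPdist_lt => eps eps0.
have := hz eps eps0; apply: filterS => k.
have e1 : \1_V z.1 = 1 :> R by rewrite indicE mem_set.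
have e2 : \1_`[0, 1] z.2 = 1 :> R by rewrite indicE mem_set//= in_itv.
by rewrite sub0r normrN /f e1 e2 !mulr1 normr_id distrC.
Qed.

Variables (H H' : R -> R) (L : R).
Hypotheses (dH : forall t : R, is_derive t (1 : R) H (H' t)) (cH' : continuous H')
  (H'L : forall t, `|H' t| <= L).
Variables (psi dpsi : 'rV[R]_n -> R) (C C' : R).
Hypotheses (mpsi : measurable_fun setT psi) (mdpsi : measurable_fun setT dpsi).
Hypotheses (dpsiE : forall x, is_derive x e psi (dpsi x)).
Hypotheses (psiC : forall x, `|psi x| <= C) (dpsiC : forall x, `|dpsi x| <= C').
Hypothesis psiV : forall x s, psi x != 0 -> `|s| <= T -> V (x + s *: e).

Let HW x := H (uW x) * \1_W x.
Let tk (k : nat) := T / (2 ^ (k + 1))%:R.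

Let tk_gt0 k : 0 < tk k. Proof. by rewrite divr_gt0// ltr0n expn_gt0. Qed.

Let tk_le k : tk k <= T.
Proof. by rewrite ler_pdivrMr ?ltr0n ?expn_gt0// ler_peMr ?ler1n ?expn_gt0// ltW. Qed.

Let tk_norm k : `|tk k| <= T. Proof. by rewrite gtr0_norm. Qed.

Let tk_cvg0 : tk k @[k --> \oo] --> (0 : R).
Proof.
by have := @cvg_geometric_series_half R T 0 => /cvgP /cvg_series_cvg_0.
Qed.

Let mH : measurable_fun setT H.
Proof. by apply: continuous_measurable_fun; exact: C1_continuous dH. Qed.

Let L1HW : L1 mu HW.
Proof.
have : L1 mu (fun x => `|H 0| * \1_W x + L * `|uW x|).
  by apply: L1D; apply: L1_scale; [exact: L1_indic_compact|exact: L1_norm].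
apply: L1_le.
  apply: measurable_funM => //; exact: measurableT_comp mH (L1_measurable iu).
move=> x; rewrite /HW normrM [X in _ * X]ger0_norm//.
have := C1_lipschitz dH H'L 0 (uW x); rewrite subr0 => h.
have w1 : \1_W x <= 1 :> R by rewrite indicE lern1 leq_b1.
have w0 : 0 <= \1_W x :> R by [].
have : `|H (uW x)| <= `|H 0| + L * `|uW x|.
  by have := ler_normD (H 0) (H (uW x) - H 0); rewrite addrC subrK; lra.
move=> h2; apply: (le_trans (ler_wpM2r w0 h2)).
rewrite mulrDl lerD2l; apply: ler_piMr => //.
by rewrite mulr_ge0// (le_trans _ (H'L 0)).
Qed.

Let K x s : psi x != 0 -> `|s| <= T -> W (x + s *: e).
Proof. by move=> h1 h2; apply: VsubW; exact: psiV. Qed.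

Let psi0 x : ~ V x -> psi x = 0.
Proof.
move=> nV; apply/eqP; apply: contrapT => /negP h; apply: nV.
by have := psiV (s := 0) h; rewrite normr0 scale0r addr0; apply; exact: ltW.
Qed.

Let phi t x := dquot H H' (uW x) (uW (x + t *: e)) * psi x.

Let mphi t : measurable_fun setT (phi t).
Proof.
apply: measurable_funM => //; apply: measurable_dquot => //.
  exact: L1_measurable iu.
by apply: (measurableT_comp (L1_measurable iu)); exact: measurable_shift.
Qed.

Let phiC t x : `|phi t x| <= L * C.
Proof. by rewrite normrM ler_pM// (dquot_norm dH H'L). Qed.

Let J k (z : 'rV[R]_n * R) := gW z.1 * shear (- tk k) e (phi (tk k)) z.

(** The chain rule before passing to the limit: an increment of H(u) is the difference
    quotient of H times an increment of u, which [line_identity] expresses through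
    the weak derivative. *)
Let difference_identity k :
  (\int[mu]_x (HW x * (psi x - psi (x - tk k *: e)))%:E =
   - \int[mu]_x \int[leb]_s (tk k * gW x * shear (- tk k) e (phi (tk k)) (x, s))%:E)%E.
Proof.
set t := tk k; have tT : `|t| <= T by exact: tk_norm.
have itg : L1 mu (fun x => t * gW x) by exact: L1_scale.
have L1p (f : 'rV[R]_n -> R) v : L1 mu f -> L1 mu (fun x => f x * psi (x + v)).
  move=> if_; apply: (L1M (C := C) if_) => [|x]; last exact: psiC.
  by apply: (measurableT_comp mpsi); exact: measurable_shift.
have L1p0 (f : 'rV[R]_n -> R) : L1 mu f -> L1 mu (fun x => f x * psi x).
  by move=> /(L1p _ 0); under eq_fun do rewrite addr0.
under eq_integral do rewrite mulrBr EFinB.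
rewrite (integralB measurableT (L1p0 _ L1HW) (L1p _ _ L1HW)).
have -> : (\int[mu]_x (HW x * psi (x - t *: e))%:E = \int[mu]_x (HW (x + t *: e) * psi x)%:E)%E.
  rewrite -[LHS](integral_shift (t *: e) (L1p _ _ L1HW)).
  by apply: eq_integral => x _; rewrite addrK.
have L1s := L1_shift (t *: e) L1HW.
rewrite -(integralB measurableT (L1p0 _ L1HW) (L1p0 _ L1s)).
rewrite -(integral_shear_swap t e itg (mphi t) (phiC t)).
have [_ aeI _] := L1_partial (integrable_shear t e itg).
have iu' := L1_shift (t *: e) iu.
have L1d : L1 mu (fun x => (uW (x + t *: e) - uW x) * phi t x).
  by apply: (L1M (C := L * C)); [exact: L1B|exact: mphi|exact: phiC].
transitivity (- \int[mu]_x ((uW (x + t *: e) - uW x) * phi t x)%:E)%E.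
  rewrite -[RHS]mulN1e -(integralZl measurableT L1d).
  apply: eq_integral => x _; rewrite -EFinB -EFinM; congr EFin.
  have [p0|p0] := eqVneq (psi x) 0; first by rewrite /phi p0; ring.
  have W1 : W x by have := K (s := 0) p0; rewrite normr0 scale0r addr0; apply; exact: ltW.
  have W2 : W (x + t *: e) by exact: K.
  rewrite /HW !indicE !mem_set//.
  have hd := dquotE H H' (uW x) (uW (x + t *: e)).
  by rewrite /phi /= !mulr1 -mulrBl -opprB hd; ring.
congr (- _)%E; apply: ae_integral_eq.
have := line_identity wG oV WU VW iu ig uWu uW0 gWG gW0 tT.
apply: filterS2 aeI => x ix hx _.
under [RHS]eq_integral do rewrite EFinM.
rewrite integralZr// L1_EFin// -EFinM; congr EFin.
have [Vx|nV] := pselect (V x); first by rewrite hx.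
by rewrite /phi psi0// !mulr0.
Qed.

Let L1J k : L1 pi (J k).
Proof.
have i3 : L1 pi (shear 0 e gW) by exact: integrable_shear.
have i4 : L1 pi (fun z => shear 0 e gW z * shear (- tk k) e (phi (tk k)) z).
  apply: (@L1M _ _ _ _ _ _ (L * C)) => //; first by apply: measurable_shear; exact: mphi.
  move=> z; rewrite /shear normrM [X in _ * X]ger0_norm//.
  have := phiC (tk k) (z.1 + (- tk k * z.2) *: e); apply: le_trans.
  by rewrite ler_piMr// indicE lern1 leq_b1.
apply: eq_integrable i4 => // z _; congr EFin.
rewrite /J /shear mul0r scale0r addr0 !indicE.
by case: (_ \in _); rewrite ?mulr1 ?mulr0.
Qed.

Let slope k x := (psi x - psi (x - tk k *: e)) / tk k.

Let is_derive_psi x (h : R) :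
  is_derive h (1 : R) (fun h => psi (x + h *: e)) (dpsi (x + h *: e)).
Proof.
have d0 := (is_derive_lineP psi (x + h *: e) e (dpsi (x + h *: e))).2 (dpsiE _).
have d1 := is_derive_affine 1 (- h) h.
rewrite (_ : (fun h => _) = (fun k => psi (x + h *: e + k *: e)) \o (fun k => 1 * k + - h)).
  rewrite -[dpsi _]mulr1; apply: is_derive1_comp => //.
  by rewrite mul1r subrr.
apply/funext => k /=; rewrite -addrA -scalerDl; congr (psi (_ + _ *: _)); ring.
Qed.

Let psi_line x (r : nat -> R) : r k @[k --> \oo] --> (0 : R) ->
  psi (x + r k *: e) @[k --> \oo] --> psi x.
Proof.
move=> r0; have c0 : {for (0 : R), continuous (fun h : R => psi (x + h *: e))}.
  exact: is_derive_continuous (is_derive_psi x 0).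
have := continuous_cvg _ c0 r0; rewrite /= scale0r addr0; exact.
Qed.

Let slope_bound k x : `|slope k x| <= C'.
Proof.
have t0 := tk_gt0 k.
have [||c _] := @MVT _ (fun h => psi (x + h *: e)) (fun h => dpsi (x + h *: e)) (- tk k) 0
  _ (fun h _ => is_derive_psi x h); first by rewrite oppr_lt0.
  apply: continuous_subspaceT => h; exact: is_derive_continuous (is_derive_psi x h).
rewrite scale0r addr0 scaleNr sub0r opprK /slope => ->.
by rewrite mulfK ?gt_eqF.
Qed.

Let slope_cvg x : slope k x @[k --> \oo] --> dpsi x.
Proof.
have := is_derive_psi x 0; rewrite scale0r addr0 => -[] /[swap] <- /= d0.
have h : (fun h : R => h^-1 *: (((fun h => psi (x + h *: e)) \o shift 0) (h *: (1 : R)) -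
    psi (x + 0 *: e))) h @[h --> (0 : R)^'] --> 'D_1 (fun h : R => psi (x + h *: e)) 0 by exact: d0.
have := (cvgr_dnbhsP _ _ _).1 h (fun k => - tk k) _.
have -> : (fun k => slope k x) = (fun k => (fun h : R => h^-1 *: (((fun h => psi (x + h *: e)) \o shift 0) (h *: (1 : R)) -
    psi (x + 0 *: e))) (- tk k)).
  apply/funext => k /=; rewrite /slope addr0 scale0r addr0 [_ *: 1]mulr1 scaleNr.
  by rewrite invrN -[RHS]/(_ * _) mulNr -mulrN opprB mulrC.
apply; split; first by move=> k; rewrite oppr_eq0 gt_eqF.
by rewrite -oppr0; exact: cvgN tk_cvg0.
Qed.

Let L1slope k : L1 mu (fun x => HW x * slope k x).
Proof.
apply: (L1M (C := C') L1HW); last exact: slope_bound.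
apply: measurable_funM => //; apply: measurable_funB => //.
by apply: (measurableT_comp mpsi); exact: measurable_shift.
Qed.

Let slope_identity k : (\int[mu]_x (HW x * slope k x) = - \int[pi]_z J k z)%R.
Proof.
apply: EFin_inj; rewrite EFinN -(L1_EFin (L1slope k)) -(L1_EFin (L1J k)).
transitivity ((tk k)^-1%:E * (\int[mu]_x (HW x * (psi x - psi (x - tk k *: e)))%:E))%E.
  rewrite -integralZl//; last first.
    apply: eq_integrable (@integrableZl _ _ _ mu setT measurableT (tk k) _ (L1slope k)) => // x _.
    rewrite /= -EFinM; congr EFin; rewrite /slope; field.
    by rewrite gt_eqF.
  by apply: eq_integral => x _; rewrite -EFinM; congr EFin; rewrite /slope; ring.
rewrite difference_identity muleN; congr (- _)%E.
rewrite -(@integral12_prod_meas1 _ _ _ _ _ mu leb _ (L1J k)).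
transitivity ((tk k)^-1%:E * ((tk k)%:E * \int[pi]_z (J k z)%:E))%E; last first.
  by rewrite muleA -EFinM mulVf ?gt_eqF// mul1e -(@integral12_prod_meas1 _ _ _ _ _ mu leb _ (L1J k)).
congr (_ * _)%E; rewrite -integralZl//; last exact: L1J.
have i2 : L1 pi (fun z => tk k * J k z).
  by apply: L1_scale; exact: L1J.
under [RHS]eq_integral do rewrite -EFinM.
rewrite -[RHS](@integral12_prod_meas1 _ _ _ _ _ mu leb _ i2).
by apply: eq_integral => x _; apply: eq_integral => s _; rewrite /J /= mulrA.
Qed.

Let limJ (z : 'rV[R]_n * R) := gW z.1 * (H' (uW z.1) * psi z.1) * \1_`[0, 1] z.2.

Lemma chain_L1r : L1 mu (fun x => gW x * (H' (uW x) * psi x)).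
Proof.
apply: (L1M (C := L * C) ig); last by move=> x; rewrite normrM ler_pM.
apply: measurable_funM => //; apply: (measurableT_comp (f := H')).
  exact: continuous_measurable_fun.
exact: L1_measurable iu.
Qed.

(** In J k, the difference quotient of H is taken between u(x - t_k s e) and
    u(x + t_k (1 - s) e). Both converge to u(x) for almost every (x, s), and the
    quotients are bounded by L, so that dominated convergence applies. *)
Let J_cvg : (\int[pi]_z J k z)%R @[k --> \oo] --> (\int[mu]_x (gW x * (H' (uW x) * psi x)))%R.
Proof.
have elim : limJ = shear 0 e (fun x => gW x * (H' (uW x) * psi x)).
  by apply/funext => z; rewrite /limJ /shear mul0r scale0r addr0.
have L1lim : L1 pi limJ by rewrite elim; apply: integrable_shear; exact: chain_L1r.
have -> : (\int[mu]_x (gW x * (H' (uW x) * psi x)) = \int[pi]_z limJ z)%R.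
  apply: EFin_inj; rewrite -(L1_EFin chain_L1r) -(L1_EFin L1lim).
  rewrite -[RHS](@integral12_prod_meas1 _ _ _ _ _ mu leb _ L1lim).
  apply: eq_integral => x _; rewrite /fubini_F /limJ /=.
  under [RHS]eq_integral do rewrite EFinM.
  rewrite integralZl//; last exact: integrable_indic_itv.
  have e1 : (\int[leb]_s (\1_`[0%R, 1%R] s)%:E = 1)%E.
    by have := @ge0_integral_indic01 R 1%E lee01; under eq_integral do rewrite mul1e.
  by rewrite [X in (_ * X)%E]e1 mule1.
have i3 : L1 pi (shear 0 e gW) by exact: integrable_shear.
have tks k s : 0 <= s <= 1 -> `|tk k * s| <= tk k.
  move=> /andP[s0 s1]; rewrite normrM gtr0_norm// ger0_norm//.
  by rewrite ler_piMr// ltW.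
have c1 := @ae_cvg_translates (fun k s => - tk k * s) _ _.
have c2 := @ae_cvg_translates (fun k s => tk k * (1 - s)) _ _.
have [|||||_] // := @Rdominated_convergence _ _ _ pi J limJ (fun z => `|shear 0 e gW z| * `|L * C|).
- by move=> k; exact: L1_measurable (L1J k).
- exact: L1_measurable L1lim.
- have {}c1 := c1 ltac:(by move=> k; apply: measurable_funM)
    ltac:(by move=> k s s01; rewrite mulNr normrN; exact: tks).
  have {}c2 := c2 ltac:(by move=> k; apply: measurable_funM => //; exact: measurable_funB)
    ltac:(by move=> k s s01; apply: tks; lra).
  apply: (@ae_imp2 _ _ _ pi _ _ _ c1 c2) => z h1 h2; rewrite /J /limJ /shear.
  have [z01|z01] := boolP (0 <= z.2 <= 1); last first.
    rewrite indicE memNset ?mulr0; last by rewrite /= in_itv; exact/negP.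
    by under eq_fun do rewrite mulr0 mulr0; exact: cvg_cst.
  rewrite indicE mem_set/=; last by rewrite in_itv.
  rewrite mulr1; under eq_fun do rewrite mulr1.
  apply: cvgM; first exact: cvg_cst.
  have [Vz|nV] := pselect (V z.1); last first.
    rewrite psi0// mulr0 (_ : (fun k => _) = (fun=> 0)); first exact: cvg_cst.
    apply/funext => k; rewrite /phi; have [->|p0] := eqVneq (psi (z.1 + (- tk k * z.2) *: e)) 0.
      by rewrite mulr0.
    exfalso; apply: nV; have := psiV (s := tk k * z.2) p0.
    rewrite -addrA -scalerDl mulNr addNr scale0r addr0; apply.
    exact: le_trans (tks _ _ z01) (tk_le k).
  rewrite /phi; apply: cvgM; last first.
    apply: psi_line; rewrite -(mul0r z.2) -oppr0; apply: cvgM; last exact: cvg_cst.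
    exact: cvgN tk_cvg0.
  apply: (dquot_cvg dH cH') => //; first exact: h1.
  have := h2 Vz z01; apply: cvg_trans; apply: near_eq_cvg; apply: nearW => k.
  by rewrite -addrA -scalerDl; congr (uW (_ + _ *: _)); ring.
- by apply: (L1M (C := `|L * C|)); [exact: L1_norm|exact: measurable_cst|move=> z; rewrite normr_id].
- move=> k z; rewrite /J /shear mul0r scale0r addr0 !normrM -!mulrA.
  apply: ler_wpM2l => //; rewrite [leRHS]mulrC [X in X <= _]mulrA; apply: ler_wpM2r => //.
  rewrite -!normrM; apply: le_trans (phiC _ _) _; exact: ler_norm.
Qed.

Lemma chain_L1l : L1 mu (fun x => HW x * dpsi x).
Proof. exact: (L1M (C := C') L1HW). Qed.

(** The limit of [slope_identity] along the steps t_k: the slopes of psi converge to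
    its derivative and the right-hand side is [J_cvg]. *)
Lemma chain_local : (\int[mu]_x (HW x * dpsi x) = - \int[mu]_x (gW x * (H' (uW x) * psi x)))%R.
Proof.
have [_ h] : L1 mu (fun x => HW x * dpsi x) /\
    (\int[mu]_x (HW x * slope k x)) @[k --> \oo] --> \int[mu]_x (HW x * dpsi x).
  apply: (@Rdominated_convergence _ _ _ mu _ _ (fun x => `|HW x| * C')).
  - move=> k; apply: measurable_funM; first exact: L1_measurable L1HW.
    apply: measurable_funM => //; apply: measurable_funB => //.
    by apply: (measurableT_comp mpsi); exact: measurable_shift.
  - by apply: measurable_funM => //; exact: L1_measurable L1HW.
  - by apply: aeW => x; apply: cvgM; [exact: cvg_cst|exact: slope_cvg].
  - by apply: (L1M (C := `|C'|)) => //; exact: L1_norm.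
  - by move=> k x; rewrite normrM ler_wpM2l//; exact: slope_bound.
apply: cvg_unique h _ => //.
rewrite (_ : (fun k => _) = (fun k => - \int[pi]_z J k z)); last first.
  by apply/funext => k; exact: slope_identity.
exact: cvgN J_cvg.
Qed.

End chain.

(** * Measurability and local integrability *)

Section measurability.
Context {R : realType} {n : nat}.
Implicit Types (U V K : set 'rV[R]_n) (u f g h : 'rV[R]_n -> R).
Local Notation mu := (@lebesgue_rV R n).

Lemma lebesgue_measurable_funT U f : measurable_fun setT f -> lebesgue_measurable_fun U f.
Proof. by move=> mf; exists f; [exact: measurable_funTS|exact: aeW]. Qed.

Lemma lebesgue_measurable_funS U V f : measurable U -> measurable V -> V `<=` U ->
  lebesgue_measurable_fun U f -> lebesgue_measurable_fun V f.
Proof.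
move=> mU mV VU [h mh fh]; exists h; first exact: measurable_funS mh.
by apply: filterS fh => x + /VU; exact.
Qed.

Lemma lebesgue_measurable_fun_comp2 U (F : R * R -> R) f g : measurable_fun setT F ->
  lebesgue_measurable_fun U f -> lebesgue_measurable_fun U g ->
  lebesgue_measurable_fun U (fun x => F (f x, g x)).
Proof.
move=> mF [f' mf ff] [g' mg gg]; exists (fun x => F (f' x, g' x)).
  move=> mU; have mf2 : measurable_fun setT (f' \_ U) by apply/(measurable_restrictT _ mU).
  have mg2 : measurable_fun setT (g' \_ U) by apply/(measurable_restrictT _ mU).
  have m := measurableT_comp mF (measurable_fun_pair mf2 mg2).
  have m2 : measurable_fun U (fun x => F (f' x, g' x)).
    by apply: eq_measurable_fun (measurable_funTS m) => x xU /=; rewrite !patchE xU.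
  exact: m2.
by apply: filterS2 ff gg => x e1 e2 Ux; rewrite e1// e2.
Qed.

Lemma lebesgue_measurable_funD U f g : lebesgue_measurable_fun U f ->
  lebesgue_measurable_fun U g -> lebesgue_measurable_fun U (fun x => f x + g x).
Proof.
apply: (@lebesgue_measurable_fun_comp2 U (fun z => z.1 + z.2)).
by apply: measurable_funD.
Qed.

Lemma lebesgue_measurable_funM U f g : lebesgue_measurable_fun U f ->
  lebesgue_measurable_fun U g -> lebesgue_measurable_fun U (fun x => f x * g x).
Proof.
apply: (@lebesgue_measurable_fun_comp2 U (fun z => z.1 * z.2)).
by apply: measurable_funM.
Qed.

Lemma lebesgue_measurable_fun_comp U (F : R -> R) f : measurable_fun setT F ->
  lebesgue_measurable_fun U f -> lebesgue_measurable_fun U (fun x => F (f x)).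
Proof.
move=> mF mf; apply: (@lebesgue_measurable_fun_comp2 U (fun z => F z.1) f f) => //.
exact: measurableT_comp mF measurable_fst.
Qed.

Lemma lebesgue_measurable_fun_sum U (I : Type) (r : seq I) (f : I -> 'rV[R]_n -> R) :
  (forall i, lebesgue_measurable_fun U (f i)) ->
  lebesgue_measurable_fun U (fun x => \sum_(i <- r) f i x).
Proof.
move=> mf; elim: r => [|i r IH].
  by under eq_fun do rewrite big_nil; exact: lebesgue_measurable_funT.
by under eq_fun do rewrite big_cons; exact: lebesgue_measurable_funD.
Qed.

Lemma continuous_bounded_on K f : compact K -> continuous f ->
  exists C, forall x, K x -> `|f x| <= C.
Proof.
move=> cK cf; have := @continuous_compact _ _ f K (continuous_subspaceT cf) cK.
move=> /compact_bounded; rewrite /bounded_set => -[M [_ hM]].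
by exists (M + 1) => x Kx; apply: (hM (M + 1)); [rewrite ltrDl|exists x].
Qed.

Lemma continuous_bounded K f : compact K -> continuous f -> (forall x, ~ K x -> f x = 0) ->
  exists C, forall x, `|f x| <= C.
Proof.
move=> cK cf f0; have [C hC] := continuous_bounded_on cK cf.
exists (Num.max C 0) => x; have [Kx|/f0 ->] := pselect (K x).
  by rewrite le_max hC.
by rewrite normr0 le_max lexx orbT.
Qed.

Lemma integral_dom (D : set 'rV[R]_n) h (F : 'rV[R]_n -> R) : measurable D ->
  lebesgue_measurable_fun D h -> L1 mu F ->
  {ae mu, forall x, D x -> `|h x| <= F x} ->
  (\int[mu]_(x in D) `|h x|%:E <= \int[mu]_x `|F x|%:E)%E.
Proof.
move=> mD [h' mh' hh'] iF hF.
rewrite (@ae_integral_eq _ _ _ _ _ _ (fun x => `|h' x|%:E)); last first.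
  by apply: filterS hh' => x e Kx; rewrite e.
apply: le_trans (_ : (\int[mu]_(x in D) `|F x|%:E <= _)%E).
  apply: ae_ge0_le_integral => //.
  - by apply/measurable_EFinP; exact: measurableT_comp mh'.
  - apply/measurable_EFinP; apply: measurable_funTS; apply: measurableT_comp => //.
    exact: L1_measurable iF.
  - apply: filterS2 hh' hF => x e1 e2 Kx; rewrite lee_fin -e1//.
    by apply: le_trans (e2 Kx) _; exact: ler_norm.
apply: ge0_subset_integral => //; apply/measurable_EFinP; apply: measurableT_comp => //.
exact: L1_measurable iF.
Qed.

Lemma integral_dom_lty (D : set 'rV[R]_n) h (F : 'rV[R]_n -> R) : measurable D ->
  lebesgue_measurable_fun D h -> L1 mu F ->
  {ae mu, forall x, D x -> `|h x| <= F x} -> (\int[mu]_(x in D) `|h x|%:E < +oo)%E.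
Proof.
move=> mD mh iF hF; apply: le_lt_trans (integral_dom mD mh iF hF) _.
by rewrite (L1_EFin (L1_norm iF)) ltry.
Qed.

Lemma integral_abs_eq0 (D : set 'rV[R]_n) h : measurable D -> lebesgue_measurable_fun D h ->
  (\int[mu]_(x in D) `|h x|%:E = 0)%E -> {ae mu, forall x, D x -> h x = 0}.
Proof.
move=> mD [h' mh' hh'].
rewrite (@ae_integral_eq _ _ _ _ _ _ (fun x => `|(h' x)%:E|%E)); last first.
  by apply: filterS hh' => x e Kx; rewrite e.
move=> /ae_eq_integral_abs => h0; have {}h0 := h0 mD (iffRL (measurable_EFinP _ _) mh').
by apply: filterS2 hh' h0 => x e1 e2 Dx; rewrite e1//; apply: EFin_inj; exact: e2.
Qed.

Lemma loc_integrable_dom U f : open U -> lebesgue_measurable_fun U f ->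
  (forall K, K `<=` U -> compact K ->
     exists2 F, L1 mu F & {ae mu, forall x, K x -> `|f x| <= F x}) -> loc_integrable U f.
Proof.
move=> oU mf h; split=> // K KU cK; have [F iF fF] := h K KU cK.
have mK := compact_measurable_rV cK.
apply: integral_dom_lty iF fF => //.
by apply: lebesgue_measurable_funS mf => //; exact: open_measurable_rV.
Qed.

Lemma loc_integrable_bound U f h : open U -> lebesgue_measurable_fun U h -> loc_integrable U f ->
  (forall K, K `<=` U -> compact K ->
     exists C, {ae mu, forall x, K x -> `|h x| <= C * (`|f x| + 1)}) ->
  loc_integrable U h.
Proof.
move=> oU mh lf hC; apply: loc_integrable_dom => // K KU cK; have {hC}[C hC] := hC K KU cK.
have [fK [ifK fKf fK0]] := loc_integrable_repr oU KU cK lf.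
exists (fun x => C * (`|fK x| + \1_K x)).
  apply: L1_scale; apply: L1D; first exact: L1_norm.
  exact: L1_indic_compact.
by apply: filterS2 hC fKf => x e2 e3 Kx; rewrite e3// indicE mem_set//=; exact: e2.
Qed.

Lemma loc_integrableD U f g : open U -> loc_integrable U f -> loc_integrable U g ->
  loc_integrable U (fun x => f x + g x).
Proof.
move=> oU lf lg; apply: loc_integrable_dom => // [|K KU cK].
  exact: lebesgue_measurable_funD lf.1 lg.1.
have [f' [if' ff' f0]] := loc_integrable_repr oU KU cK lf.
have [g' [ig' gg' g0]] := loc_integrable_repr oU KU cK lg.
exists (fun x => `|f' x| + `|g' x|); first by apply: L1D; exact: L1_norm.
by apply: filterS2 ff' gg' => x e1 e2 Kx; rewrite e1// e2//; exact: ler_normD.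
Qed.

Lemma loc_integrableM U f g : open U -> loc_integrable U f -> continuous g ->
  loc_integrable U (fun x => f x * g x).
Proof.
move=> oU lf cg; have mg := lebesgue_measurable_funT U (continuous_measurable_rV cg).
apply: (loc_integrable_bound oU _ lf) => [|K KU cK].
  exact: lebesgue_measurable_funM lf.1 mg.
have [C hC] := continuous_bounded_on cK cg; exists C; apply: aeW => x Kx.
rewrite normrM mulrC; apply: le_trans (_ : C * `|f x| <= _).
  by rewrite ler_wpM2r// hC.
by rewrite ler_wpM2l ?lerDl// (le_trans _ (hC x Kx)).
Qed.

Lemma integral_testD U K (f1 f2 g1 g2 : 'rV[R]_n -> R) : open U -> K `<=` U -> compact K ->
  loc_integrable U f1 -> continuous g1 -> (forall x, ~ K x -> g1 x = 0) ->
  loc_integrable U f2 -> continuous g2 -> (forall x, ~ K x -> g2 x = 0) ->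
  (\int[mu]_(x in U) (f1 x * g1 x + f2 x * g2 x)%:E =
   \int[mu]_(x in U) (f1 x * g1 x)%:E + \int[mu]_(x in U) (f2 x * g2 x)%:E)%E
  /\ (\int[mu]_(x in U) (f1 x * g1 x)%:E \is a fin_num)%E.
Proof.
move=> oU KU cK lf1 cg1 g10 lf2 cg2 g20.
have [h1 [ih1 hf1 h10]] := loc_integrable_repr oU KU cK lf1.
have [h2 [ih2 hf2 h20]] := loc_integrable_repr oU KU cK lf2.
rewrite (integral_repr KU hf1 h10 g10) (integral_repr KU hf2 h20 g20).
have [C1 hC1] := continuous_bounded cK cg1 g10.
have [C2 hC2] := continuous_bounded cK cg2 g20.
have i1 : L1 mu (fun x => h1 x * g1 x) by apply: (L1M ih1) hC1; exact: continuous_measurable_rV.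
have i2 : L1 mu (fun x => h2 x * g2 x) by apply: (L1M ih2) hC2; exact: continuous_measurable_rV.
split; last by rewrite L1_EFin.
rewrite -(@integralD _ _ _ mu setT measurableT _ _ i1 i2) (@integral_vanish _ _ U K)//; last first.
  by move=> x _ nK; rewrite g10// g20// !mulr0 addr0.
rewrite [RHS](@integral_vanish _ _ setT K)//; last first.
  by move=> x _ nK; rewrite /= g10// g20// !mulr0 adde0.
apply: ae_integral_eq; apply: filterS2 hf1 hf2 => x e1 e2 Kx /=.
by rewrite e1// e2// EFinD.
Qed.

End measurability.

(** * The chain and product rules for weak gradients *)

Section chain_rule.
Context {R : realType} {n : nat}.
Implicit Types (x v : 'rV[R]_n) (U V K : set 'rV[R]_n).
Local Notation mu := (@lebesgue_rV R n).

(** The open sets O k of points with a cube of radius greater than 1/(k + 1) inside U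
    increase to a cover of K, hence one of them contains K. *)
Lemma compact_margin U K : open U -> compact K -> K `<=` U ->
  exists2 r : R, 0 < r & forall x, K x -> cbox (fun i => x ord0 i - r) (fun i => x ord0 i + r) `<=` U.
Proof.
move=> oU cK KU.
pose O (k : nat) := [set x : 'rV[R]_n | exists2 r : R, k.+1%:R^-1 < r &
   cbox (fun i => x ord0 i - r) (fun i => x ord0 i + r) `<=` U].
have oO k : open (O k).
  rewrite openE => x [r]; rewrite /O; set e := k.+1%:R^-1 => kr rU; pose d := (r - e) / 2.
  have d0 : 0 < d by rewrite divr_gt0// subr_gt0.
  rewrite /interior -nbhs_ballE; exists d => //= y /rV_ballP[_ xy].
  exists (r - d); first by rewrite /d; lra.
  move=> z zy; apply: rU => i; have := zy i; have := xy i.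
  by rewrite ltr_norml; lra.
have ndO : nondecreasing_seq O.
  apply/nondecreasing_seqP => k; apply/subsetPset => x [r kr rU]; exists r => //.
  by apply: le_lt_trans kr; rewrite lef_pV2 ?posrE ?ltr0n// ler_nat.
have [|k KO] := compact_sub_increasing oO ndO cK.
  move=> x /KU Ux; have [r r0 rU] := open_obox_sub oU Ux.
  have [k _ kr] := near_infty_natSinv_lt (PosNum r0).
  by exists k => //; exists r => //; exact: kr (leqnn k).
exists k.+1%:R^-1; first by rewrite invr_gt0.
set e := k.+1%:R^-1 => x /KO[r kr rU] z zx; apply: rU => i; have := zx i; rewrite -/e in kr *; lra.
Qed.

Variables (U : set 'rV[R]_n) (u : 'rV[R]_n -> R) (G : 'rV[R]_n -> 'rV[R]_n).
Hypotheses (oU : open U) (wG : weak_gradient U u G).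
Variables (H H' : R -> R) (L : R).
Hypotheses (dH : forall t : R, is_derive t (1 : R) H (H' t)) (cH' : continuous H')
  (H'L : forall t, `|H' t| <= L).

(** Localization of [chain_local] around the support of psi. *)
Lemma chain_rule (i : 'I_n) (psi dpsi : 'rV[R]_n -> R) K : compact K -> K `<=` U ->
  continuous psi -> continuous dpsi ->
  (forall x, is_derive x (unit_rV i) psi (dpsi x)) -> (forall x, ~ K x -> psi x = 0) ->
  (\int[mu]_(x in U) (H (u x) * dpsi x)%:E =
   - \int[mu]_(x in U) (G x ord0 i * (H' (u x) * psi x))%:E)%E.
Proof.
move=> cK KU cpsi cdpsi dpsiE psi0.
have dpsi0 x : ~ K x -> dpsi x = 0.
  move=> nK; have [_ <-] := dpsiE x; apply: derive_out.
  have /closure_id cK' : closed K by apply: compact_closed => //; exact: norm_hausdorff.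
  move=> h; apply: nK; rewrite cK'; move: h; apply: closure_subset => y /= /eqP py.
  by apply: contrapT => /psi0.
have [r r0 rU] := compact_margin oU cK KU; pose T := r / 3.
have T0 : 0 < T by rewrite divr_gt0.
(* V and W are the neighbourhoods of K of radius 2 T and 3 T, so that moving by T
   along an axis leads from K into V and from V into W, and W is compact in U *)
pose V := \bigcup_(k in K) obox (fun i => k ord0 i - 2 * T) (fun i => k ord0 i + 2 * T).
pose W := (fun z : 'rV[R]_n * 'rV[R]_n => z.1 + z.2) @` (K `*` cbox (fun=> - r) (fun=> r)).
have oV : open V by apply: bigcup_open => x _; exact: open_obox.
have cW : compact W.
  apply: continuous_compact; last by apply: compact_setX => //; exact: compact_cbox.
  apply: continuous_subspaceT => z; exact: add_continuous.
have inW x k : K k -> (forall j, `|x ord0 j - k ord0 j| <= r) -> W x.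
  move=> Kk h; exists (k, x - k) => /=; last by rewrite addrC subrK.
  by split => //= j; rewrite !mxE; have := h j; rewrite ler_norml.
have WU : W `<=` U.
  move=> _ [[k y] /= [Kk ky] <-]; apply: (rU k Kk) => j; rewrite !mxE.
  by have := ky j; lra.
have coordT x s j : `|s| <= T -> `|(x + s *: unit_rV i) ord0 j - x ord0 j| <= T.
  move=> sT; rewrite coord_line addrC addKr.
  by case: eqP => _ /=; rewrite ?mulr1// mulr0 normr0 ltW.
have VW x s : V x -> `|s| <= T -> W (x + s *: unit_rV i).
  move=> [k Kk xk] sT; apply: (inW _ k Kk) => j; have := coordT x s j sT.
  by have := xk j; rewrite !ler_norml /T; lra.
have psiV x s : psi x != 0 -> `|s| <= T -> V (x + s *: unit_rV i).
  move=> /eqP px sT; have Kx : K x by apply: contrapT => /psi0.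
  exists x => // j; have := coordT x s j sT.
  by rewrite ler_norml /T; lra.
have KW : K `<=` W by move=> x Kx; apply: (inW _ x Kx) => j; rewrite subrr normr0 ltW.
have [uW [iu uWu uW0]] := loc_integrable_repr oU WU cW wG.1.
have [gW [ig gWG gW0]] := loc_integrable_repr oU WU cW (wG.2 i).1.
have [C psiC] := continuous_bounded cK cpsi psi0.
have [C' dpsiC] := continuous_bounded cK cdpsi dpsi0.
have mpsi := continuous_measurable_rV cpsi.
have mdpsi := continuous_measurable_rV cdpsi.
have E := chain_local wG oV WU cW VW T0 iu ig uWu uW0 gWG gW0 dH cH' H'L mpsi mdpsi dpsiE psiC dpsiC psiV.
have L1l := chain_L1l cW iu dH H'L mdpsi dpsiC.
have L1r := chain_L1r iu ig cH' H'L mpsi psiC.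
have HWu : {ae mu, forall x, W x -> H (uW x) * \1_W x = H (u x)}.
  by apply: filterS uWu => x e Wx; rewrite e// indicE mem_set// mulr1.
have HW0 x : ~ W x -> H (uW x) * \1_W x = 0.
  by move=> nW; rewrite indicE memNset// mulr0.
have dW x : ~ W x -> dpsi x = 0 by move=> nW; apply: dpsi0 => /KW.
have pW x : ~ W x -> psi x = 0 by move=> nW; apply: psi0 => /KW.
rewrite (integral_repr WU HWu HW0 dW) L1_EFin// E EFinN -L1_EFin//; congr (- _)%E.
have h x : gW x * (H' (uW x) * psi x) = (gW x * H' (uW x)) * psi x by rewrite mulrA.
under eq_integral do rewrite h.
under [RHS]eq_integral do rewrite mulrA.
apply/esym; apply: (integral_repr WU _ _ pW).
  by apply: filterS2 uWu gWG => x e1 e2 Wx; rewrite e1// e2.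
by move=> x nW; rewrite gW0// mul0r.
Qed.

Lemma loc_integrable_compH : loc_integrable U (fun x => H (u x)).
Proof.
have cH : continuous H by exact: C1_continuous dH.
apply: (loc_integrable_bound oU _ wG.1).
  by apply: lebesgue_measurable_fun_comp wG.1.1; exact: continuous_measurable_fun.
move=> K KU cK; exists (`|H 0| + L); apply: aeW => x Kx.
have := C1_lipschitz dH H'L 0 (u x); rewrite subr0 => h.
have := ler_normD (H 0) (H (u x) - H 0); rewrite addrC subrK => h2.
have L0 : 0 <= L by apply: le_trans (H'L 0).
have := mulr_ge0 (normr_ge0 (H 0)) (normr_ge0 (u x)).
by rewrite mulrDl !mulrDr; lra.
Qed.

Lemma loc_integrable_chain (i : 'I_n) : loc_integrable U (fun x => H' (u x) * G x ord0 i).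
Proof.
apply: (loc_integrable_bound oU _ (wG.2 i).1).
  apply: lebesgue_measurable_funM (wG.2 i).1.1.
  by apply: lebesgue_measurable_fun_comp wG.1.1; exact: continuous_measurable_fun.
move=> K KU cK; exists L; apply: aeW => x Kx.
have L0 : 0 <= L by apply: le_trans (H'L 0).
rewrite normrM; apply: (@le_trans _ _ (L * `|G x ord0 i|)); first by rewrite ler_wpM2r.
by rewrite ler_wpM2l// lerDl.
Qed.

(** The product rule with Phi comes for free: testing H(u) Phi with f amounts to
    testing H(u) with the C^1 function Phi f. *)
Lemma weak_gradient_chain (Phi : 'rV[R]_n -> R) (dPhi : 'I_n -> 'rV[R]_n -> R) :
  continuous Phi -> (forall i, continuous (dPhi i)) ->
  (forall i x, is_derive x (unit_rV i) Phi (dPhi i x)) ->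
  weak_gradient U (fun x => H (u x) * Phi x)
    (fun x => \row_i (H' (u x) * G x ord0 i * Phi x + H (u x) * dPhi i x)).
Proof.
move=> cP cdP dP; have lH := loc_integrable_compH.
split; first exact: loc_integrableM.
move=> i; have lG := loc_integrable_chain i; split.
  rewrite (_ : (fun x => _) = (fun x => H' (u x) * G x ord0 i * Phi x + H (u x) * dPhi i x)).
    by apply: loc_integrableD; [|exact: loc_integrableM|exact: loc_integrableM].
  by apply/funext => x; rewrite mxE.
move=> f [sf cf fU]; under [X in (- X)%E]eq_integral do rewrite mxE.
have [c0 d0] := sf [::]; have [c1 _] := sf [:: i]; rewrite /= in c0 d0 c1.
pose psi x := Phi x * f x; pose dpsi x := Phi x * 'D_(unit_rV i) f x + f x * dPhi i x.
have dpsiE x : is_derive x (unit_rV i) psi (dpsi x).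
  have df : is_derive x (unit_rV i) f ('D_(unit_rV i) f x) by apply/derivableP; exact: d0.
  exact: is_deriveM.
have cMP (h1 h2 : 'rV[R]_n -> R) : continuous h1 -> continuous h2 -> continuous (fun x => h1 x * h2 x).
  by move=> k1 k2 x; exact: (@continuousM _ _ h1 h2 x (k1 x) (k2 x)).
have cpsi : continuous psi by exact: cMP.
have cdpsi : continuous dpsi.
  by move=> x; exact: (continuousD (cMP _ _ cP c1 x) (cMP _ _ c0 (cdP i) x)).
set K := closure [set x | f x != 0] in cf fU.
have f0 x : ~ K x -> f x = 0 by exact: fun_out.
have df0 x : ~ K x -> 'D_(unit_rV i) f x = 0 by exact: derive_out.
have psi0 x : ~ K x -> psi x = 0 by move=> /f0 h; rewrite /psi h mulr0.
have E := chain_rule cf fU cpsi cdpsi dpsiE psi0.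
have cPdf : continuous (fun x => Phi x * 'D_(unit_rV i) f x) by exact: cMP.
have cfdP : continuous (fun x => f x * dPhi i x) by exact: cMP.
have Pdf0 x : ~ K x -> Phi x * 'D_(unit_rV i) f x = 0 by move=> /df0 ->; rewrite mulr0.
have fdP0 x : ~ K x -> f x * dPhi i x = 0 by move=> /f0 ->; rewrite mul0r.
have [e1 fin1] := integral_testD oU fU cf lH cPdf Pdf0 lH cfdP fdP0.
have [e2 fin2] := integral_testD oU fU cf lG cpsi psi0 lH cfdP fdP0.
have [_ fin3] := integral_testD oU fU cf lH cfdP fdP0 lG cpsi psi0.
have {}E : (\int[mu]_(x in U) (H (u x) * (Phi x * 'D_(unit_rV i) f x))%:E +
    \int[mu]_(x in U) (H (u x) * (f x * dPhi i x))%:E =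
    - \int[mu]_(x in U) (H' (u x) * G x ord0 i * psi x)%:E)%E.
  transitivity (\int[mu]_(x in U) (H (u x) * dpsi x)%:E)%E.
    by rewrite -e1; apply: eq_integral => x _; rewrite /dpsi mulrDr.
  by rewrite E; congr (- _)%E; apply: eq_integral => x _; congr EFin; ring.
transitivity (\int[mu]_(x in U) (H (u x) * (Phi x * 'D_(unit_rV i) f x))%:E)%E.
  by apply: eq_integral => x _; rewrite mulrA.
transitivity (- \int[mu]_(x in U) (H' (u x) * G x ord0 i * psi x + H (u x) * (f x * dPhi i x))%:E)%E; last first.
  by congr (- _)%E; apply: eq_integral => x _; congr EFin; rewrite /psi; ring.
rewrite e2; move: E fin1 fin2 fin3.
set a1 := integral _ _ _; set a2 := integral _ _ _; set a3 := integral _ _ _.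
case: a1 => [a1| |] //; case: a2 => [a2| |] //; case: a3 => [a3| |] //.
move=> /(congr1 fine) /= E _ _ _; apply: (congr1 EFin); lra.
Qed.

End chain_rule.

(** * A C^1 step and a C^1 nonlinearity of slow growth *)

Section profiles.
Context {R : realType}.
Implicit Types s t : R.

Definition pos2 s : R := (Num.max s 0) ^+ 2.

Lemma continuous_pos s : {for s, continuous (fun s => Num.max s 0)}.
Proof. exact: (@continuous_max _ _ id (cst 0) s cvg_id (cvg_cst _)). Qed.

Lemma is_derive_pos2 s : is_derive s (1 : R) pos2 (2 * Num.max s 0).
Proof.
have [s0|s0|->] := ltrgtP s 0; last 1 first.
- apply/is_derive1_caratheodory; exists (fun z => Num.max z 0); split.
  + move=> z; rewrite /pos2 maxxx expr0n subr0 subr0 /=.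
    by have [z0|z0] := leP z 0; [rewrite mul0r expr0n|rewrite expr2].
  + exact: continuous_pos.
  + by rewrite maxxx mulr0.
- rewrite mulr0.
  have h : is_derive s (1 : R) (cst (0 : R)) 0 by exact: is_derive_cst.
  apply: near_eq_is_derive h.
  near=> z; rewrite /pos2 max_r ?expr0n//; apply: ltW.
  by near: z; exact: lt_nbhsl.
have h : is_derive s (1 : R) (fun z => z ^+ 2) (2 * s).
  have h := is_deriveM (is_derive_id s (1 : R)) (is_derive_id s (1 : R)).
  rewrite (_ : (fun z => z ^+ 2) = (id : R -> R) * (id : R -> R)); last first.
    by apply/funext => z; rewrite expr2.
  by apply: is_derive_eq h _; rewrite -![_ *: _]/(_ * _) /=; ring.
apply: near_eq_is_derive h.
near=> z; rewrite /pos2 max_l//; apply: ltW.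
by near: z; exact: lt_nbhsr.
Unshelve. all: by end_near. Qed.

Lemma pos2_continuous : continuous pos2.
Proof. by move=> s; exact: is_derive_continuous (is_derive_pos2 s). Qed.

Lemma pos2_ge0 s : 0 <= pos2 s. Proof. exact: sqr_ge0. Qed.

Lemma pos2_le0 s : s <= 0 -> pos2 s = 0. Proof. by move=> s0; rewrite /pos2 max_r// expr0n. Qed.

Lemma pos2E s : 0 <= s -> pos2 s = s ^+ 2. Proof. by move=> s0; rewrite /pos2 max_l. Qed.

(** Two parabolas glued at 1/2: the simplest C^1 function with values 0 before 0 and 1
    after 1. Arguments are kept in the affine form c t + d so that one differentiation
    lemma covers all three terms. *)
Definition step t : R := 2 * pos2 (1 * t + 0) - 4 * pos2 (1 * t - 2^-1) + 2 * pos2 (1 * t - 1).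
Definition dstep t : R :=
  4 * Num.max t 0 - 8 * Num.max (t - 2^-1) 0 + 4 * Num.max (t - 1) 0.

Lemma is_derive_step t : is_derive t (1 : R) step (dstep t).
Proof.
have d c := is_derive_comp_affine (is_derive_pos2 (1 * t + c)).
have h := is_deriveD (is_deriveB (is_deriveZ 2 (d 0)) (is_deriveZ 4 (d (- 2^-1)))) (is_deriveZ 2 (d (- 1))).
apply: is_derive_eq h _; rewrite /dstep !mul1r !mulr1 addr0.
by rewrite -![_ *: _]/(_ * _) !mulrA; congr (_ * _ - _ * _ + _ * _); lra.
Qed.

Lemma dstep_continuous : continuous dstep.
Proof.
have c d : continuous (fun t => Num.max (t - d) 0).
  move=> t; apply: (@continuous_max _ _ (fun t => t - d) (cst 0)); last exact: cvg_cst.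
  by apply: cvgB; [exact: cvg_id|exact: cvg_cst].
move=> t; apply: cvgD; last by apply: cvgM; [exact: cvg_cst|exact: c].
apply: cvgB; apply: cvgM; try exact: cvg_cst; last exact: c.
exact: continuous_pos.
Qed.

Lemma step0 t : t <= 0 -> step t = 0.
Proof. by move=> t0; rewrite /step !pos2_le0; lra. Qed.

Lemma step1 t : 1 <= t -> step t = 1.
Proof. by move=> t1; rewrite /step !pos2E; nra. Qed.

Lemma step_ge0 t : 0 <= step t.
Proof.
have [t0|t0] := leP t 0; first by rewrite step0.
have [t1|t1] := leP 1 t; first by rewrite step1.
have [t2|t2] := leP t 2^-1; rewrite /step [pos2 (1 * t - 1)]pos2_le0; try lra.
  by rewrite [pos2 (_ - 2^-1)]pos2_le0 ?pos2E; nra.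
by rewrite !pos2E; nra.
Qed.

Lemma step_le1 t : step t <= 1.
Proof.
have [t0|t0] := leP t 0; first by rewrite step0.
have [t1|t1] := leP 1 t; first by rewrite step1.
have [t2|t2] := leP t 2^-1; rewrite /step [pos2 (1 * t - 1)]pos2_le0; try lra.
  by rewrite [pos2 (_ - 2^-1)]pos2_le0 ?pos2E; nra.
by rewrite !pos2E; nra.
Qed.

Lemma dstep_bound t : `|dstep t| <= 2.
Proof.
rewrite ler_norml /dstep.
by have [?|?] := leP t 0; have [?|?] := leP (t - 2^-1) 0; have [?|?] := leP (t - 1) 0; lra.
Qed.

Lemma dstep_out t : ~~ (0 < t < 1) -> dstep t = 0.
Proof.
rewrite negb_and -!leNgt /dstep => /orP[h|h].
  by rewrite !max_r; lra.
by rewrite !max_l; lra.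
Qed.

End profiles.

Section power_profile.
Context {R : realType}.
Variable kap : R.
Hypothesis kap01 : 0 < kap <= 2^-1.
Implicit Types s t : R.

(** Grows like s^(2 kap) at infinity but vanishes to second order at 0, which makes
    its extension by 0 to s <= 0 of class C^1. *)
Definition power_profile s : R := (1 + pos2 s) `^ kap - 1.
Definition dpower_profile s : R := 2 * kap * Num.max s 0 * (1 + pos2 s) `^ (kap - 1).

Let pos21 s : 0 < 1 + pos2 s.
Proof. by have := pos2_ge0 s; lra. Qed.

Lemma is_derive_power_profile s : is_derive s (1 : R) power_profile (dpower_profile s).
Proof.
have d1 := is_deriveD (is_derive_cst (1 : R) s 1) (is_derive_pos2 s).
have d2 := @is_derive1_comp _ (fun z : R => z `^ kap) (fun s => 1 + pos2 s) s _ _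
  (is_derive1_powR kap (pos21 s)) d1.
have d3 := is_deriveB d2 (is_derive_cst (1 : R) s 1).
by apply: is_derive_eq d3 _; rewrite /dpower_profile add0r subr0; ring.
Qed.

Lemma dpower_profile_continuous : continuous dpower_profile.
Proof.
move=> s; apply: cvgM.
  by apply: cvgM; [exact: cvg_cst|exact: continuous_pos].
apply: (@continuous_comp _ _ _ (fun s => 1 + pos2 s) (fun z : R => z `^ (kap - 1))).
  by apply: cvgD; [exact: cvg_cst|exact: pos2_continuous].
exact: is_derive_continuous (is_derive1_powR _ (pos21 s)).
Qed.

Lemma power_profile0 s : s <= 0 -> power_profile s = 0.
Proof. by move=> s0; rewrite /power_profile pos2_le0// addr0 powR1 subrr. Qed.

Lemma dpower_profile0 s : s <= 0 -> dpower_profile s = 0.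
Proof. by move=> s0; rewrite /dpower_profile max_r// mulr0 mul0r. Qed.

Lemma power_profile_gt0 s : 0 < s -> 0 < power_profile s.
Proof.
move=> s0; rewrite subr_gt0 -[X in X < _](congr1 (@^~ kap) (@powR1 R)).
have /andP[k0 _] := kap01.
by apply: gt0_ltr_powR; rewrite ?nnegrE// ?ltW// ltrDl pos2E ?ltW// exprn_gt0.
Qed.

Lemma power_profile_ge0 s : 0 <= power_profile s.
Proof.
have [s0|s0] := leP s 0; first by rewrite power_profile0.
exact/ltW/power_profile_gt0.
Qed.

Lemma dpower_profile_ge0 s : 0 <= dpower_profile s.
Proof.
have /andP[k0 _] := kap01.
have m0 : 0 <= Num.max s 0 by rewrite le_max lexx orbT.
by rewrite /dpower_profile !mulr_ge0 ?powR_ge0// ltW.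
Qed.

(** With c = s^2 this is (1 + c)^kap - c (1 + c)^(kap - 1) = (1 + c)^(kap - 1) <= 1,
    as kap < 1. *)
Lemma power_profile_le s : power_profile s <= pos2 s * (1 + pos2 s) `^ (kap - 1).
Proof.
have /andP[k0 k1] := kap01; have c0 := pos2_ge0 s; have c1 := pos21 s.
rewrite /power_profile.
have -> : (1 + pos2 s) `^ kap = (1 + pos2 s) * (1 + pos2 s) `^ (kap - 1).
  by rewrite mulr_powRB1// ltW.
rewrite mulrDl mul1r lerBlDr addrC lerD2l.
rewrite -[leRHS](powRr0 (1 + pos2 s)); apply: ler_powR; lra.
Qed.

Lemma power_profile_derive s : 2 * kap * power_profile s <= dpower_profile s * s.
Proof.
have /andP[k0 k1] := kap01.
have [s0|s0] := leP s 0; first by rewrite power_profile0// dpower_profile0// mulr0 mul0r.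
have h := power_profile_le s; rewrite /dpower_profile (max_l (ltW s0)).
rewrite pos2E ?(ltW s0)// in h *.
have -> : 2 * kap * s * (1 + s ^+ 2) `^ (kap - 1) * s = 2 * kap * (s ^+ 2 * (1 + s ^+ 2) `^ (kap - 1)).
  by ring.
by rewrite ler_wpM2l//; lra.
Qed.

Lemma power_profile_growth s : 0 <= s -> power_profile s <= s `^ (2 * kap).
Proof.
move=> s0; have /andP[k0 k1] := kap01.
have [->|s1] := eqVneq s 0.
  by rewrite power_profile0// powR_ge0.
have {s1 s0} s0 : 0 < s by rewrite lt_def s1.
apply: le_trans (power_profile_le s) _; rewrite pos2E ?(ltW s0)//.
have s20 : 0 < s ^+ 2 by rewrite exprn_gt0.
have -> : s `^ (2 * kap) = s ^+ 2 * (s ^+ 2) `^ (kap - 1).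
  by rewrite mulr_powRB1 ?(ltW s20)// powRrM powR_mulrn// ltW.
rewrite ler_pM2l// -opprB !powRN lef_pV2 ?posrE ?powR_gt0//; last lra.
by apply: ge0_ler_powR; rewrite ?nnegrE; lra.
Qed.

Lemma dpower_profile_le1 s : dpower_profile s <= 1.
Proof.
have /andP[k0 k1] := kap01.
have [s0|s0] := leP s 0; first by rewrite dpower_profile0.
rewrite /dpower_profile (max_l (ltW s0)) pos2E ?(ltW s0)//.
have s20 : 0 < s ^+ 2 by rewrite exprn_gt0.
have h1 : (1 + s ^+ 2) `^ (kap - 1) <= s^-1.
  apply: (@le_trans _ _ ((1 + s ^+ 2) `^ (- 2^-1))); first by apply: ler_powR; lra.
  rewrite powRN lef_pV2 ?posrE ?powR_gt0//; last lra.
  rewrite powR12_sqrt; last lra.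
  rewrite -[X in X <= _](ger0_norm (ltW s0)) -sqrtr_sqr ler_sqrt; lra.
have h2 : s * (1 + s ^+ 2) `^ (kap - 1) <= 1 by rewrite mulrC -ler_pdivlMr// div1r.
have h3 : 0 <= s * (1 + s ^+ 2) `^ (kap - 1) by rewrite mulr_ge0 ?powR_ge0// ltW.
by rewrite -mulrA; nra.
Qed.

Variable M : R.
Hypothesis M0 : 0 < M.

(** The odd extension of t |-> power_profile (t - M): it kills the set |u| <= M, and
    inherits from the profile the two inequalities that the energy estimate needs,
    [Htest_growth] and [Htest_derive]. *)
Definition Htest t : R := power_profile (1 * t - M) - power_profile (- 1 * t - M).
Definition dHtest t : R := dpower_profile (1 * t - M) + dpower_profile (- 1 * t - M).

Lemma is_derive_Htest t : is_derive t (1 : R) Htest (dHtest t).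
Proof.
have d c := is_derive_comp_affine (is_derive_power_profile (c * t - M)).
apply: is_derive_eq (is_deriveB (d 1) (d (- 1))) _.
by rewrite /dHtest; ring.
Qed.

Lemma dHtest_continuous : continuous dHtest.
Proof.
move=> t; apply: cvgD.
  apply: (@continuous_comp _ _ _ (fun t => 1 * t - M) dpower_profile); last exact: dpower_profile_continuous.
  exact: is_derive_continuous (is_derive_affine _ _ _).
apply: (@continuous_comp _ _ _ (fun t => - 1 * t - M) dpower_profile); last exact: dpower_profile_continuous.
exact: is_derive_continuous (is_derive_affine _ _ _).
Qed.

Lemma HtestN t : Htest (- t) = - Htest t.
Proof. have e1 : 1 * - t - M = - 1 * t - M by ring.
have e2 : - 1 * - t - M = 1 * t - M by ring.
by rewrite [LHS]/Htest e1 e2 -opprB. Qed.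

Lemma dHtestN t : dHtest (- t) = dHtest t.
Proof. have e1 : 1 * - t - M = - 1 * t - M by ring.
have e2 : - 1 * - t - M = 1 * t - M by ring.
by rewrite /dHtest e1 e2 addrC. Qed.

Lemma Htest_pos t : 0 <= t -> Htest t = power_profile (t - M).
Proof. move=> t0; rewrite /Htest mul1r (@power_profile0 (- 1 * t - M)) ?subr0//.
by move: M0; lra. Qed.

Lemma dHtest_pos t : 0 <= t -> dHtest t = dpower_profile (t - M).
Proof. move=> t0; rewrite /dHtest mul1r (@dpower_profile0 (- 1 * t - M)) ?addr0//.
by move: M0; lra. Qed.

Lemma norm_Htest t : `|Htest t| = power_profile (`|t| - M).
Proof.
wlog t0 : t / 0 <= t.
  by move=> h; have [/h//|/ltW t0] := leP 0 t; rewrite -normrN -HtestN -(normrN t) h// oppr_ge0.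
by rewrite Htest_pos// (ger0_norm t0) ger0_norm// power_profile_ge0.
Qed.

Lemma dHtest_norm t : dHtest t = dpower_profile (`|t| - M).
Proof.
wlog t0 : t / 0 <= t.
  by move=> h; have [/h//|/ltW t0] := leP 0 t; rewrite -dHtestN -(normrN t) h// oppr_ge0.
by rewrite dHtest_pos// (ger0_norm t0).
Qed.

Lemma dHtest_ge0 t : 0 <= dHtest t. Proof. by rewrite dHtest_norm dpower_profile_ge0. Qed.

Lemma dHtest_bound t : `|dHtest t| <= 1.
Proof. by rewrite ger0_norm ?dHtest_ge0// dHtest_norm dpower_profile_le1. Qed.

Lemma Htest_sg t : Htest t = Num.sg t * `|Htest t|.
Proof.
wlog t0 : t / 0 <= t.
  move=> h; have [/h//|/ltW t0] := leP 0 t; have := h (- t).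
  by rewrite oppr_ge0 HtestN normrN sgrN mulNr => /(_ t0)/oppr_inj.
rewrite norm_Htest Htest_pos// (ger0_norm t0).
have [->|t1] := eqVneq t 0; first by rewrite sgr0 mul0r power_profile0//; move: M0; lra.
by rewrite gtr0_sg ?mul1r// lt_def t1.
Qed.

Lemma Htest_derive t : 2 * kap * `|Htest t| <= dHtest t * `|t|.
Proof.
rewrite norm_Htest dHtest_norm; apply: le_trans (power_profile_derive _) _.
by rewrite ler_wpM2l ?dpower_profile_ge0//; move: M0; lra.
Qed.

Lemma Htest_growth t : `|Htest t| <= `|t| `^ (2 * kap).
Proof.
have /andP[k0 k1] := kap01.
rewrite norm_Htest; have [h|h] := leP (`|t| - M) 0.
  by rewrite power_profile0 ?powR_ge0.
apply: le_trans (power_profile_growth (ltW h)) _.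
by apply: ge0_ler_powR; rewrite ?nnegrE; move: M0; lra.
Qed.

Lemma Htest_eq0 t : `|t| <= M -> Htest t = 0.
Proof. by move=> h; apply/normr0_eq0; rewrite norm_Htest power_profile0//; lra. Qed.

Lemma Htest_neq0 t : M < `|t| -> 0 < `|Htest t|.
Proof. by move=> h; rewrite norm_Htest power_profile_gt0//; lra. Qed.

End power_profile.

(** * An integrable envelope *)

Section integral_tens.
Context {R : realType}.
Local Notation leb := (@lebesgue_measure R).

Lemma tens_consr n (th : 'I_n.+1 -> R -> R) (t : R) (y : 'rV[R]_n) :
  tens th (consr (t, y)) = th ord0 t * tens (fun j => th (lift ord0 j)) y.
Proof.
rewrite /tens big_ord_recl mxE unlift_none /=; congr (_ * _).
by apply: eq_bigr => j _; rewrite mxE liftK.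
Qed.

Lemma tens_ge0 n (th : 'I_n -> R -> R) x : (forall j t, 0 <= th j t) -> 0 <= tens th x.
Proof. by move=> h; apply: prodr_ge0. Qed.

Lemma measurable_tens n (th : 'I_n -> R -> R) : (forall j, measurable_fun setT (th j)) ->
  measurable_fun setT (tens th).
Proof.
move=> mth; apply: measurable_prod => j _.
exact: measurableT_comp (mth j) (@measurable_coord_rV _ R n j).
Qed.

Lemma ge0_integral_tens n (th : 'I_n -> R -> R) :
  (forall j, measurable_fun setT (th j)) -> (forall j t, 0 <= th j t) ->
  (\int[lebesgue_rV n]_x (tens th x)%:E = \prod_(j < n) \int[leb]_t (th j t)%:E)%E.
Proof.
elim: n th => [|n IH] th mth th0.
  rewrite big_ord0 /=.
  under eq_integral do rewrite /tens big_ord0.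
  by rewrite integral_cst//= diracT mule1.
have mt := measurable_tens mth.
have mmu := @measurable_consr R n.
rewrite [LHS](_ : _ = \int[pushforward (leb \x lebesgue_rV n)%E (@consr R n)]_x (tens th x)%:E)%E//.
rewrite ge0_integral_pushforward//; last 2 first.
- exact/measurable_EFinP.
- by move=> y _; rewrite lee_fin tens_ge0.
rewrite preimage_setT.
have mf : measurable_fun setT (fun z : R * 'rV[R]_n => (tens th (consr z))%:E).
  by apply/measurable_EFinP; exact: measurableT_comp mt mmu.
rewrite (@fubini_tonelli1 _ _ _ _ _ leb (lebesgue_rV n) _ mf); last first.
  by move=> z; rewrite lee_fin tens_ge0.
rewrite big_ord_recl -IH//.
transitivity (\int[leb]_t ((th ord0 t)%:E * \int[lebesgue_rV n]_x (tens (fun j => th (lift ord0 j)) x)%:E))%E.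
  apply: eq_integral => t _; rewrite /fubini_F.
  under eq_integral do rewrite tens_consr EFinM.
  rewrite ge0_integralZl//.
  - apply/measurable_EFinP; exact: measurable_tens.
  - by move=> x _; rewrite lee_fin tens_ge0.
  - by rewrite lee_fin.
rewrite ge0_integralZr//.
- by apply/measurable_EFinP; exact: mth.
- by move=> x _; rewrite lee_fin.
- by apply: integral_ge0 => x _; rewrite lee_fin tens_ge0.
Qed.

End integral_tens.

Section envelope.
Context {R : realType}.
Local Notation leb := (@lebesgue_measure R).
Variable lam : R.
Hypothesis lam01 : 0 < lam <= 1.

(** The decay is integrable, yet slow enough for the logarithmic derivative to stay
    bounded, by lam; a Gaussian would decay too fast for that. *)
Definition envelope1 (t : R) : R := (1 + (lam * t) ^+ 2)^-1.
Definition dlog_envelope1 (t : R) : R := - (2 * lam ^+ 2 * t) * envelope1 t.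

Let den_gt0 t : 0 < 1 + (lam * t) ^+ 2.
Proof. by have := sqr_ge0 (lam * t); lra. Qed.

Lemma envelope1_gt0 t : 0 < envelope1 t. Proof. by rewrite invr_gt0. Qed.

Lemma envelope1_ge0 t : 0 <= envelope1 t. Proof. exact/ltW/envelope1_gt0. Qed.

Lemma envelope1_le1 t : envelope1 t <= 1.
Proof. by rewrite invf_le1// lerDl sqr_ge0. Qed.

Lemma is_derive_envelope1 t : is_derive t (1 : R) envelope1 (envelope1 t * dlog_envelope1 t).
Proof.
have d0 := is_derive_affine lam 0 t.
have d1 := is_deriveM d0 d0.
have d2 := is_deriveD (is_derive_cst (1 : R) t 1) d1.
set z := 1 + (lam * t) ^+ 2.
have z0 : z != 0 by rewrite gt_eqF// /z.
have d3 : is_derive z (1 : R) (fun s : R => s^-1) (- z ^- 2).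
  have e1 : (- z ^- 2 *: (1 : R)) = - z ^- 2 :> R by exact: mulr1.
  by rewrite -e1; apply: is_deriveV.
have ez : z = (cst 1 + (fun t => lam * t + 0) * (fun t => lam * t + 0)) t.
  by rewrite /z expr2 -[RHS]/(1 + (lam * t + 0) * (lam * t + 0)) addr0.
have d4 := @is_derive1_comp _ (fun s : R => s^-1) (cst 1 + (fun t => lam * t + 0) * (fun t => lam * t + 0)) t _ _ (eq_ind _ (fun z' => is_derive z' (1 : R) (fun s : R => s^-1) (- z ^- 2)) d3 _ ez) d2.
rewrite (_ : envelope1 = (fun s : R => s^-1) \o (cst 1 + (fun t => lam * t + 0) * (fun t => lam * t + 0))); last first.
  by apply/funext => y; rewrite /envelope1 expr2 -[lam * y]addr0.
apply: is_derive_eq d4 _; rewrite /dlog_envelope1 /envelope1 -/z -![_ *: _]/(_ * _).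
rewrite (_ : (_ \o _) t = z^-1); last by rewrite ez.
by field.
Qed.

Lemma envelope1_continuous : continuous envelope1.
Proof.
move=> t; apply: cvgV; first by rewrite gt_eqF.
apply: cvgD; first exact: cvg_cst.
apply: (@continuous_comp _ _ _ (fun t => lam * t) (fun t => t ^+ 2)); last exact: exprn_continuous.
by apply: cvgM; [exact: cvg_cst|exact: cvg_id].
Qed.

Lemma dlog_envelope1_continuous : continuous dlog_envelope1.
Proof.
move=> t; apply: cvgM; last exact: envelope1_continuous.
by apply: cvgN; apply: cvgM; [exact: cvg_cst|exact: cvg_id].
Qed.

Lemma dlog_envelope1_bound t : `|dlog_envelope1 t| <= lam.
Proof.
have /andP[l0 l1] := lam01.
rewrite /dlog_envelope1 normrM normrN (ger0_norm (envelope1_ge0 _)) ler_pdivrMr//.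
rewrite ler_norml; have := sqr_ge0 (lam * t - 1); have := sqr_ge0 (lam * t + 1).
by rewrite !expr2 => h1 h2; apply/andP; split; nra.
Qed.

Lemma envelope1_integral_lty : (\int[leb]_t (envelope1 t)%:E < +oo)%E.
Proof.
have /andP[l0 l1] := lam01.
apply: (@le_lt_trans _ _ (\int[leb]_t ((lam ^+ 2)^-1%:E * (oneDsqr t)^-1%:E))%E).
  apply: ge0_le_integral => //.
  - by move=> t _; rewrite lee_fin envelope1_ge0.
  - by apply/measurable_EFinP; apply: continuous_measurable_fun; exact: envelope1_continuous.
  - apply/measurable_EFinP; apply: measurable_funM => //.
    by apply: continuous_measurable_fun; exact: continuous_oneDsqrV.
  move=> t _; rewrite -EFinM lee_fin /envelope1 -invfM lef_pV2 ?posrE//.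
  - rewrite /oneDsqr exprMn mulrDr mulr1; have := sqr_ge0 (lam * t).
    have : lam ^+ 2 <= 1 by rewrite expr_le1// ltW.
    by lra.
  - by rewrite mulr_gt0 ?exprn_gt0//; have := oneDsqr_ge1 t; lra.
have i0 (t : R) : 0 <= (oneDsqr t)^-1 by rewrite invr_ge0; have := oneDsqr_ge1 t; lra.
rewrite ge0_integralZl//; last first.
- by rewrite lee_fin invr_ge0 exprn_ge0// ltW.
- by apply/measurable_EFinP; apply: continuous_measurable_fun; exact: continuous_oneDsqrV.
rewrite ge0_symfun_integralT//; last 2 first.
- exact: continuous_oneDsqrV.
- by move=> t /=; rewrite /oneDsqr sqrrN.
by rewrite -set_itvcy integral0y_oneDsqr -!EFinM ltry.
Qed.

Variable n : nat.
Local Notation mu := (@lebesgue_rV R n).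

Definition envelope : 'rV[R]_n -> R := tens (fun=> envelope1).

Lemma envelope_gt0 x : 0 < envelope x.
Proof. by rewrite /envelope /tens; apply: prodr_gt0 => j _; exact: envelope1_gt0. Qed.

Lemma envelope_ge0 x : 0 <= envelope x. Proof. exact/ltW/envelope_gt0. Qed.

Lemma envelope_le1 x : envelope x <= 1.
Proof. by rewrite /envelope /tens; apply: prodr_ile1 => j _; rewrite envelope1_ge0 envelope1_le1. Qed.

Lemma envelope_continuous : continuous envelope.
Proof. by apply: continuous_tens => j; exact: envelope1_continuous. Qed.

Lemma is_derive_envelope x i : is_derive x (unit_rV i) envelope (envelope x * dlog_envelope1 (x ord0 i)).
Proof.
apply: is_derive_eq (is_derive_tens x is_derive_envelope1) _.
rewrite /envelope /tens (bigD1 i)//= eqxx [in RHS](bigD1 i)//=.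
rewrite (eq_bigr (fun j => envelope1 (x ord0 j))); last by move=> j /negbTE ->.
by rewrite mulrAC.
Qed.

Lemma measurable_envelope : measurable_fun setT envelope.
Proof. by apply: continuous_measurable_rV; exact: envelope_continuous. Qed.

Let menv1 : measurable_fun setT envelope1.
Proof. by apply: continuous_measurable_fun; exact: envelope1_continuous. Qed.

Let ienv1_fin : (\int[leb]_t (envelope1 t)%:E)%E \is a fin_num.
Proof.
by rewrite ge0_fin_numE ?envelope1_integral_lty// integral_ge0// => t _; rewrite lee_fin envelope1_ge0.
Qed.

Lemma L1_envelope : L1 mu envelope.
Proof.
apply/integrableP; split; first by apply/measurable_EFinP; exact: measurable_envelope.
under eq_integral do rewrite /= ger0_norm ?envelope_ge0//.
rewrite ge0_integral_tens//; last by move=> _ t; exact: envelope1_ge0.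
rewrite ltey_eq; apply/orP; left.
by apply: (big_ind (fun x : \bar R => x \is a fin_num)) => // x y; exact: fin_numM.
Qed.

(** By Tonelli, with the envelope bounded by 1 in the directions of J and integrated
    over the whole line in the others. *)
Lemma envelope_tube (J : {pred 'I_n}) : exists2 C : R, 0 <= C & forall r : R, 0 < r ->
  (\int[mu]_(x in [set x : 'rV[R]_n | forall j, j \in J -> (`|x ord0 j| <= r)%R]) (envelope x)%:E <= (C * r ^+ #|J|)%:E)%E.
Proof.
pose c := fine (\int[leb]_t (envelope1 t)%:E)%E.
have c0 : 0 <= c by apply: fine_ge0; apply: integral_ge0 => t _; rewrite lee_fin envelope1_ge0.
exists (2 ^+ #|J| * c ^+ #|[predC J]|); first by rewrite mulr_ge0// exprn_ge0.
move=> r r0; pose th j : R -> R := if j \in J then \1_`[- r, r] else envelope1.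
have mth j : measurable_fun setT (th j) by rewrite /th; case: ifP.
have th0 j t : 0 <= th j t by rewrite /th; case: ifP => _ //; exact: envelope1_ge0.
have mS : measurable [set x : 'rV[R]_n | forall j, j \in J -> `|x ord0 j| <= r].
  have mB := @measurable_box R n (fun j => if j \in J then `[- r, r]%classic else setT).
  have := mB (fun j => ltac:(by case: ifP)); congr measurable.
  apply/seteqP; split => x h j; have := h j; last by case: ifP => // jJ; rewrite /= in_itv/= ler_norml; exact.
  by move=> + jJ; rewrite jJ /= in_itv/= ler_norml.
apply: (@le_trans _ _ (\int[mu]_x (tens th x)%:E)%E).
  rewrite integral_mkcond; apply: ge0_le_integral => //.
  - by move=> x _; rewrite patchE; case: ifP => // _; rewrite lee_fin envelope_ge0.
  - apply: (proj1 (measurable_restrictT _ mS)); apply/measurable_EFinP.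
    by apply: measurable_funTS; exact: measurable_envelope.
  - by apply/measurable_EFinP; exact: measurable_tens.
  move=> x _; rewrite patchE; case: ifPn => [/set_mem xr|_]; last by rewrite lee_fin tens_ge0.
  rewrite lee_fin; apply: ler_prod => j _; rewrite envelope1_ge0/= /th; case: ifP => // jJ.
  by rewrite indicE mem_set ?envelope1_le1//= in_itv/= -ler_norml xr.
rewrite ge0_integral_tens//.
rewrite (bigID (mem J))/=.
rewrite (eq_bigr (fun=> (2 * r)%:E)); last first.
  move=> j jJ; rewrite /th jJ integral_indic// setIT.
  have := @lebesgue_measure_itv R `[- r, r]%R; rewrite /= lte_fin ifT; last by lra.
  by move=> ->; rewrite -EFinB; congr EFin; lra.
rewrite [X in (_ * X)%E](eq_bigr (fun=> c%:E)); last first.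
  by move=> j /negbTE jJ; rewrite /th jJ /c fineK.
rewrite !prodEFin !prodr_const -EFinM lee_fin exprMn mulrAC.
exact: lexx.
Qed.

End envelope.

(** * The singular set and its cutoffs *)

Section geometry.
Context {R : realType}.
Variables (d m : nat) (rad : \bar R).
Implicit Types x : 'rV[R]_(d + m).
Local Notation mu := (@lebesgue_rV R (d + m)).

(** The directions normal to Gamma. *)
Definition transversal : {pred 'I_(d + m)} := [pred i : 'I_(d + m) | (d <= i)%N].

(** The squared distance to Gamma, preferred to the distance because it is a
    polynomial. *)
Definition rho x : R := \sum_(i < d + m) (i \in transversal)%:R * x ord0 i ^+ 2.

Lemma dotr_rsubmx x : dotr (rsubmx x) (rsubmx x) = rho x.
Proof.
rewrite /rho big_split_ord/= [X in _ = X + _]big1 ?add0r; last first.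
  by move=> i _; rewrite inE/= leqNgt ltn_ord/= mul0r.
by apply: eq_bigr => i _; rewrite inE/= leq_addr mul1r mxE expr2.
Qed.

Lemma rho_ge0 x : 0 <= rho x.
Proof. by apply: sumr_ge0 => i _; rewrite mulr_ge0// sqr_ge0. Qed.

Lemma enorm_rsubmx x : enorm (rsubmx x) = Num.sqrt (rho x).
Proof. by rewrite /enorm dotr_rsubmx. Qed.

Lemma rho_ge_coord x i : i \in transversal -> x ord0 i ^+ 2 <= rho x.
Proof.
move=> iJ; rewrite /rho (bigD1 i)//= iJ mul1r lerDl.
by apply: sumr_ge0 => j _; rewrite mulr_ge0// sqr_ge0.
Qed.

Lemma card_transversal : #|transversal| = m.
Proof.
rewrite -[RHS](card_ord m) -(card_imset predT (@rshift_inj d m)).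
apply: eq_card => i; rewrite inE/=; apply/idP/imsetP => [di|[j _ ->]]; last exact: leq_addr.
have im : (i - d < m)%N by rewrite ltn_subLR.
by exists (Ordinal im) => //; apply: val_inj; rewrite /= subnKC.
Qed.

Lemma rho_continuous : continuous rho.
Proof.
rewrite /rho; elim: (index_enum _) => [|i s IH].
  rewrite (_ : (fun x => _) = cst 0); first exact: cst_continuous.
  by apply/funext => x; rewrite big_nil.
rewrite (_ : (fun x => _) = (fun x => (i \in transversal)%:R * x ord0 i ^+ 2 +
   \sum_(j <- s) (j \in transversal)%:R * x ord0 j ^+ 2)); last by apply/funext => x; rewrite big_cons.
move=> x; apply: (@continuousD _ _ _ (fun x => (i \in transversal)%:R * x ord0 i ^+ 2)); last exact: IH.
apply: (@continuousM _ _ (cst (i \in transversal)%:R) (fun x => x ord0 i ^+ 2)); first exact: cst_continuous.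
apply: (@continuous_comp _ _ _ (fun x : 'rV[R]_(d + m) => x ord0 i) (fun t : R => t ^+ 2)).
  exact: coord_continuous.
exact: exprn_continuous.
Qed.

Definition drho i x : R := (i \in transversal)%:R * (2 * x ord0 i).

Lemma drho_continuous i : continuous (drho i).
Proof.
move=> x; apply: (@continuousM _ _ (cst (i \in transversal)%:R) (fun x => 2 * x ord0 i)).
  exact: cst_continuous.
apply: (@continuousM _ _ (cst 2) (fun x => x ord0 i)); first exact: cst_continuous.
exact: coord_continuous.
Qed.

Lemma is_derive_rho i x : is_derive x (unit_rV i) rho (drho i x).
Proof.
apply/is_derive_lineP.
pose b : R := (i \in transversal)%:R.
have e h : rho (x + h *: unit_rV i) = b * h * h + drho i x * h + rho x.
  rewrite /rho (bigD1 i)//= [in RHS](bigD1 i)//= coord_line eqxx mulr1.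
  rewrite (eq_bigr (fun j => (j \in transversal)%:R * x ord0 j ^+ 2)); last first.
    by move=> j ji; rewrite coord_line (negbTE ji) mulr0 addr0.
  by rewrite -/b /drho; ring.
have d0 := is_derive_affine b 0 (0 : R).
have d1 := is_derive_affine 1 0 (0 : R).
have d2 := is_derive_affine (drho i x) (rho x) (0 : R).
rewrite (_ : (fun h => _) = (fun h => b * h + 0) * (fun h => 1 * h + 0) + (fun h => drho i x * h + rho x)).
  apply: is_derive_eq (is_deriveD (is_deriveM d0 d1) d2) _.
  by rewrite -![_ *: _]/(_ * _); ring.
apply/funext => h; rewrite e -[RHS]/((b * h + 0) * (1 * h + 0) + (drho i x * h + rho x)).
ring.
Qed.

Lemma Omega_open : open (Omega d m rad).
Proof.
case: rad => [r| |].
- rewrite (_ : Omega d m r%:E = (fun x => Num.sqrt (rho x)) @^-1` [set t | t < r]); last first.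
    by apply/seteqP; split => x; rewrite /Omega /oball /= enorm_rsubmx lte_fin.
  apply: open_comp; last exact: open_lt.
  move=> x _; apply: (@continuous_comp _ _ _ rho (@Num.sqrt R)); first exact: rho_continuous.
  exact: sqrt_continuous.
- rewrite (_ : Omega d m +oo%E = setT); first exact: openT.
  by apply/seteqP; split => x // _; rewrite /Omega /oball /= ltry.
rewrite (_ : Omega d m -oo%E = set0); first exact: open0.
by apply/seteqP; split => x.
Qed.

Lemma GammaE x : Gamma d m x <-> rho x = 0.
Proof.
split=> [h|h].
  by rewrite -dotr_rsubmx h /dotr big1// => i _; rewrite mxE mul0r.
apply/rowP => i; rewrite !mxE; apply/eqP; rewrite -sqrf_eq0 eq_le sqr_ge0 andbT -h.
by apply: rho_ge_coord; rewrite inE/= leq_addr.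
Qed.

(** These sets exhaust Omega without Gamma and stay away from Gamma, so that the local
    assumptions on u apply to each of them. *)
Definition outer c := Omega d m rad `&` [set x | c < rho x].

Lemma outer_open c : open (outer c).
Proof.
apply: openI; first exact: Omega_open.
apply: (@open_comp _ _ rho [set t | c < t]); last exact: open_gt.
by move=> x _; exact: rho_continuous.
Qed.

Lemma closed_rho_ge c : closed [set x | c <= rho x].
Proof. apply: (@preimage_closed _ _ rho [set t | c <= t]); last exact: closed_ge.
by move=> x _; exact: rho_continuous. Qed.

Lemma closure_rho_ge c (B : set 'rV[R]_(d + m)) : 0 < c -> (forall x, B x -> c <= rho x) ->
  closure B `&` Gamma d m = set0.
Proof.
move=> c0 Bc; apply/seteqP; split => x // -[Bx /GammaE x0].
have : [set x | c <= rho x] x.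
  have cc := @closed_rho_ge c; rewrite (iffLR (closure_id _) cc).
  by apply: closure_subset Bx => y; exact: Bc.
by rewrite /= x0; lra.
Qed.

Lemma outer_away c : 0 < c -> away (Omega d m rad) (Gamma d m) (outer c).
Proof.
move=> c0; split; [exact: outer_open|by move=> x []|].
by apply: (closure_rho_ge c0) => x [_ /ltW].
Qed.

Lemma OmegaD_open : open (Omega d m rad `\` Gamma d m).
Proof.
rewrite (_ : _ `\` _ = outer 0); first exact: outer_open.
apply/seteqP; split => x [Ox h]; split => //.
  by rewrite /= lt_def rho_ge0 andbT; apply/eqP => /GammaE.
by move=> /GammaE h'; move: h; rewrite /= h' ltxx.
Qed.

Lemma outer_sub c : 0 <= c -> outer c `<=` Omega d m rad `\` Gamma d m.
Proof.
by move=> c0 x [Ox h]; split => // /GammaE h'; move: h; rewrite /= h'; lra.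
Qed.

Lemma away_sub U : away (Omega d m rad) (Gamma d m) U -> U `<=` Omega d m rad `\` Gamma d m.
Proof.
move=> [_ UD US] x Ux; split; first exact: UD.
by move=> Gx; have : (closure U `&` Gamma d m) x by [split => //; exact: subset_closure]; rewrite US.
Qed.

Lemma outer_bigcup : \bigcup_k outer k.+1%:R^-1 = Omega d m rad `\` Gamma d m.
Proof.
apply/seteqP; split => x; first by move=> [k _]; apply: outer_sub; rewrite invr_ge0.
move=> [Ox nG]; have r0 : 0 < rho x.
  by rewrite lt_def rho_ge0 andbT; apply/eqP => /GammaE.
have [k _ kr] := near_infty_natSinv_lt (PosNum r0).
by exists k => //; split => //; exact: kr (leqnn k).
Qed.

Lemma outer_nondecreasing : nondecreasing_seq (fun k => outer k.+1%:R^-1).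
Proof.
apply/nondecreasing_seqP => k; apply/subsetPset => x [Ox h]; split => //.
by apply: le_lt_trans h; rewrite lef_pV2 ?posrE ?ltr0n// ler_nat.
Qed.

Lemma Gamma_null : (0 < m)%N -> {ae mu, forall x, ~ Gamma d m x}.
Proof.
move=> m0; exists (Gamma d m).
pose A (i : 'I_(d + m)) : set R := if i \in transversal then [set 0] else setT.
have mA i : measurable (A i) by rewrite /A; case: ifP.
have GA : Gamma d m = [set x | forall i, A i (x ord0 i)].
  apply/seteqP; split => x.
    move=> /GammaE h i; rewrite /A; case: ifP => // iJ /=.
    by apply/eqP; rewrite -sqrf_eq0 eq_le sqr_ge0 andbT -h; exact: rho_ge_coord.
  move=> h; apply/GammaE; rewrite /rho big1// => i _; have := h i; rewrite /A.
  by case: ifP => _; [move=> ->; rewrite expr0n mulr0|rewrite mul0r].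
split.
- by rewrite GA; exact: measurable_box.
- rewrite GA lebesgue_rV_box//.
  rewrite (bigD1 (rshift d (Ordinal m0)))//= /A inE/= leq_addr.
  by rewrite lebesgue_measure_set1 mul0e.
- by move=> x /=; apply: contra_notP.
Qed.

Variable k : R.
Hypothesis k0 : 0 < k.

(** Zero at distance at most 1/k from Gamma, one at distance at least sqrt 2 / k. *)
Definition cutoff x : R := step (k ^+ 2 * rho x - 1).
Definition dcutoff i x : R := dstep (k ^+ 2 * rho x - 1) * (k ^+ 2 * drho i x).

Lemma cutoff_continuous : continuous cutoff.
Proof.
move=> x; apply: (@continuous_comp _ _ _ (fun x => k ^+ 2 * rho x - 1) step).
  apply: (@continuousB _ _ _ (fun x => k ^+ 2 * rho x) (cst 1)); last exact: cst_continuous.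
  apply: (@continuousM _ _ (cst (k ^+ 2)) rho); first exact: cst_continuous.
  exact: rho_continuous.
exact: is_derive_continuous (is_derive_step _).
Qed.

Lemma dcutoff_continuous i : continuous (dcutoff i).
Proof.
move=> x; apply: (@continuousM _ _ (fun x => dstep (k ^+ 2 * rho x - 1)) (fun x => k ^+ 2 * drho i x)).
  apply: (@continuous_comp _ _ _ (fun x => k ^+ 2 * rho x - 1) dstep).
    apply: (@continuousB _ _ _ (fun x => k ^+ 2 * rho x) (cst 1)); last exact: cst_continuous.
    apply: (@continuousM _ _ (cst (k ^+ 2)) rho); first exact: cst_continuous.
    exact: rho_continuous.
  exact: dstep_continuous.
apply: (@continuousM _ _ (cst (k ^+ 2)) (drho i)); first exact: cst_continuous.
exact: drho_continuous.
Qed.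

Lemma is_derive_cutoff i x : is_derive x (unit_rV i) cutoff (dcutoff i x).
Proof.
have /is_derive_lineP d0 := is_derive_rho i x.
apply/is_derive_lineP.
have d1 := is_derive_affine (k ^+ 2) (- 1) (rho (x + 0 *: unit_rV i)).
have d2 := @is_derive1_comp _ (fun t => k ^+ 2 * t - 1) (fun h : R => rho (x + h *: unit_rV i)) 0 _ _ d1 d0.
have d3 := is_derive_step (k ^+ 2 * rho (x + 0 *: unit_rV i) - 1).
have d4 := @is_derive1_comp _ step ((fun t => k ^+ 2 * t - 1) \o (fun h : R => rho (x + h *: unit_rV i))) 0 _ _ d3 d2.
by apply: is_derive_eq d4 _; rewrite scale0r addr0.
Qed.

Lemma cutoff_ge0 x : 0 <= cutoff x. Proof. exact: step_ge0. Qed.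
Lemma cutoff_le1 x : cutoff x <= 1. Proof. exact: step_le1. Qed.

Lemma cutoff_eq0 x : rho x <= (k ^+ 2)^-1 -> cutoff x = 0.
Proof.
move=> h; apply: step0; have k2 : 0 < k ^+ 2 by rewrite exprn_gt0.
by rewrite subr_le0 mulrC -ler_pdivlMr// div1r.
Qed.

Lemma cutoff_eq1 x : 2 / k ^+ 2 <= rho x -> cutoff x = 1.
Proof.
move=> h; apply: step1; have k2 : 0 < k ^+ 2 by rewrite exprn_gt0.
by rewrite ler_pdivrMr// mulrC in h; lra.
Qed.

Lemma dcutoff_supp i x : dcutoff i x != 0 ->
  forall j, j \in transversal -> `|x ord0 j| <= 2 / k.
Proof.
move=> h j jJ; have : 0 < k ^+ 2 * rho x - 1 < 1.
  by apply: contraNT h => /dstep_out; rewrite /dcutoff => ->; rewrite mul0r.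
move=> /andP[_ h1]; have := rho_ge_coord x jJ => h2.
have k2 : 0 < k ^+ 2 by rewrite exprn_gt0.
have h3 : (k * `|x ord0 j|) ^+ 2 < 2 ^+ 2.
  rewrite exprMn real_normK ?num_real//.
  have : k ^+ 2 * x ord0 j ^+ 2 <= k ^+ 2 * rho x by rewrite ler_wpM2l// ltW.
  by rewrite [2 ^+ 2]expr2; lra.
have h4 : k * `|x ord0 j| < 2.
  by rewrite -(@ltr_pXn2r _ 2)// nnegrE// mulr_ge0// ltW.
by rewrite ler_pdivlMr// mulrC ltW.
Qed.

(** The gradient of [rho] is at most twice the distance to Gamma, hence O(1/k) where
    the cutoff is not locally constant, and this compensates one factor k. *)
Lemma dcutoff_bound i x : `|dcutoff i x| <= 8 * k.
Proof.
have [->|h] := eqVneq (dcutoff i x) 0; first by rewrite normr0 mulr_ge0// ltW.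
have [iJ|iJ] := boolP (i \in transversal); last first.
  by rewrite /dcutoff /drho (negbTE iJ) mul0r !mulr0 normr0 mulr_ge0// ltW.
have := dcutoff_supp h iJ; rewrite ler_pdivlMr// => h2.
rewrite /dcutoff /drho iJ mul1r normrM.
apply: (@le_trans _ _ (2 * `|k ^+ 2 * (2 * x ord0 i)|)).
  by rewrite ler_wpM2r// dstep_bound.
rewrite !normrM (gtr0_norm k0).
have -> : 2 * (k * k * (`|2| * `|x ord0 i|)) = 4 * k * (`|x ord0 i| * k).
  by rewrite ger0_norm//; ring.
have -> : 8 * k = 4 * k * 2 by ring.
by rewrite ler_wpM2l// mulr_ge0// ltW.
Qed.

End geometry.

(** * The absorption inequality *)

Section absorption.
Context {R : realType}.

Lemma le_powR (a b r : R) : 0 <= r -> 0 <= a -> a <= b -> a `^ r <= b `^ r.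
Proof. by move=> r0 a0 ab; apply: ge0_ler_powR; rewrite ?nnegrE// (le_trans a0). Qed.

(** Here t stands for |u|, xi for |grad u|, h and dh for |H(u)| and H'(u), and Y for the
    logarithmic gradient of the function that multiplies H(u) in the test function;
    the right-hand side without its last term bounds the integrand from below by
    ellipticity, absorption and growth of A. Since Y <= X + lam0, the summand lam0 is
    the part of the logarithmic gradient that does not decay away from the singular
    set; t >= M makes it harmless, and lam0 depends on M. *)
Lemma absorption (p q gam mu M : R) : 1 < p -> 0 < q - p + 1 -> 0 < gam -> 0 < mu -> 0 < M ->
  exists lam0 C : R, [/\ 0 < lam0, 0 <= C & forall t xi h dh X Y : R,
    M <= t -> 0 <= xi -> 0 <= h -> h <= t `^ gam -> gam * h <= dh * t -> 0 <= X ->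
    0 <= Y -> Y <= X + lam0 ->
    2^-1 * (t `^ q * h) <=
    mu * (dh * xi `^ p) + t `^ q * h - mu^-1 * (h * xi `^ (p - 1) * Y) +
    C * X `^ (p * (q + gam) / (q - p + 1))].
Proof.
move=> p1 sig0 gam0 mu0 M0.
set sig := q - p + 1 in sig0 *; pose b := mu ^+ 2 * gam.
have b0 : 0 < b by rewrite mulr_gt0// exprn_gt0.
pose C1 := mu^-1 * b^-1 `^ (p - 1).
have C10 : 0 < C1 by rewrite mulr_gt0 ?invr_gt0// powR_gt0// invr_gt0.
pose L := M `^ sig / (2 * C1).
have L0 : 0 < L by rewrite divr_gt0 ?powR_gt0// mulr_gt0.
(* Y <= 2 lam0 implies 2 C1 Y^p <= M^sig *)
pose lam0 := 2^-1 * L `^ p^-1.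
have lam00 : 0 < lam0 by rewrite mulr_gt0 ?invr_gt0// powR_gt0.
have p0 : 0 < p by lra.
have lam0E : (2 * lam0) `^ p = L.
  by rewrite /lam0 mulrA mulfV ?mul1r// -powRrM mulVf ?gt_eqF// powRr1// ltW.
pose C2 := 2 * C1 * 2 `^ p.
have C20 : 0 < C2 by apply: mulr_gt0; [exact: mulr_gt0|exact: powR_gt0].
pose C := C1 * 2 `^ p * C2 `^ ((p - 1 + gam) / sig).
have C0 : 0 <= C.
  by apply: mulr_ge0; [apply: mulr_ge0; [exact: ltW|exact: powR_ge0]|exact: powR_ge0].
exists lam0, C; split=> // t xi h dh X Y Mt xi0 h0 ht hdh X0 Y0 YX.
have t0 : 0 < t by exact: lt_le_trans Mt.
have CX0 : 0 <= C * X `^ (p * (q + gam) / sig) by rewrite mulr_ge0 ?powR_ge0.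
have tq0 : 0 <= t `^ q * h by rewrite mulr_ge0 ?powR_ge0.
have xip : xi `^ p = xi * xi `^ (p - 1) by rewrite mulr_powRB1//; lra.
have x10 : 0 <= xi `^ (p - 1) by exact: powR_ge0.
have hx0 : 0 <= h * xi `^ (p - 1) by rewrite mulr_ge0.
have dh0 : 0 <= dh by rewrite -(pmulr_lge0 _ t0); apply: le_trans hdh; rewrite mulr_ge0// ltW.
(* first regime: |grad u| is large and ellipticity dominates the cross term *)
have [case1|case2] := leP (Y * t) (b * xi).
  have E : mu^-1 * (h * xi `^ (p - 1) * Y) <= mu * (dh * xi `^ p).
    rewrite xip -(ler_pM2r t0).
    have -> : mu^-1 * (h * xi `^ (p - 1) * Y) * t = mu^-1 * (h * xi `^ (p - 1)) * (Y * t) by ring.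
    apply: (@le_trans _ _ (mu^-1 * (h * xi `^ (p - 1)) * (b * xi))).
      by rewrite ler_wpM2l// mulr_ge0// invr_ge0 ltW.
    have -> : mu^-1 * (h * xi `^ (p - 1)) * (b * xi) = mu * (xi * xi `^ (p - 1)) * (gam * h).
      by rewrite /b; field; rewrite gt_eqF.
    have -> : mu * (dh * (xi * xi `^ (p - 1))) * t = mu * (xi * xi `^ (p - 1)) * (dh * t) by ring.
    by rewrite ler_wpM2l// !mulr_ge0// ltW.
  by lra.
(* second regime: xi < Y t / b, so the cross term is controlled by h t^(p-1) Y^p *)
have xile : xi `^ (p - 1) <= Y `^ (p - 1) * t `^ (p - 1) * b^-1 `^ (p - 1).
  rewrite -!powRM ?mulr_ge0 ?invr_ge0 ?(ltW t0) ?(ltW b0)//.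
  apply: le_powR => //; first by rewrite subr_ge0 ltW.
  by rewrite ler_pdivlMr// mulrC ltW.
have Yp : Y `^ p = Y * Y `^ (p - 1) by rewrite mulr_powRB1//; lra.
have loss : mu^-1 * (h * xi `^ (p - 1) * Y) <= h * (C1 * Y `^ p * t `^ (p - 1)).
  rewrite Yp /C1.
  have -> : h * (mu^-1 * b^-1 `^ (p - 1) * (Y * Y `^ (p - 1)) * t `^ (p - 1)) =
     mu^-1 * (h * (Y `^ (p - 1) * t `^ (p - 1) * b^-1 `^ (p - 1)) * Y) by ring.
  by rewrite ler_wpM2l ?invr_ge0 ?(ltW mu0)// ler_wpM2r// ler_wpM2l.
have mux : 0 <= mu * (dh * xi `^ p) by rewrite !mulr_ge0 ?powR_ge0// ltW.
have tqE : t `^ q = t `^ sig * t `^ (p - 1).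
  rewrite -powRD; first by congr powR; rewrite /sig; ring.
  by rewrite (gt_eqF t0) implybT.
(* either half of the absorption term dominates, or t^sig <= 2 C1 Y^p *)
have [case2a|case2b] := leP (C1 * Y `^ p * t `^ (p - 1)) (2^-1 * t `^ q).
  have := ler_wpM2l h0 case2a; lra.
have tsig : t `^ sig <= 2 * C1 * Y `^ p.
  have tp0 : 0 < t `^ (p - 1) by rewrite powR_gt0.
  by rewrite -(ler_pM2r tp0); move: case2b; rewrite tqE; lra.
(* if X <= lam0 then Y <= 2 lam0, and the choice of lam0 gives t^sig < M^sig *)
have Xlam : lam0 < X.
  rewrite ltNge; apply/negP => Xl.
  have Y2 : Y `^ p <= L.
    by rewrite -lam0E; apply: le_powR => //; clear -Xl YX p0; lra.
  have t1 : M `^ sig <= t `^ sig by apply: le_powR => //; apply: ltW.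
  have tp0 : 0 < t `^ (p - 1) by rewrite powR_gt0.
  have : t `^ sig < 2 * C1 * Y `^ p.
    by rewrite -(ltr_pM2r tp0); move: case2b; rewrite tqE; lra.
  have : 2 * C1 * Y `^ p <= M `^ sig.
    have -> : M `^ sig = 2 * C1 * L by rewrite /L; field; rewrite gt_eqF.
    by rewrite ler_wpM2l// mulr_ge0// ltW.
  by lra.
have Y2X : Y `^ p <= 2 `^ p * X `^ p.
  by rewrite -powRM//; apply: le_powR => //; [exact: ltW|clear -Xlam YX; lra].
have tX : t `^ sig <= C2 * X `^ p.
  have C1' : 0 <= 2 * C1 by rewrite mulr_ge0// ltW.
  by apply: le_trans tsig _; rewrite /C2 -[leRHS]mulrA ler_wpM2l.
(* t^sig <= C2 X^p turns every power of t into a power of X *)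
have tpow (r : R) : 0 <= r -> t `^ r <= C2 `^ (r / sig) * X `^ (p * r / sig).
  move=> r0; have -> : t `^ r = (t `^ sig) `^ (r / sig).
    by rewrite -powRrM mulrCA mulfV ?gt_eqF// mulr1.
  have -> : X `^ (p * r / sig) = (X `^ p) `^ (r / sig) by rewrite -powRrM mulrA.
  rewrite -powRM ?powR_ge0 ?(ltW C20)//.
  apply: le_powR => //; last exact: powR_ge0.
  by rewrite divr_ge0// ltW.
suff fin : h * (C1 * Y `^ p * t `^ (p - 1)) <= C * X `^ (p * (q + gam) / sig) by lra.
apply: (@le_trans _ _ (t `^ gam * (C1 * (2 `^ p * X `^ p) * t `^ (p - 1)))).
  have CY (z : R) : 0 <= C1 * Y `^ p * z `^ (p - 1).
    by apply: mulr_ge0; [apply: mulr_ge0; [exact: ltW|exact: powR_ge0]|exact: powR_ge0].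
  apply: ler_pM => //.
  by rewrite ler_wpM2r ?powR_ge0// ler_wpM2l// ltW.
have -> : t `^ gam * (C1 * (2 `^ p * X `^ p) * t `^ (p - 1)) =
    C1 * 2 `^ p * X `^ p * t `^ (p - 1 + gam).
  rewrite [t `^ (p - 1 + gam)]powRD; first ring.
  by rewrite (gt_eqF t0) implybT.
have -> : C * X `^ (p * (q + gam) / sig) =
    C1 * 2 `^ p * X `^ p * (C2 `^ ((p - 1 + gam) / sig) * X `^ (p * (p - 1 + gam) / sig)).
  have -> : X `^ (p * (q + gam) / sig) = X `^ p * X `^ (p * (p - 1 + gam) / sig).
    rewrite -powRD; last by rewrite (gt_eqF (lt_trans lam00 Xlam)) implybT.
    by congr powR; rewrite /sig; field; rewrite -/sig gt_eqF.
  by rewrite /C; ring.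
apply: ler_wpM2l.
  by apply: mulr_ge0; [apply: mulr_ge0; [exact: ltW|exact: powR_ge0]|exact: powR_ge0].
by apply: tpow; rewrite addr_ge0 ?(ltW gam0)// subr_ge0 ltW.
Qed.

End absorption.

(** * Majorants and essential bounds *)

Section spaces.
Context {R : realType} {n : nat}.
Implicit Types (U V : set 'rV[R]_n) (f w : 'rV[R]_n -> R).
Local Notation mu := (@lebesgue_rV R n).

Lemma Linfty_bound V f : Linfty V f ->
  exists2 B : R, 0 <= B & {ae mu, forall x, V x -> `|f x| <= B}.
Proof.
move=> [_]; rewrite /ess_sup_on => h.
have : exists B : R, (ess_sup mu ((fun x => (`|f x|)%:E) \_ V) <= B%:E)%E.
  by move: h; case: (ess_sup _ _) => [r| |] // _; [exists r|exists 0; rewrite leNye].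
move=> [B /ess_supP hB]; exists (Num.max B 0); first by rewrite le_max lexx orbT.
apply: filterS hB => x + Vx; rewrite patchE mem_set// lee_fin => hx.
by rewrite le_max hx.
Qed.

Lemma bound_Linfty V f B : lebesgue_measurable_fun V f -> 0 <= B ->
  {ae mu, forall x, V x -> `|f x| <= B} -> Linfty V f.
Proof.
move=> mf B0 hB; split=> //; rewrite /ess_sup_on.
apply: le_lt_trans (ltry B); apply/ess_supP; apply: filterS hB => x hx.
by rewrite patchE; case: ifPn => [/set_mem /hx|_]; rewrite lee_fin.
Qed.

Lemma measurable_powRn p w f V : measurable_fun setT w -> lebesgue_measurable_fun V f ->
  lebesgue_measurable_fun V (fun x => `|f x| `^ p * w x).
Proof.
move=> mw mf; apply: lebesgue_measurable_funM (lebesgue_measurable_funT V mw).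
apply: (@lebesgue_measurable_fun_comp _ _ _ (fun t => `|t| `^ p)) => //.
by apply: (measurableT_comp (@measurable_powR R p)); exact: normr_measurable.
Qed.

Lemma Lp_dom p V w f F : measurable V -> measurable_fun setT w -> (forall x, 0 <= w x) ->
  lebesgue_measurable_fun V f -> L1 mu F ->
  {ae mu, forall x, V x -> `|f x| `^ p * w x <= F x} -> Lp p V w f.
Proof.
move=> mV mw w0 mf iF hF; split=> //.
have E x : `|f x| `^ p * w x = `| `|f x| `^ p * w x| by rewrite [RHS]ger0_norm// mulr_ge0// powR_ge0.
under eq_integral do rewrite E.
apply: integral_dom_lty iF _ => //; first exact: measurable_powRn.
by apply: filterS hF => x; rewrite -E.
Qed.

Lemma lebesgue_measurable_enorm V (G : 'rV[R]_n -> 'rV[R]_n) :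
  (forall i, lebesgue_measurable_fun V (fun x => G x ord0 i)) ->
  lebesgue_measurable_fun V (fun x => enorm (G x)).
Proof.
move=> mG; apply: (@lebesgue_measurable_fun_comp _ _ _ Num.sqrt).
  by apply: continuous_measurable_fun; exact: sqrt_continuous.
by apply: lebesgue_measurable_fun_sum => i; exact: lebesgue_measurable_funM.
Qed.

Lemma enorm_ge0 (x : 'rV[R]_n) : 0 <= enorm x. Proof. exact: sqrtr_ge0. Qed.

Lemma dotr_ge0 (x : 'rV[R]_n) : 0 <= dotr x x.
Proof. by apply: sumr_ge0 => i _; rewrite -expr2 sqr_ge0. Qed.

Lemma coord_le_enorm (x : 'rV[R]_n) i : `|x ord0 i| <= enorm x.
Proof.
rewrite -sqrtr_sqr /enorm ler_sqrt ?dotr_ge0// /dotr (bigD1 i)//= -expr2 lerDl.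
by apply: sumr_ge0 => j _; rewrite -expr2 sqr_ge0.
Qed.

Lemma enorm_le_sum (x : 'rV[R]_n) : enorm x <= \sum_i `|x ord0 i|.
Proof.
have s0 : 0 <= \sum_i `|x ord0 i| by apply: sumr_ge0.
rewrite -[leRHS]ger0_norm// -sqrtr_sqr /enorm ler_sqrt ?sqr_ge0//.
rewrite /dotr expr2 mulr_suml; apply: ler_sum => i _.
rewrite -expr2 -real_normK ?num_real// expr2 ler_wpM2l//.
by rewrite (bigD1 i)//= lerDl; apply: sumr_ge0.
Qed.

(** The l^1 norm of y stands in for its Euclidean norm, as the partial derivatives of
    the test function are estimated one by one. *)
Lemma norm_dotr_le (x y : 'rV[R]_n) : `|dotr x y| <= enorm x * \sum_i `|y ord0 i|.
Proof.
rewrite /dotr mulr_sumr; apply: le_trans (ler_norm_sum _ _ _) _.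
by apply: ler_sum => i _; rewrite normrM ler_wpM2r// coord_le_enorm.
Qed.

Lemma enorm_eq0 (x : 'rV[R]_n) : enorm x = 0 -> x = 0.
Proof.
move=> h; apply/rowP => i; rewrite mxE; apply/normr0_eq0.
by apply/eqP; rewrite eq_le normr_ge0 andbT -h coord_le_enorm.
Qed.

Lemma enorm0 : enorm (0 : 'rV[R]_n) = 0.
Proof. by rewrite /enorm /dotr big1 ?sqrtr0// => i _; rewrite mxE mul0r. Qed.

End spaces.

Lemma powRD_le (R : realType) (p x y : R) : 0 <= p -> 0 <= x -> 0 <= y ->
  (x + y) `^ p <= 2 `^ p * (x `^ p + y `^ p).
Proof.
move=> p0 x0 y0; have m0 : 0 <= Num.max x y by rewrite le_max x0.
apply: (@le_trans _ _ ((2 * Num.max x y) `^ p)).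
  apply: le_powR => //; first exact: addr_ge0.
  by have [h|h] := leP x y; lra.
rewrite powRM// ler_wpM2l ?powR_ge0//.
by have [h|h] := leP x y; rewrite ?lerDl ?lerDr powR_ge0.
Qed.

(** * Admissibility of the test functions *)

Section admissible.
Context {R : realType}.
Variables (d m : nat) (rad : \bar R).
Local Notation mu := (@lebesgue_rV R (d + m)).
Local Notation D := (Omega d m rad).
Local Notation S := (Gamma d m).
Local Notation U := (D `\` S).
Variables (p : R) (w u : 'rV[R]_(d + m) -> R).
Hypotheses (p1 : 1 < p) (mw : measurable_fun setT w) (w0 : forall x, 0 < w x) (w1 : forall x, w x <= 1).
Hypotheses (uW : W1p_loc p D S w u) (uL : Linfty_loc D S u).

Let oU : open U := @OmegaD_open R d m rad.
Let oO c : open (outer rad c) := @outer_open R d m rad c.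

(** The local Sobolev space provides a weak gradient on every set away from Gamma,
    separately; the ones on the sets [outer] glue. *)
Lemma solution_gradient : weak_gradient U u (grad U u).
Proof.
have h k : weak_gradient (outer rad k.+1%:R^-1) u (grad (outer rad k.+1%:R^-1) u).
  by have [] := uW (@outer_away R d m rad k.+1%:R^-1 ltac:(by rewrite invr_gt0)).
have [G] := weak_gradient_glue (fun k => @oO k.+1%:R^-1)
  (@outer_nondecreasing _ d m rad) h.
by rewrite outer_bigcup; exact: grad_weak_gradient.
Qed.

Local Notation G := (grad U u).

Lemma outer_bound c : 0 < c -> exists2 B : R, 0 <= B &
  {ae mu, forall x, outer rad c x -> `|u x| <= B}.
Proof. by move=> c0; apply: Linfty_bound; apply: uL; exact: outer_away. Qed.

Lemma outer_gradient_L1 c : 0 < c -> exists F : 'rV[R]_(d + m) -> R, [/\ L1 mu F,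
  forall x, 0 <= F x & {ae mu, forall x, outer rad c x -> enorm (G x) `^ p * w x <= F x}].
Proof.
move=> c0; have mV := open_measurable_rV (@oO c).
have [_ wg [mG iG]] := uW (@outer_away R d m rad c c0).
set g := grad _ _ in wg mG iG.
have E x : `|enorm (g x)| `^ p * w x = `| `|enorm (g x)| `^ p * w x|.
  by rewrite [RHS]ger0_norm// mulr_ge0 ?powR_ge0// ltW.
move: iG; under eq_integral do rewrite E; move=> iG.
have [F [iF hF F0]] := L1_repr mV (measurable_powRn p mw mG) iG.
exists (fun x => `|F x|); split=> //; first exact: L1_norm.
have eG := weak_gradient_unique (@oO c) wg
  (weak_gradientS oU (@oO c) (@outer_sub R d m rad c (ltW c0)) solution_gradient).
apply: filterS2 eG hF => x e1 e2 Vx; rewrite e2// -E -e1// ger0_norm ?enorm_ge0//.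
Qed.

Variables (H H' : R -> R) (L : R).
Hypotheses (dH : forall t : R, is_derive t (1 : R) H (H' t)) (cH' : continuous H')
  (H'L : forall t, `|H' t| <= L).
Variables (lam : R) (Phi : 'rV[R]_(d + m) -> R) (dPhi : 'I_(d + m) -> 'rV[R]_(d + m) -> R) (C c : R).
Local Notation envelope := (envelope lam (n := d + m)).
Hypotheses (lam01 : 0 < lam <= 1) (cPhi : continuous Phi) (cdPhi : forall i, continuous (dPhi i))
  (dPhiE : forall i x, is_derive x (unit_rV i) Phi (dPhi i x)).
Hypotheses (c0 : 0 < c) (PhiC : forall x, `|Phi x| <= C * envelope x)
  (dPhiC : forall i x, `|dPhi i x| <= C * envelope x).
Hypotheses (Phi0 : forall x, rho x <= c -> Phi x = 0)
  (dPhi0 : forall i x, rho x <= c -> dPhi i x = 0).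

Local Notation phi := (fun x => H (u x) * Phi x).
Let gphi x : 'rV[R]_(d + m) := \row_i (H' (u x) * G x ord0 i * Phi x + H (u x) * dPhi i x).

Let wphi : weak_gradient U phi gphi.
Proof. exact: (weak_gradient_chain oU solution_gradient dH cH' H'L cPhi cdPhi dPhiE). Qed.

Lemma admissible_gradient : {ae mu, forall x, U x -> grad U phi x = gphi x}.
Proof.
exact: weak_gradient_unique oU (grad_weak_gradient wphi) wphi.
Qed.

Let L0 : 0 <= L. Proof. exact: le_trans (H'L 0). Qed.

Let C0 : 0 <= C.
Proof.
have := PhiC 0; have := envelope_gt0 lam (0 : 'rV[R]_(d + m)) => e0.
by move/(le_trans (normr_ge0 _)); rewrite pmulr_lge0.
Qed.

Let inner_or x V : away D S V -> V x -> rho x <= c \/ outer rad c x.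
Proof.
move=> [_ VD _] Vx; have [h|h] := leP (rho x) c; first by left.
by right; split => //; exact: VD.
Qed.

Let Hbound : exists2 B : R, 0 <= B & {ae mu, forall x, outer rad c x -> `|H (u x)| <= B}.
Proof.
have [B B0 hB] := outer_bound c0.
exists (`|H 0| + L * B); first by rewrite addr_ge0// mulr_ge0.
apply: filterS hB => x + Vx; move=> /(_ Vx) ux.
have := C1_lipschitz dH H'L 0 (u x); rewrite subr0 => h.
have := ler_normD (H 0) (H (u x) - H 0); rewrite addrC subrK.
by have := ler_wpM2l L0 ux; lra.
Qed.

Lemma admissible_Linfty : Linfty_loc D S phi.
Proof.
move=> V aV; have [oV VD _] := aV; have VU := away_sub aV.
have [B B0 hB] := Hbound.
have mphi : lebesgue_measurable_fun V phi.
  apply: (lebesgue_measurable_funS _ _ VU wphi.1.1); apply: open_measurable_rV => //.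
apply: (@bound_Linfty _ _ _ _ (B * C)) => //; first exact: mulr_ge0.
apply: filterS hB => x hx Vx; have [r0|/hx Hx] := inner_or aV Vx.
  by rewrite Phi0// mulr0 normr0 mulr_ge0.
rewrite normrM ler_pM//; apply: le_trans (PhiC x) _.
by rewrite ler_piMr// envelope_le1.
Qed.

Let envelope_powR x : envelope x `^ p <= envelope x.
Proof.
have e0 := envelope_gt0 lam x; have e1 := envelope_le1 lam x.
by apply: ge1r_powR; rewrite ?e0 ?e1// ltW.
Qed.

(** Where rho > c, u is bounded and |grad u|^p w is integrable, and elsewhere the
    function vanishes. As w <= 1, the terms without grad u are dominated by the envelope, which
    is integrable along with its p-th power since it takes values in [0, 1]. *)
Lemma admissible_W1p : W1p_loc p D S w phi.
Proof.
move=> V aV; have [oV VD _] := aV; have VU := away_sub aV.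
have [B B0 hB] := Hbound.
have mV := open_measurable_rV oV.
have wV := weak_gradientS oU oV VU wphi.
have wV' := grad_weak_gradient wV.
have eV := weak_gradient_unique oV wV' wV.
have w0' x : 0 <= w x by exact: ltW.
have p0 : 0 <= p by apply: ltW; exact: lt_trans p1.
have [F [iF F0 hF]] := outer_gradient_L1 c0.
split => //.
- apply: (@Lp_dom _ _ _ _ _ _ (fun x => (B * C) `^ p * envelope x)) => //.
  + exact: wV.1.1.
  + by apply: L1_scale; exact: L1_envelope.
  apply: filterS hB => x hx Vx.
  have CE0 : 0 <= (B * C) `^ p * envelope x by rewrite mulr_ge0 ?powR_ge0 ?envelope_ge0.
  have [r0|/hx Hx] := inner_or aV Vx.
    by rewrite Phi0// mulr0 normr0 powR0 ?mul0r// gt_eqF// (lt_trans _ p1).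
  apply: (@le_trans _ _ ((B * C * envelope x) `^ p * 1)).
    apply: ler_pM; rewrite ?powR_ge0//; apply: le_powR => //.
    by rewrite normrM -mulrA ler_pM.
  by rewrite mulr1 powRM ?mulr_ge0 ?envelope_ge0// ler_wpM2l ?powR_ge0.
- pose N : R := (d + m)%:R.
  apply: (@Lp_dom _ _ _ _ _ _ (fun x => 2 `^ p * ((N * (L * C)) `^ p * F x + (N * (B * C)) `^ p * envelope x))) => //.
  + by apply: lebesgue_measurable_enorm => i; have [_ /(_ i) [[]]] := wV'.
  + by apply/L1_scale/L1D; apply: L1_scale => //; exact: L1_envelope.
  apply: filterS3 hB hF eV => x hx hFx ex Vx; rewrite ex//.
  have R0 : 0 <= 2 `^ p * ((N * (L * C)) `^ p * F x + (N * (B * C)) `^ p * envelope x).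
    by rewrite mulr_ge0 ?powR_ge0// addr_ge0// mulr_ge0 ?powR_ge0// envelope_ge0.
  have [r0|Ox] := inner_or aV Vx.
    rewrite (_ : gphi x = 0); last first.
      by apply/rowP => i; rewrite !mxE Phi0// dPhi0// !mulr0 addr0.
    by rewrite enorm0 normr0 powR0 ?mul0r// gt_eqF// (lt_trans _ p1).
  have {hx} Hx := hx Ox; have {hFx} Fx := hFx Ox.
  have e1 := envelope_le1 lam x; have e0 := envelope_ge0 lam x.
  have bound : `|enorm (gphi x)| <= N * (L * C) * enorm (G x) + N * (B * C) * envelope x.
    rewrite ger0_norm ?enorm_ge0//; apply: le_trans (enorm_le_sum _) _.
    apply: (@le_trans _ _ (\sum_(i < d + m) (L * C * enorm (G x) + B * C * envelope x))).
      apply: ler_sum => i _; rewrite mxE; apply: le_trans (ler_normD _ _) _; apply: lerD.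
        rewrite !normrM mulrAC; apply: ler_pM; rewrite ?mulr_ge0//; last exact: coord_le_enorm.
        apply: ler_pM => //; apply: le_trans (PhiC x) _.
        by rewrite ler_piMr.
      by rewrite normrM -mulrA; apply: ler_pM.
    rewrite sumr_const card_ord -mulr_natl -/N; rewrite le_eqVlt; apply/orP; left; apply/eqP.
    ring.
  have G0 := enorm_ge0 (G x).
  have N0 : 0 <= N by rewrite ler0n.
  have NL : 0 <= N * (L * C) by rewrite !mulr_ge0.
  have NB : 0 <= N * (B * C) by rewrite !mulr_ge0.
  apply: (@le_trans _ _ (2 `^ p * ((N * (L * C) * enorm (G x)) `^ p + (N * (B * C) * envelope x) `^ p) * w x)).
    rewrite ler_wpM2r//; apply: le_trans (powRD_le _ _ _) => //; last 2 first.
    - exact: mulr_ge0.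
    - exact: mulr_ge0.
    by apply: le_powR.
  rewrite -mulrA ler_wpM2l ?powR_ge0// mulrDl; apply: lerD.
    by rewrite powRM// -mulrA ler_wpM2l ?powR_ge0.
  rewrite powRM// -mulrA ler_wpM2l ?powR_ge0//.
  by apply: le_trans (envelope_powR x); rewrite ler_piMr// powR_ge0.
Qed.

Lemma admissible_supp : closure (D `&` [set x | phi x != 0]) `&` S = set0.
Proof.
apply: (closure_rho_ge c0) => x [_ /= h]; rewrite leNgt; apply/negP => /ltW/Phi0 e.
by move: h; rewrite e mulr0 eqxx.
Qed.

End admissible.

(** * Testing the equation *)

Section cutoff_envelope.
Context {R : realType}.
Variables (d m s : nat) (k lam : R).
Hypotheses (k0 : 0 < k) (lam01 : 0 < lam <= 1).
Local Notation envelope := (envelope lam (n := d + m)).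
Implicit Types x : 'rV[R]_(d + m).

(** The exponent is at least 2, so that the partial derivatives also vanish with the
    cutoff; it is later taken so large that the powers of cutoff in the denominators
    of the logarithmic gradient cancel. *)
Definition testfun x : R := cutoff k x ^+ s.+2 * envelope x.
Definition dtestfun i x : R :=
  s.+2%:R * cutoff k x ^+ s.+1 * dcutoff k i x * envelope x + cutoff k x ^+ s.+2 * (envelope x * dlog_envelope1 lam (x ord0 i)).

Let cMP (h1 h2 : 'rV[R]_(d + m) -> R) : continuous h1 -> continuous h2 -> continuous (fun x => h1 x * h2 x).
Proof. by move=> c1 c2 x; exact: (@continuousM _ _ h1 h2 x (c1 x) (c2 x)). Qed.

Let cut_pow_continuous j : continuous (fun x => cutoff k x ^+ j).
Proof.
move=> x; apply: (@continuous_comp _ _ _ (cutoff k) (fun t : R => t ^+ j)).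
  exact: cutoff_continuous.
exact: exprn_continuous.
Qed.

Lemma testfun_continuous : continuous testfun.
Proof. by apply: cMP => //; exact: envelope_continuous. Qed.

Lemma dtestfun_continuous i : continuous (dtestfun i).
Proof.
have cE := @envelope_continuous R lam (d + m).
have c1 : continuous (fun x => s.+2%:R * cutoff k x ^+ s.+1 * dcutoff k i x * envelope x).
  apply: cMP => //; apply: cMP; last exact: dcutoff_continuous.
  by apply: (cMP (h1 := cst s.+2%:R)) => //; exact: cst_continuous.
have c2 : continuous (fun x => cutoff k x ^+ s.+2 * (envelope x * dlog_envelope1 lam (x ord0 i))).
  apply: cMP => //; apply: cMP => // x.
  apply: (@continuous_comp _ _ _ (fun x : 'rV[R]_(d + m) => x ord0 i) (dlog_envelope1 lam)).
    exact: coord_continuous.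
  exact: dlog_envelope1_continuous.
by move=> x; exact: (continuousD (c1 x) (c2 x)).
Qed.

Lemma is_derive_testfun i x : is_derive x (unit_rV i) testfun (dtestfun i x).
Proof.
have dc := is_derive_cutoff k i x; have dE := @is_derive_envelope R lam (d + m) x i.
have dp := is_deriveX s.+2 dc.
rewrite (_ : testfun = (cutoff k ^+ s.+2) * envelope); last first.
  by apply/funext => y; rewrite /testfun -[RHS]/((cutoff k ^+ s.+2) y * envelope y) exprfctE.
apply: is_derive_eq (is_deriveM dp dE) _.
rewrite /dtestfun -![_ *: _]/(_ * _) exprfctE /=.
by move: (envelope x) (dlog_envelope1 _ _) (cutoff k x ^+ s.+2) (cutoff k x ^+ s.+1) (dcutoff k i x) => a b e f g; ring.
Qed.

Lemma testfun_ge0 x : 0 <= testfun x.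
Proof. by rewrite mulr_ge0 ?envelope_ge0// exprn_ge0// cutoff_ge0. Qed.

Lemma testfun_le_envelope x : testfun x <= envelope x.
Proof.
by rewrite ler_piMl ?envelope_ge0// exprn_ile1 ?cutoff_ge0 ?cutoff_le1.
Qed.

Let C : R := s.+2%:R * (8 * k) + 1.

Lemma testfun_bound x : `|testfun x| <= C * envelope x.
Proof.
rewrite ger0_norm ?testfun_ge0//; apply: le_trans (testfun_le_envelope x) _.
by rewrite ler_peMl ?envelope_ge0// lerDr !mulr_ge0// ltW.
Qed.

Lemma dtestfun_bound i x : `|dtestfun i x| <= C * envelope x.
Proof.
have e0 := envelope_ge0 lam x; have z0 := cutoff_ge0 k x; have z1 := cutoff_le1 k x.
have /andP[l0 l1] := lam01.
apply: le_trans (ler_normD _ _) _; rewrite [leRHS]mulrDl mul1r; apply: lerD.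
  rewrite normrM (ger0_norm e0) ler_wpM2r// normrM.
  apply: ler_pM => //; last exact: dcutoff_bound.
  by rewrite normrM ger0_norm// ler_piMr// ger0_norm ?exprn_ge0// exprn_ile1.
rewrite normrM ger0_norm ?exprn_ge0// -[leRHS]mul1r; apply: ler_pM => //.
- exact: exprn_ge0.
- by rewrite exprn_ile1.
rewrite normrM (ger0_norm e0) ler_piMr//.
by apply: le_trans (dlog_envelope1_bound lam01 _) _.
Qed.

Lemma testfun0 x : rho x <= (k ^+ 2)^-1 -> testfun x = 0.
Proof. by move=> h; rewrite /testfun cutoff_eq0// exprS mul0r mul0r. Qed.

Lemma dtestfun0 i x : rho x <= (k ^+ 2)^-1 -> dtestfun i x = 0.
Proof. by move=> h; rewrite /dtestfun cutoff_eq0// !exprS !(mul0r, mulr0) addr0. Qed.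

(** The logarithmic gradient of the test function splits into a part due to the cutoff
    and a part of size lam due to the envelope. *)
Lemma dtestfun_sum x : cutoff k x != 0 ->
  \sum_i `|dtestfun i x| <=
  testfun x * (s.+2%:R * (\sum_(i < d + m) `|dcutoff k i x|) / cutoff k x + (d + m)%:R * lam).
Proof.
move=> zn0; have e0 := envelope_ge0 lam x; have z0 := cutoff_ge0 k x; have z1 := cutoff_le1 k x.
have -> : testfun x * (s.+2%:R * (\sum_(i < d + m) `|dcutoff k i x|) / cutoff k x + (d + m)%:R * lam) =
    \sum_(i < d + m) (testfun x * (s.+2%:R * `|dcutoff k i x| / cutoff k x) + testfun x * lam).
  rewrite big_split/= -mulr_sumr -mulr_suml -mulr_sumr sumr_const card_ord -mulr_natl.
  by ring.
apply: ler_sum => i _; apply: le_trans (ler_normD _ _) _; apply: lerD.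
  rewrite !normrM (ger0_norm e0) (ger0_norm (exprn_ge0 _ z0)) ger0_norm//.
  rewrite le_eqVlt; apply/orP; left; apply/eqP.
  by rewrite /testfun [cutoff k x ^+ s.+2]exprS; field.
rewrite normrM ger0_norm ?exprn_ge0// normrM (ger0_norm e0) mulrA.
by apply: ler_wpM2l; [exact: testfun_ge0|exact: dlog_envelope1_bound].
Qed.

End cutoff_envelope.

Section testing.
Context {R : realType}.
Variables (d m : nat) (rad : \bar R).
Local Notation mu := (@lebesgue_rV R (d + m)).
Local Notation D := (Omega d m rad).
Local Notation S := (Gamma d m).
Local Notation U := (D `\` S).
Variables (p : R) (w u : 'rV[R]_(d + m) -> R) (A : 'rV[R]_(d + m) -> 'rV[R]_(d + m)) (a g : R -> R).
Hypotheses (p1 : 1 < p) (mw : measurable_fun setT w) (w0 : forall x, 0 < w x) (w1 : forall x, w x <= 1).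
Hypotheses (uW : W1p_loc p D S w u) (uL : Linfty_loc D S u).
Hypothesis us : weak_solution p D S w A a g u.
Hypothesis m0 : (0 < m)%N.

Variables (H H' : R -> R) (L : R).
Hypotheses (dH : forall t : R, is_derive t (1 : R) H (H' t)) (cH' : continuous H')
  (H'L : forall t, `|H' t| <= L).
Variables (s : nat) (k lam : R).
Hypotheses (k0 : 0 < k) (lam01 : 0 < lam <= 1).

Definition flux x : 'rV[R]_(d + m) := A (grad U u x).
(** The integrand of the weak formulation for the test function H(u) testfun, with the
    gradient of the latter expanded. *)
Definition tested x : R :=
  (H' (u x) * testfun s k lam x * dotr (flux x) (grad U u x) +
   H (u x) * (\sum_i flux x ord0 i * dtestfun s k lam i x) +
   (a (u x) + g (u x)) * (H (u x) * testfun s k lam x)) * w x.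

(** The weak formulation itself, with a Borel integrand on the whole space. *)
Lemma testing : exists F : 'rV[R]_(d + m) -> R,
  [/\ L1 mu F, (\int[mu]_x (F x)%:E = 0)%E, {ae mu, forall x, D x -> F x = tested x} &
      forall x, ~ D x -> F x = 0].
Proof.
have k20 : 0 < (k ^+ 2)^-1 by rewrite invr_gt0 exprn_gt0.
have cP := @testfun_continuous R d m s k lam.
have cdP := @dtestfun_continuous R d m s k lam.
have dP := @is_derive_testfun R d m s k lam.
have bP := @testfun_bound R d m s k lam k0.
have bdP := @dtestfun_bound R d m s k lam k0 lam01.
have P0 := @testfun0 R d m s k lam k0.
have dP0 := @dtestfun0 R d m s k lam k0.
have [mF iF eF] := us (admissible_W1p p1 mw w0 w1 uW uL dH cH' H'L lam01 cP cdP dP k20 bP bdP P0 dP0)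
  (admissible_Linfty uW uL dH cH' H'L cP cdP dP k20 bP P0) (admissible_supp rad u H k20 P0).
have mD : measurable D by apply: open_measurable_rV; exact: Omega_open.
have [F [iF' hF F0]] := L1_repr mD mF iF.
exists F; split => //.
  rewrite (@integral_vanish _ _ setT D)//; last by move=> x _ /F0 ->.
  rewrite -eF; apply: ae_integral_eq; apply: filterS hF => x /[apply] -> //.
have gr := admissible_gradient uW dH cH' H'L cP cdP dP.
apply: filterS3 hF gr (@Gamma_null R d m m0) => x e1 e2 nG Dx; rewrite e1// e2; last by split.
rewrite /tested /flux; congr (_ * _).
rewrite -addrA -mulrDl; congr (_ + _).
rewrite /dotr !mulr_sumr -big_split/=; apply: eq_bigr => i _; rewrite mxE; ring.
Qed.

End testing.

Lemma weighted_combine (R : realFieldType) (f c b x a1 a2 a3 r1 r2 r3 : R) : 0 <= f ->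
  b <= a1 + a3 - a2 + c * x -> f * a1 <= r1 -> - (f * a2) <= r2 -> f * a3 <= r3 ->
  f * b <= r1 + r2 + r3 + c * (f * x).
Proof. by move=> f0 /(ler_wpM2l f0) h1 h2 h3 h4; lra. Qed.

(** * The energy estimate *)

Section estimate.
Context {R : realType}.
Variables (d m : nat) (rad : \bar R).
Local Notation mu := (@lebesgue_rV R (d + m)).
Local Notation D := (Omega d m rad).
Local Notation S := (Gamma d m).
Local Notation U := (D `\` S).
Variables (p q nu : R) (w u : 'rV[R]_(d + m) -> R) (A : 'rV[R]_(d + m) -> 'rV[R]_(d + m)) (a g : R -> R).
Hypotheses (p1 : 1 < p) (mw : measurable_fun setT w) (w0 : forall x, 0 < w x) (w1 : forall x, w x <= 1).
Hypotheses (uW : W1p_loc p D S w u) (uL : Linfty_loc D S u).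
Hypothesis us : weak_solution p D S w A a g u.
Hypothesis m0 : (0 < m)%N.
Hypotheses (nu0 : 0 < nu) (sig0 : 0 < q - p + 1).
Hypothesis coercive : forall eta, nu * enorm eta `^ p <= dotr (A eta) eta.
Hypothesis growth : forall eta, enorm (A eta) <= nu^-1 * enorm eta `^ (p - 1).
Hypothesis gsign : forall t, `|t| `^ q <= g t * Num.sg t.
Hypothesis asign : forall t, 0 <= a t * Num.sg t.

Section fixed_level.
Variables (kap M : R).
Hypotheses (kap01 : 0 < kap <= 2^-1) (M0 : 0 < M).
Local Notation H := (Htest kap M).
Local Notation H' := (dHtest kap M).
Local Notation e := (p * (q + 2 * kap) / (q - p + 1)).
Hypothesis em : e < m%:R.

Variables (lam0 C lam : R) (s : nat).
Hypotheses (lam00 : 0 < lam0) (C0 : 0 <= C) (lam01 : 0 < lam <= 1) (lamN : (d + m)%:R * lam <= lam0)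
  (es : e <= s.+2%:R).
Hypothesis absorb : forall t xi h dh X Y : R,
    M <= t -> 0 <= xi -> 0 <= h -> h <= t `^ (2 * kap) -> 2 * kap * h <= dh * t -> 0 <= X ->
    0 <= Y -> Y <= X + lam0 ->
    2^-1 * (t `^ q * h) <=
    nu * (dh * xi `^ p) + t `^ q * h - nu^-1 * (h * xi `^ (p - 1) * Y) + C * X `^ e.

Let e0 : 0 < e.
Proof.
have /andP[k0 _] := kap01; rewrite divr_gt0// mulr_gt0//; first by move: p1; lra.
by move: p1 sig0; lra.
Qed.

(** A set that contains the support of the gradient of the cutoff. *)
Definition tube (k : R) : set 'rV[R]_(d + m) :=
  [set x | forall j, j \in transversal (d := d) (m := m) -> `|x ord0 j| <= 2 / k].

(** The error of the energy estimate: the factor k^e against the mass of the envelope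
    in the tube, which is O(k^(-m)). *)
Definition excess (k : R) x : R :=
  C * (s.+2%:R * ((d + m)%:R * (8 * k))) `^ e * (envelope lam x * \1_(tube k) x).

Let excess_ge0 k x : 0 < k -> 0 <= excess k x.
Proof. by move=> k0; rewrite /excess !mulr_ge0 ?powR_ge0 ?envelope_ge0. Qed.

(** The cutoff appears to the power s + 2 >= e in [testfun], which absorbs its e-th
    power in the denominator. *)
Lemma testfun_power k x : 0 < k -> cutoff k x != 0 ->
  testfun s k lam x * (s.+2%:R * (\sum_(i < d + m) `|dcutoff k i x|) / cutoff k x) `^ e <=
  (s.+2%:R * ((d + m)%:R * (8 * k))) `^ e * (envelope lam x * \1_(tube k) x).
Proof.
move=> k0 zn0; have z0 : 0 < cutoff k x by rewrite lt_def zn0 cutoff_ge0.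
set y := \sum_(i < d + m) _; have y0 : 0 <= y by exact: sumr_ge0.
have E0 := envelope_ge0 lam x.
have [y00|yn0] := eqVneq y 0.
  rewrite y00 mulr0 mul0r powR0 ?mulr0 ?gt_eqF//.
  by rewrite !mulr_ge0 ?powR_ge0.
have xt : tube k x.
  have [i di] : exists i, dcutoff k i x != 0.
    apply: contrapT => h; move/eqP: yn0; apply; rewrite /y big1// => i _.
    by apply/normr0P/eqP; apply: contrapT => h2; apply: h; exists i; exact/eqP.
  by move=> j; exact: (dcutoff_supp k0 di).
rewrite indicE mem_set// mulr1.
set X := s.+2%:R * y / cutoff k x.
have X0 : 0 <= X by rewrite divr_ge0 ?mulr_ge0// ltW.
have Xz : s.+2%:R * y = X * cutoff k x by rewrite /X divfK.
have zpow : cutoff k x ^+ s.+2 <= cutoff k x `^ e.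
  rewrite -powR_mulrn ?(ltW z0)//; apply: ger_powR => //.
  by rewrite z0 cutoff_le1.
apply: (@le_trans _ _ (envelope lam x * (s.+2%:R * y) `^ e)).
  have -> : testfun s k lam x * X `^ e = envelope lam x * (X `^ e * cutoff k x ^+ s.+2).
    by rewrite /testfun mulrAC [RHS]mulrC; congr (_ * _); rewrite mulrC.
  rewrite Xz (powRM _ X0 (ltW z0)); apply: ler_wpM2l => //.
  by apply: ler_wpM2l => //; exact: powR_ge0.
rewrite mulrC ler_wpM2r//; apply: le_powR; [exact: ltW|by rewrite mulr_ge0|].
rewrite ler_wpM2l// /y; apply: (@le_trans _ _ (\sum_(i < d + m) (8 * k))).
  by apply: ler_sum => i _; exact: dcutoff_bound.
by rewrite sumr_const card_ord -[leLHS]mulr_natl.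
Qed.

(** [absorption] applied at the point x, multiplied by the test function. The three
    terms of [tested] are bounded from below by coercivity, by growth of A with
    [dtestfun_sum], and by the sign conditions on a and g. *)
Lemma tested_lower k x : 0 < k ->
  2^-1 * (`|u x| `^ q * `|H (u x)|) * testfun s k lam x * w x <=
  tested rad w u A a g H H' s k lam x + excess k x.
Proof.
move=> k0; rewrite /tested.
have ex0 := excess_ge0 x k0; have wx := w0 x; have wx1 := w1 x.
have [z0|zn0] := eqVneq (cutoff k x) 0.
  have Phi0 : testfun s k lam x = 0 by rewrite /testfun z0 exprS !mul0r.
  have dPhi0 i : dtestfun s k lam i x = 0.
    by rewrite /dtestfun z0 !exprS !(mul0r, mulr0) addr0.
  rewrite Phi0 !(mulr0, mul0r) big1 ?mulr0 ?addr0 ?mul0r ?add0r//.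
  by move=> i _; rewrite dPhi0 mulr0.
have [uM|Mu] := leP `|u x| M.
  rewrite (Htest_eq0 kap01 M0 uM) (dHtest_norm _ M0) dpower_profile0 ?subr_le0//.
  by rewrite !(mulr0, mul0r, addr0, add0r, normr0).
set Phi := testfun s k lam x; have Phi0 : 0 <= Phi by exact: testfun_ge0.
set xi := grad U u x; set h := `|H (u x)|; set t := `|u x|.
set B := flux rad u A x.
set y := \sum_(i < d + m) `|dcutoff k i x|.
have y0 : 0 <= y by exact: sumr_ge0.
pose X := s.+2%:R * y / cutoff k x; pose Y := X + (d + m)%:R * lam.
have z0 : 0 < cutoff k x by rewrite lt_def zn0 cutoff_ge0.
have X0 : 0 <= X by rewrite divr_ge0 ?mulr_ge0// ltW.
have /andP[l0 _] := lam01.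
have Y0 : 0 <= Y by rewrite addr_ge0// mulr_ge0// ltW.
have YX : Y <= X + lam0 by rewrite lerD2l.
have h0 : 0 <= h by exact: normr_ge0.
have abs := @absorb t (enorm xi) h (H' (u x)) X Y (ltW Mu) (enorm_ge0 xi) h0
  (Htest_growth kap01 M0 _) (Htest_derive kap01 M0 _) X0 Y0 YX.
have T1 : Phi * (nu * (H' (u x) * enorm xi `^ p)) <= H' (u x) * Phi * dotr B xi.
  have -> : Phi * (nu * (H' (u x) * enorm xi `^ p)) = H' (u x) * Phi * (nu * enorm xi `^ p) by ring.
  apply: ler_wpM2l; last exact: coercive.
  by apply: mulr_ge0 => //; exact: (dHtest_ge0 kap01 M0).
have T2 : - (Phi * (nu^-1 * (h * enorm xi `^ (p - 1) * Y))) <=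
    H (u x) * (\sum_i B ord0 i * dtestfun s k lam i x).
  have E : \sum_i B ord0 i * dtestfun s k lam i x = dotr B (\row_i dtestfun s k lam i x).
    by rewrite /dotr; apply: eq_bigr => i _; rewrite mxE.
  rewrite E; set Q := dotr B _.
  have Qb : `|Q| <= nu^-1 * enorm xi `^ (p - 1) * (Phi * Y).
    apply: le_trans (norm_dotr_le _ _) _; apply: ler_pM; rewrite ?enorm_ge0//.
    - exact: sumr_ge0.
    - exact: growth.
    under eq_bigr do rewrite mxE.
    exact: dtestfun_sum.
  have := ler_wpM2l h0 Qb; rewrite -normrM ler_norml => /andP[+ _].
  apply: le_trans; rewrite lerN2 le_eqVlt; apply/orP; left; apply/eqP; ring.
have T3 : Phi * (t `^ q * h) <= (a (u x) + g (u x)) * (H (u x) * Phi).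
  have -> : (a (u x) + g (u x)) * (H (u x) * Phi) =
     Phi * ((a (u x) * Num.sg (u x) + g (u x) * Num.sg (u x)) * h).
    by rewrite [H (u x)](Htest_sg kap01 M0) /h; ring.
  rewrite ler_wpM2l// ler_wpM2r//; have := asign (u x); have := gsign (u x).
  by rewrite -/t; lra.
set T := _ + _ + _ in T1 T2 T3 *.
have T4 : Phi * (2^-1 * (t `^ q * h)) <= T + C * (Phi * X `^ e).
  exact: weighted_combine Phi0 abs T1 T2 T3.
have T5 : C * (Phi * X `^ e) <= excess k x.
  by rewrite /excess -[leRHS]mulrA; apply: ler_wpM2l => //; exact: testfun_power.
have -> : 2^-1 * (t `^ q * h) * Phi * w x = Phi * (2^-1 * (t `^ q * h)) * w x by ring.
have : Phi * (2^-1 * (t `^ q * h)) * w x <= (T + excess k x) * w x.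
  by rewrite ler_wpM2r ?(ltW wx)//; move: T4 T5; lra.
move=> T6; apply: (le_trans T6); rewrite mulrDl lerD2l.
by rewrite ler_piMr.
Qed.

Definition energy x : R := 2^-1 * (`|u x| `^ q * `|H (u x)|) * envelope lam x * w x.

Let weighted_ge0 k x : 0 <= 2^-1 * (`|u x| `^ q * `|H (u x)|) * testfun s k lam x * w x.
Proof.
apply: mulr_ge0; last exact: ltW.
apply: mulr_ge0; last exact: testfun_ge0.
by apply: mulr_ge0 => //; apply: mulr_ge0 => //; exact: powR_ge0.
Qed.

Let mu_meas : lebesgue_measurable_fun U u.
Proof. exact: (solution_gradient uW).1.1. Qed.

Let menergy c : outer rad c `<=` U -> lebesgue_measurable_fun (outer rad c) energy.
Proof.
move=> OU; have mO := open_measurable_rV (@outer_open R d m rad c).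
have mu' := lebesgue_measurable_funS (open_measurable_rV (OmegaD_open (rad := rad))) mO OU mu_meas.
have mt (f : R -> R) : measurable_fun setT f -> lebesgue_measurable_fun (outer rad c) (fun x => f (u x)).
  by move=> mf; exact: lebesgue_measurable_fun_comp mu'.
apply: lebesgue_measurable_funM; last exact: lebesgue_measurable_funT.
apply: lebesgue_measurable_funM; last first.
  by apply: lebesgue_measurable_funT; exact: measurable_envelope.
apply: (mt (fun t => 2^-1 * (`|t| `^ q * `|H t|))).
apply: measurable_funM => //; apply: measurable_funM.
  by apply: (measurableT_comp (@measurable_powR R q)); exact: normr_measurable.
apply: measurableT_comp => //; apply: continuous_measurable_fun => t.
exact: is_derive_continuous (is_derive_Htest kap M t).
Qed.

(** Integrate [tested_lower]: the tested integrand has integral 0. On the set rho > c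
    the cutoff is 1 for k large, so the left-hand side does not depend on k. *)
Lemma energy_bound c : 0 < c -> exists2 B : R, 0 <= B & forall k, 0 < k -> 2 / k ^+ 2 <= c ->
  (\int[mu]_(x in outer rad c) `|energy x|%:E <= (B * k `^ (e - m%:R))%:E)%E.
Proof.
move=> c0; have [B1 B10 hB1] := @envelope_tube R lam lam01 (d + m) (@transversal d m).
rewrite card_transversal in hB1.
pose K := C * (s.+2%:R * ((d + m)%:R * 8)) `^ e.
have K0 : 0 <= K by rewrite mulr_ge0 ?powR_ge0.
exists (K * (B1 * 2 ^+ m)); first by rewrite !mulr_ge0// exprn_ge0.
move=> k k0 kc.
have [F [iF F0 hF Fout]] := testing p1 mw w0 w1 uW uL us m0
  (is_derive_Htest kap M) (dHtest_continuous (M := M)) (dHtest_bound kap01 M0) s k0 lam01.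
have mO := open_measurable_rV (@outer_open R d m rad c).
have mT : measurable (tube k).
  rewrite (_ : tube k = \bigcap_(j in transversal (d := d) (m := m)) [set x | `|x ord0 j| <= 2 / k]).
    apply: fin_bigcap_measurable => [|j _]; first exact: finite_finset.
    have mc : measurable_fun setT (fun x : 'rV[R]_(d + m) => `|x ord0 j|).
      by apply: measurableT_comp => //; exact: measurable_coord_rV.
    have := mc measurableT [set t | t <= 2 / k]; rewrite setTI; apply.
    by rewrite (_ : [set t | t <= 2 / k] = `]-oo, (2 / k)]%classic)// set_itvNyc.
  by apply/seteqP; split => x h j; exact: h.
have iP : L1 mu (excess k).
  apply: L1_scale; apply: L1_indic => //; exact: L1_envelope.
have FP0 : {ae mu, forall x, 0 <= F x + excess k x}.
  apply: filterS hF => x hx; have [Dx|nD] := pselect (D x); last first.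
    by rewrite Fout// add0r excess_ge0.
  rewrite hx//; apply: le_trans (tested_lower x k0).
  exact: weighted_ge0.
have OU : outer rad c `<=` U by apply: outer_sub; exact: ltW.
have men := menergy OU.
have iFP : L1 mu (fun x => F x + excess k x) by exact: L1D.
apply: le_trans (integral_dom mO men iFP _) _.
  apply: filterS hF => x hx Ox; have Dx : D x by case: Ox.
  have -> : energy x = 2^-1 * (`|u x| `^ q * `|H (u x)|) * testfun s k lam x * w x.
    by rewrite /energy /testfun cutoff_eq1 ?expr1n ?mul1r//; case: Ox => _ /ltW; apply: le_trans.
  rewrite ger0_norm; last exact: weighted_ge0.
  by rewrite hx//; exact: tested_lower.
rewrite (@ae_integral_eq _ _ _ _ _ _ (fun x => (F x)%:E + (excess k x)%:E)%E); last first.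
  by apply: filterS FP0 => x h _; rewrite ger0_norm.
rewrite (@integralD _ _ _ mu setT measurableT _ _ iF iP) F0 add0e.
have -> : (\int[mu]_x (EFin \o excess k) x = \int[mu]_x
    ((C * (s.+2%:R * ((d + m)%:R * (8 * k))) `^ e)%:E * (envelope lam x * \1_(tube k) x)%:E))%E.
  by apply: eq_integral => x _; rewrite /= /excess EFinM.
rewrite ge0_integralZl//; last 3 first.
- apply/measurable_EFinP; apply: measurable_funM => //; exact: measurable_envelope.
- by move=> x _; rewrite lee_fin mulr_ge0 ?envelope_ge0.
- by rewrite lee_fin mulr_ge0 ?powR_ge0.
have -> : (\int[mu]_x (envelope lam x * \1_(tube k) x)%:E = \int[mu]_(x in tube k) (envelope lam x)%:E)%E.
  rewrite [RHS]integral_mkcond; apply: eq_integral => x _.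
  by rewrite patchE indicE; case: (x \in tube k); rewrite ?mulr1 ?mulr0.
apply: (@le_trans _ _ ((C * (s.+2%:R * ((d + m)%:R * (8 * k))) `^ e)%:E * (B1 * (2 / k) ^+ m)%:E)%E).
  apply: lee_wpmul2l; first by rewrite lee_fin mulr_ge0 ?powR_ge0.
  by apply: hB1; rewrite divr_gt0.
rewrite -EFinM lee_fin.
have -> : s.+2%:R * ((d + m)%:R * (8 * k)) = (s.+2%:R * ((d + m)%:R * 8)) * k by ring.
rewrite powRM ?mulr_ge0//; last exact: ltW.
have -> : k `^ (e - m%:R) = k `^ e / k ^+ m.
  rewrite powRD; last by rewrite (gt_eqF k0) implybT.
  by rewrite powRN powR_mulrn// ltW.
rewrite exprMn exprVn /K le_eqVlt; apply/orP; left; apply/eqP.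
by move: (_ `^ e) (k `^ e) (k ^- m) (2 ^+ m) => r1 r2 r3 r4; ring.
Qed.

Lemma energy_integral0 c : 0 < c -> (\int[mu]_(x in outer rad c) `|energy x|%:E = 0)%E.
Proof.
move=> c0; apply/eqP; rewrite eq_le; apply/andP; split; last first.
  by apply: integral_ge0 => x _; rewrite lee_fin.
have [B B0 hB] := energy_bound c0.
apply/lee_addgt0Pr => eps eps0; rewrite add0e.
have me : 0 < m%:R - e by rewrite subr_gt0.
(* B k^(e-m) <= eps as soon as k >= y, while k >= 1 + 2/c gives 2/k^2 <= c *)
pose y := (B / eps) `^ (m%:R - e)^-1.
have y0 : 0 <= y by exact: powR_ge0.
pose k := 1 + 2 / c + y.
have c2 : 0 < 2 / c by rewrite divr_gt0.
have k1 : 1 <= k by rewrite /k -addrA lerDl addr_ge0// ltW.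
have k0 : 0 < k by exact: lt_le_trans k1.
apply: le_trans (hB k k0 _) _.
  rewrite ler_pdivrMr ?exprn_gt0// mulrC -ler_pdivrMr//.
  apply: (@le_trans _ _ k); first by rewrite /k; lra.
  by rewrite expr2 ler_peMl// ltW.
have -> : e - m%:R = - (m%:R - e) by rewrite opprB.
rewrite lee_fin powRN ler_pdivrMr ?powR_gt0// mulrC -ler_pdivrMr//.
have -> : B / eps = y `^ (m%:R - e).
  by rewrite /y -powRrM mulVf ?gt_eqF// powRr1// divr_ge0// ltW.
by apply: le_powR => //; [exact: ltW|rewrite /k; lra].
Qed.

(** The energy density is positive wherever |u| > M. *)
Lemma level_bound c : 0 < c -> {ae mu, forall x, outer rad c x -> `|u x| <= M}.
Proof.
move=> c0; have mO := open_measurable_rV (@outer_open R d m rad c).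
have OU : outer rad c `<=` U by apply: outer_sub; exact: ltW.
have := integral_abs_eq0 mO (menergy OU) (energy_integral0 c0).
apply: filterS => x hx Ox; rewrite leNgt; apply/negP => Mu.
have u0 : 0 < `|u x| by exact: lt_trans Mu.
have : 0 < energy x.
  apply: mulr_gt0 => //; apply: mulr_gt0; last exact: envelope_gt0.
  apply: mulr_gt0; first by rewrite invr_gt0.
  apply: mulr_gt0; first exact: powR_gt0.
  exact: (Htest_neq0 kap01 M0).
by rewrite hx// ltxx.
Qed.

End fixed_level.

Hypothesis codim : p * q / (q - p + 1) < m%:R.

Lemma level_bound_all M c : 0 < M -> 0 < c -> {ae mu, forall x, outer rad c x -> `|u x| <= M}.
Proof.
move=> M0 c0; have p0 : 0 < p by move: p1; lra.
(* the exponent e = p (q + 2 kap) / (q - p + 1) is less than m iff 2 kap < del *)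
pose del := m%:R * (q - p + 1) / p - q.
have del0 : 0 < del.
  rewrite subr_gt0 ltr_pdivlMr// mulrC; move: codim; rewrite ltr_pdivrMr//.
pose kap := Num.min 2^-1 (del / 4).
have kap01 : 0 < kap <= 2^-1.
  by rewrite lt_min invr_gt0 ltr0n divr_gt0//= ge_min lexx.
have kdel : 2 * kap < del.
  have : kap <= del / 4 by rewrite ge_min lexx orbT.
  by move: del0; lra.
have em : p * (q + 2 * kap) / (q - p + 1) < m%:R.
  rewrite ltr_pdivrMr// mulrC -ltr_pdivlMr//.
  by move: kdel; rewrite /del; lra.
have k20 : 0 < 2 * kap by case/andP: kap01 => k0 _; rewrite mulr_gt0.
have [lam0 [C [lam00 C0 absorb]]] := absorption p1 sig0 k20 nu0 M0.
pose N : R := (d + m)%:R.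
have N0 : 0 < N by rewrite ltr0n addn_gt0 m0 orbT.
pose lam := Num.min 1 (lam0 / N).
have lam01 : 0 < lam <= 1 by rewrite lt_min ltr01 divr_gt0//= ge_min lexx.
have lamN : (d + m)%:R * lam <= lam0.
  rewrite mulrC -ler_pdivlMr//; by rewrite ge_min lexx orbT.
have es : p * (q + 2 * kap) / (q - p + 1) <= m.+2%:R.
  by apply: ltW; apply: lt_le_trans em _; rewrite ler_nat -addn2 leq_addr.
exact: (level_bound kap01 M0 em C0 lam01 lamN es absorb).
Qed.

Lemma solution_eq0 : {ae mu, forall x, U x -> u x = 0}.
Proof.
have : {ae mu, forall x j k, outer rad j.+1%:R^-1 x -> `|u x| <= k.+1%:R^-1}.
  apply: ae_foralln => j; apply: ae_foralln => k.
  by apply: level_bound_all; rewrite invr_gt0.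
apply: filterS => x hx; rewrite -outer_bigcup => -[j _ xj].
apply/eqP; apply: contrapT => /negP u0; have {}u0 : 0 < `|u x| by rewrite normr_gt0.
have [k _ hk] := near_infty_natSinv_lt (PosNum u0).
have hk' : k.+1%:R^-1 < `|u x| := hk k (leqnn k).
by have := le_lt_trans (hx j k xj) hk'; rewrite ltxx.
Qed.

End estimate.

(** * Functions that vanish almost everywhere *)

Section zero.
Context {R : realType} {n : nat}.
Implicit Types (V : set 'rV[R]_n) (u f : 'rV[R]_n -> R).
Local Notation mu := (@lebesgue_rV R n).

Lemma ae0_lebesgue_measurable V f : {ae mu, forall x, V x -> f x = 0} -> lebesgue_measurable_fun V f.
Proof.
move=> h; apply: (@eq_ae_lebesgue_measurable _ _ _ (fun=> 0)).
  by apply: filterS h => x /[apply] ->.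
exact: lebesgue_measurable_funT.
Qed.

Lemma ae0_integral V (f : 'rV[R]_n -> \bar R) : {ae mu, forall x, V x -> f x = 0%E} ->
  (\int[mu]_(x in V) f x = 0)%E.
Proof. by move=> h; rewrite (ae_integral_eq h) integral0. Qed.

Lemma ae0_loc_integrable V f : {ae mu, forall x, V x -> f x = 0} -> loc_integrable V f.
Proof.
move=> h; split; first exact: ae0_lebesgue_measurable.
move=> K KV _; rewrite ae0_integral ?ltry//.
by apply: filterS h => x hx /KV /hx ->; rewrite normr0.
Qed.

Lemma weak_gradient0 V u : {ae mu, forall x, V x -> u x = 0} -> weak_gradient V u (fun=> 0).
Proof.
move=> h; split; first exact: ae0_loc_integrable.
move=> i; split; first by apply: ae0_loc_integrable; apply: aeW => x _; rewrite mxE.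
move=> f _; rewrite !ae0_integral ?oppe0//.
  by apply: aeW => x _; rewrite mxE mul0r.
by apply: filterS h => x /[apply] ->; rewrite mul0r.
Qed.

Lemma grad_ae0 V u : open V -> {ae mu, forall x, V x -> u x = 0} ->
  {ae mu, forall x, V x -> grad V u x = 0}.
Proof.
by move=> oV /weak_gradient0 h; exact: weak_gradient_unique oV (grad_weak_gradient h) h.
Qed.

Lemma open_not_null V x : open V -> V x -> {ae mu, forall x, ~ V x} -> False.
Proof.
move=> oV Vx [N [mN N0 VN]].
have [r r0 rV] := open_obox_sub oV Vx.
pose b1 i := x ord0 i - r; pose b2 i := x ord0 i + r.
have : (mu (obox b1 b2) <= mu N)%E.
  apply: le_measure; rewrite ?inE//; first exact: measurable_obox.
  by move=> y /obox_cbox /rV Vy; apply: VN => /=; apply.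
have b12 i : b1 i < b2 i by rewrite /b1 /b2; lra.
rewrite N0 lebesgue_rV_obox; last by move=> i; exact: ltW.
rewrite lee_fin leNgt => /negP; apply; apply: prodr_gt0 => i _.
by rewrite subr_gt0.
Qed.

End zero.

(** * Removability *)

Section conclusion.
Context {R : realType}.
Variables (d m : nat) (rad : \bar R).
Local Notation mu := (@lebesgue_rV R (d + m)).
Local Notation D := (Omega d m rad).
Local Notation S := (Gamma d m).
Local Notation U := (D `\` S).
Variables (p q nu : R) (w u : 'rV[R]_(d + m) -> R) (A : 'rV[R]_(d + m) -> 'rV[R]_(d + m)) (a g : R -> R).
Hypotheses (p1 : 1 < p) (mw : measurable_fun setT w) (w0 : forall x, 0 < w x) (w1 : forall x, w x <= 1).
Hypotheses (uW : W1p_loc p D S w u) (uL : Linfty_loc D S u).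
Hypothesis us : weak_solution p D S w A a g u.
Hypotheses (m0 : (0 < m)%N) (rad0 : (0 < rad)%E).
Hypotheses (nu0 : 0 < nu) (sig0 : 0 < q - p + 1).
Hypothesis coercive : forall eta, nu * enorm eta `^ p <= dotr (A eta) eta.
Hypothesis growth : forall eta, enorm (A eta) <= nu^-1 * enorm eta `^ (p - 1).
Hypothesis gsign : forall t, `|t| `^ q <= g t * Num.sg t.
Hypothesis asign : forall t, 0 <= a t * Num.sg t.
Hypothesis codim : p * q / (q - p + 1) < m%:R.

Lemma flux0 : A 0 = 0.
Proof.
apply: enorm_eq0; apply/eqP; rewrite eq_le enorm_ge0 andbT.
apply: le_trans (growth 0) _; rewrite enorm0 powR0 ?mulr0// subr_eq0 gt_eqF//.
Qed.

Let u0U : {ae mu, forall x, U x -> u x = 0}.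
Proof. exact: (solution_eq0 p1 mw w0 w1 uW uL us m0 nu0 sig0 coercive growth gsign asign codim). Qed.

Lemma solution_ae0 : {ae mu, forall x, D x -> u x = 0}.
Proof. by apply: filterS2 u0U (@Gamma_null R d m m0) => x h nG Dx; apply: h. Qed.

Lemma Omega_point : exists2 x, D x & 0 < rho x.
Proof.
have [t t0 tr] : exists2 t : R, 0 < t & (t%:E < rad)%E.
  move: rad0; case: rad => [r| |] // r0; last by exists 1 => //; rewrite ltry.
  by exists (r / 2); rewrite ?lte_fin in r0 *; lra.
pose i := rshift d (Ordinal m0).
have E : rho (t *: unit_rV i) = t ^+ 2.
  rewrite /rho (bigD1 i)//= big1 ?addr0; last first.
    by move=> j ji; rewrite !mxE (negbTE ji) andbF mulr0 expr0n mulr0.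
  by rewrite inE/= leq_addr !mxE !eqxx mulr1 mul1r.
exists (t *: unit_rV i); last by rewrite E exprn_gt0.
by rewrite /Omega /oball /= enorm_rsubmx E sqrtr_sqr gtr0_norm.
Qed.

(** With u = 0 the tested integrand is (a(0) + g(0)) times a function that is positive
    away from Gamma, and its integral is 0. The sign conditions say nothing about the
    value of a + g at 0, so the equation has to be used. *)
Lemma reaction0 : a 0 + g 0 = 0.
Proof.
apply: contrapT => /eqP c0.
have [x0 Dx0 r0] := Omega_point.
pose c := rho x0 / 2; have cc0 : 0 < c by rewrite divr_gt0.
pose k := 1 + 2 / c.
have c2 : 0 < 2 / c by rewrite divr_gt0.
have k1 : 1 <= k by rewrite lerDl ltW.
have k0 : 0 < k by exact: lt_le_trans k1.
have kc : 2 / k ^+ 2 <= c.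
  rewrite ler_pdivrMr ?exprn_gt0// mulrC -ler_pdivrMr//.
  apply: (@le_trans _ _ k); first by rewrite /k; lra.
  by rewrite expr2 ler_peMl// ltW.
(* the nonlinearity H is the constant 1: the test function is cutoff^2 times the
   envelope *)
have lam01 : 0 < (1 : R) <= 1 by rewrite ltr01 lexx.
have dH (t : R) : is_derive t (1 : R) (cst (1 : R)) (cst 0 t) by exact: is_derive_cst.
have cH' : continuous (cst (0 : R) : R -> R) by exact: cst_continuous.
have H'L (t : R) : `|cst (0 : R) t| <= 0 by rewrite normr0.
have [F [iF F0 hF Fout]] := testing p1 mw w0 w1 uW uL us m0 dH cH' H'L 0%N k0 lam01.
have FE : {ae mu, forall x, D x -> F x = (a 0 + g 0) * (testfun 0 k 1 x * w x)}.
  have gU := grad_ae0 (@OmegaD_open R d m rad) u0U.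
  have gD : {ae mu, forall x, D x -> grad U u x = 0}.
    by apply: filterS2 gU (@Gamma_null R d m m0) => x h nG Dx; apply: h.
  apply: filterS3 hF solution_ae0 gD => x e1 e2 e3 Dx; rewrite e1// /tested /flux e2// e3//.
  rewrite flux0 /= !mul0r add0r big1 ?mulr0 ?add0r ?mul1r ?mulrA//.
  by move=> i _; rewrite mxE mul0r.
have Z0 : (\int[mu]_x `|F x|%:E = 0)%E.
  have E : {ae mu, forall x, setT x -> `|F x|%:E = ((Num.sg (a 0 + g 0))%:E * (F x)%:E)%E}.
    apply: filterS FE => x e _; rewrite -EFinM; congr EFin.
    have [Dx|nD] := pselect (D x); last by rewrite Fout// normr0 mulr0.
    rewrite e// normrM [X in X * _]normrEsg -mulrA; do 2 congr (_ * _).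
    by rewrite ger0_norm// mulr_ge0 ?testfun_ge0// ltW.
  by rewrite (ae_integral_eq E) integralZl// F0 mule0.
have := integral_abs_eq0 measurableT (lebesgue_measurable_funT _ (L1_measurable iF)) Z0.
move=> F00; apply: (@open_not_null R _ (outer rad c) x0); first exact: outer_open.
  by split => //=; rewrite /c; lra.
apply: filterS2 FE F00 => x e1 e2 Ox; have Dx : D x by case: Ox.
have cE : testfun 0 k 1 x = envelope 1 x.
  by rewrite /testfun cutoff_eq1 ?expr1n ?mul1r//; case: Ox => _ /ltW; apply: le_trans.
have := e2 I; rewrite e1// cE => /eqP; rewrite !mulf_eq0 (negbTE c0)/=.
by rewrite (gt_eqF (envelope_gt0 1 x)) (gt_eqF (w0 x)).
Qed.

(** All integrands vanish almost everywhere, since u, grad u, A(0) and a(0) + g(0) do. *)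
Theorem solution_removable : removable p D w A a g u.
Proof.
have p0 : p != 0 by rewrite gt_eqF// (lt_trans _ p1).
have oD : open D by exact: Omega_open.
have gD := grad_ae0 oD solution_ae0.
split.
- split.
  + split; first exact: ae0_lebesgue_measurable solution_ae0.
    rewrite ae0_integral ?ltry//.
    by apply: filterS solution_ae0 => x /[apply] ->; rewrite normr0 powR0// mul0r.
  + exact: grad_weak_gradient (weak_gradient0 solution_ae0).
  + split.
      apply: ae0_lebesgue_measurable; apply: filterS gD => x /[apply] ->; exact: enorm0.
    rewrite ae0_integral ?ltry//.
    by apply: filterS gD => x /[apply] ->; rewrite enorm0 normr0 powR0// mul0r.
- apply: (@bound_Linfty _ _ _ _ 0) => //; first exact: ae0_lebesgue_measurable solution_ae0.
  by apply: filterS solution_ae0 => x /[apply] ->; rewrite normr0.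
move=> phi _ _; rewrite /integral_identity.
set F := fun x => _.
have F0 : {ae mu, forall x, D x -> F x = 0}.
  apply: filterS2 gD solution_ae0 => x e1 e2 Dx; rewrite /F e1// e2// flux0.
  rewrite /dotr big1 ?add0r; last by move=> i _; rewrite mxE mul0r.
  by rewrite -mulrDl reaction0 !mul0r.
split.
- exact: ae0_lebesgue_measurable.
- by rewrite ae0_integral ?ltry//; apply: filterS F0 => x h /h; rewrite /F => ->; rewrite normr0.
- by rewrite ae0_integral//; apply: filterS F0 => x h /h; rewrite /F => ->.
Qed.

End conclusion.

Section vartheta.
Context {R : realType} {n : nat}.
Variable alpha : R.
Hypothesis alpha0 : 0 <= alpha.

Lemma measurable_vartheta : measurable_fun setT (@vartheta R n alpha).
Proof.
apply: (measurableT_comp (@measurable_powR R (- alpha))).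
apply: measurable_funD => //.
have ms : measurable_fun setT (@Num.sqrt R).
  by apply: continuous_measurable_fun; exact: sqrt_continuous.
have md : measurable_fun setT (fun x : 'rV[R]_n => dotr x x).
  by apply: measurable_sum => i; apply: measurable_funM; exact: measurable_coord_rV.
exact: measurableT_comp ms md.
Qed.

Lemma vartheta_gt0 (x : 'rV[R]_n) : 0 < vartheta alpha x.
Proof. by apply: powR_gt0; have := enorm_ge0 x; lra. Qed.

Lemma vartheta_le1 (x : 'rV[R]_n) : vartheta alpha x <= 1.
Proof.
rewrite -[leRHS](powRr0 (1 + enorm x)); apply: ler_powR; last by rewrite oppr_le0.
by rewrite lerDl enorm_ge0.
Qed.

End vartheta.

Theorem corollary1p4 (R : realType) (d m : nat) (rad : \bar R)
    (A : 'rV[R]_(d + m) -> 'rV[R]_(d + m)) (g b a : R -> R)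
    (p q alpha beta mu mu1 : R)
    (N_ge3 : (3 <= d + m)%N) (codim_ge2 : (2 <= m)%N) (rad_gt0 : (0 < rad)%E)
    (mA : measurable_fun setT A)
    (mg : measurable_fun setT g) (mb : measurable_fun setT b)
    (bg : loc_bounded g) (bb : loc_bounded b)
    (H1 : structure_H1 A g b p q alpha beta mu mu1)
    (H2 : structure_H2 A)
    (ma : measurable_fun setT a) (ba : loc_bounded a)
    (Ha : forall t, mu1 * `|t| `^ (p - 1) <= a t * Num.sg t) :
  (Num.max (p * q / (q - p + 1)) (p ^+ 2 / (p - 1)) < m%:R -> 0 < mu1 ->
   forall u : 'rV[R]_(d + m) -> R,
     W1p_loc p (Omega d m rad) (Gamma d m) (fun=> 1) u ->
     Linfty_loc (Omega d m rad) (Gamma d m) u ->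
     assumption_A1 rad u ->
     weak_solution p (Omega d m rad) (Gamma d m) (fun=> 1) A a g u ->
     removable p (Omega d m rad) (fun=> 1) A a g u)
  /\
  (p * q / (q - p + 1) < m%:R -> 0 <= mu1 ->
   forall u : 'rV[R]_(d + m) -> R,
     W1p_loc p (Omega d m rad) (Gamma d m) (vartheta alpha) u ->
     Linfty_loc (Omega d m rad) (Gamma d m) u ->
     assumption_A2 rad p q alpha u ->
     weak_solution p (Omega d m rad) (Gamma d m) (vartheta alpha) A a g u ->
     removable p (Omega d m rad) (vartheta alpha) A a g u).
Proof.
have [coer grow gs _ /andP[p1 _] /andP[al0 _] _ _ sig0 nu0 mu10] := H1.
have m0 : (0 < m)%N by exact: leq_trans codim_ge2.
have as_ t : 0 <= a t * Num.sg t.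
  by apply: le_trans (Ha t); rewrite mulr_ge0 ?powR_ge0.
split.
  rewrite gt_max => /andP[codim _] _ u uW uL _ us.
  exact: (solution_removable p1 (measurable_cst _) (fun=> ltr01) (fun=> lexx _) uW uL us
    m0 rad_gt0 nu0 sig0 coer grow gs as_ codim).
move=> codim _ u uW uL _ us.
exact: (solution_removable p1 (measurable_vartheta alpha) (vartheta_gt0 alpha) (vartheta_le1 al0)
  uW uL us m0 rad_gt0 nu0 sig0 coer grow gs as_ codim).
Qed.
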